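(* Let $\mathfrak X(P)^K_{\rm flat}$ be the set of all flat vector fields on $P$. (i) $\mathfrak X(P)^K_{\rm flat}$ is a $\mathcal J$-submodule of $\mathfrak X(P)^K$. (ii) If $X,Y\in\mathfrak X(P)^K_{\rm flat}$ correspond to the maps $\Phi,\Psi:P\to\mathfrak p$ respectively (that is, $X=\tilde\Phi$, $Y=\tilde\Psi$), then $[X,Y]=Z$, where $Z$ is the flat vector field corresponding to the map $\Phi\circledast\Psi$, $\Phi\circledast\Psi(y)=d\Psi_y(y\Phi(y))-d\Phi_y(y\Psi(y))$ for $y\in P$. Hence $\mathfrak X(P)^K_{\rm flat}$ is a Lie subalgebra of $\mathfrak X(P)^K$.
   Context: $G\subset \mathrm{GL}(N,\mathbf C)$ is a connected complex reductive linear algebraic group, $\theta$ an involutive automorphism of $G$ (its differential on $\mathfrak g$ is also denoted $\theta$), $K=G^\theta$, and $\mathfrak g=\mathfrak k+\mathfrak p$ the decomposition into $\pm1$-eigenspaces of $\theta$. $P=\{g\theta(g)^{-1}:g\in G\}\subset G$ is a closed irreducible subset, isomorphic to $G/K$ via the Cartan embedding $j:G/K\to P$, $gK\mapsto g\theta(g)^{-1}$. $K$ acts on $P$ by conjugation; $\mathfrak X(P)^K$ is the Lie algebra of $K$-invariant regular vector fields on $P$. $\mathcal J=\mathbf C[G/K]^K$ is identified with $\mathbf C[P]^K$ via $j$ and acts by pointwise multiplication. For $y\in P$ put $\theta_y=(\mathrm{Ad}\,y)^{-1}\theta$, an involution of $\mathfrak g$, let $\mathfrak p_y$ be its $-1$-eigenspace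 and $\pi_y=\frac12(1-\theta_y)$ the projection onto $\mathfrak p_y$; then $T_yP=y\,\mathfrak p_y$ (matrix product). For a regular map $\Phi:P\to\mathfrak g$, $\tilde\Phi$ is the regular vector field on $P$ given by $\tilde\Phi f(y)=\frac{d}{dt}f(y+ty\pi_y\Phi(y))|_{t=0}$ for $f\in\mathbf C[P]$ ($f$ extended to a regular function on $\mathrm{GL}(N,\mathbf C)$). The vector field $\tilde\Phi$ is called flat if (a) $\Phi$ takes values in $\mathfrak p$ and is $K$-equivariant: $\Phi(kyk^{-1})=\mathrm{Ad}(k)\Phi(y)$ for $k\in K$, $y\in P$; and (b) $\mathrm{Ad}(y)\Phi(y)=\Phi(y)$ for all $y\in P$. For a flat field, $\Phi(y)\in\mathfrak p_y$, so $y\Phi(y)\in T_yP$ and $\tilde\Phi f(y)=\frac{d}{dt}f(y+ty\Phi(y))|_{t=0}$; $d\Phi_y:T_yP\to\mathfrak p$ denotes the differential. *)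

(* Defs.v *)
From HB Require Import structures.
From mathcomp Require Import all_boot all_order all_algebra.
From mathcomp Require Import perm complex.
From mathcomp Require Import boolp classical_sets functions reals.
From mathcomp Require Import topology normedtype derive.

Set Implicit Arguments.
Unset Strict Implicit.
Unset Printing Implicit Defensive.

Import Order.TTheory GRing.Theory Num.Theory numFieldNormedType.Exports.

Local Open Scope classical_set_scope.
Local Open Scope ring_scope.
Local Open Scope complex_scope.

Section RegularFunctions.
Context {R : realType} {N : nat}.
Local Notation C := R[i].
Local Notation M := 'M[C]_N.
Implicit Types (A B : set M) (F H : M -> C) (x y v : M).

(* C[GL(N)] = C[x_ij, 1/det].  Its elements are represented by total functions
   on matrices; only their values on invertible matrices are meaningful. *)
Inductive regularGL : (M -> C) -> Prop :=
| regularGL_const c : regularGL (fun=> c)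
| regularGL_coord i j : regularGL (fun x => x i j)
| regularGL_invdet : regularGL (fun x => (\det x)^-1)
| regularGL_add F H :
    regularGL F -> regularGL H -> regularGL (fun x => F x + H x)
| regularGL_mul F H :
    regularGL F -> regularGL H -> regularGL (fun x => F x * H x).

Definition lineD F y v : C := derive1 (fun t : C => F (y + t *: v) : C^o) 0.

Definition zariski_closed A : Prop :=
  exists2 S : set (M -> C), S `<=` regularGL
    & A = [set x | x \in unitmx /\ forall F, S F -> F x = 0].

Definition zariski_connected A : Prop :=
  forall B1 B2, zariski_closed B1 -> zariski_closed B2 ->
    A `<=` B1 `|` B2 -> A `&` B1 `&` B2 = set0 ->
    A `&` B1 = set0 \/ A `&` B2 = set0.

Definition tangent A y : set M :=
  [set v | forall F, regularGL F -> (forall x, A x -> F x = 0) ->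
                     lineD F y v = 0].

(* For A Zariski closed in GL(N) (or in a closed subset of it), this is
   membership in C[A]. *)
Definition regular_on A (f : A -> C) : Prop :=
  exists2 F, regularGL F & forall y : A, f y = F (val y).

Definition regular_map A (Phi : A -> M) : Prop :=
  forall i j, regular_on (fun z => Phi z i j).

(* A chosen regular extension to GL(N) of a regular function on A (and 0 if
   there is none). *)
Definition extend A (f : A -> C) : M -> C :=
  xget (fun=> 0) [set F | regularGL F /\ forall y : A, f y = F (val y)].

(* For v tangent to A at y this does not depend on the chosen extensions, see
   [lineD_extend] below. *)
Definition diffmx A (Phi : A -> M) y v : M :=
  \matrix_(i, j) lineD (extend (fun z => Phi z i j)) y v.

Lemma regularGL_sum (I : Type) (r : seq I) (p : pred I) (F : I -> M -> C) :
  (forall i, regularGL (F i)) -> regularGL (fun x => \sum_(i <- r | p i) F i x).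
Proof.
move=> hF; elim: r => [|i r IHr].
  by under eq_fun do rewrite big_nil; exact: regularGL_const.
under eq_fun do rewrite big_cons.
by case: (p i) => //; exact: regularGL_add.
Qed.

Lemma regularGL_prod (I : Type) (r : seq I) (p : pred I) (F : I -> M -> C) :
  (forall i, regularGL (F i)) -> regularGL (fun x => \prod_(i <- r | p i) F i x).
Proof.
move=> hF; elim: r => [|i r IHr].
  by under eq_fun do rewrite big_nil; exact: regularGL_const.
under eq_fun do rewrite big_cons.
by case: (p i) => //; exact: regularGL_mul.
Qed.

Lemma regularGL_det n (V : M -> 'M[C]_n) :
  (forall i j, regularGL (fun x => V x i j)) -> regularGL (fun x => \det (V x)).
Proof.
move=> hV; apply: regularGL_sum => s; apply: regularGL_mul.
  exact: regularGL_const.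
by apply: regularGL_prod => i.
Qed.

Lemma regularGL_mulmx (V W : M -> M) :
  (forall i j, regularGL (fun x => V x i j)) ->
  (forall i j, regularGL (fun x => W x i j)) ->
  forall i j, regularGL (fun x => (V x *m W x) i j).
Proof.
move=> hV hW i j; under eq_fun do rewrite mxE.
by apply: regularGL_sum => k; apply: regularGL_mul.
Qed.

Lemma regularGL_adj i j : regularGL (fun x => (\det x)^-1 * (\adj x) i j).
Proof.
apply: regularGL_mul; first exact: regularGL_invdet.
under eq_fun do rewrite mxE /cofactor.
apply: regularGL_mul; first exact: regularGL_const.
apply: regularGL_det => k l; under eq_fun do rewrite !mxE.
exact: regularGL_coord.
Qed.

Lemma invmx_adjE x i j : x \in unitmx ->
  invmx x i j = (\det x)^-1 * (\adj x) i j.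
Proof. by move=> ux; rewrite /invmx ux mxE. Qed.

Lemma is_derive_line_coord y v i j :
  is_derive (0 : C^o) 1 (fun t : C^o => (y + t *: v) i j : C^o) (v i j).
Proof.
under eq_fun do rewrite !mxE.
have -> : (fun t : C^o => y i j + t * v i j : C^o) =
          cst (y i j : C^o) + (v i j : C) *: (@id C^o).
  by apply/funext => t; rewrite /= mulrC.
have h := is_deriveD (is_derive_cst (y i j : C^o) (0 : C^o) 1)
  (is_deriveZ (v i j : C) (is_derive_id (0 : C^o) 1)).
by rewrite add0r [_ *: 1]mulr1 in h.
Qed.

Definition has_line_derivative F (D : M -> M -> C) :=
  [/\ forall y v, y \in unitmx ->
        is_derive (0 : C^o) 1 (fun t : C^o => F (y + t *: v) : C^o) (D y v),
      forall y v w a, D y (a *: v + w) = a * D y v + D y w &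
      forall V : M -> M, (forall i j, regularGL (fun x => V x i j)) ->
        regularGL (fun y => D y (V y))].

Lemma hld_const c : has_line_derivative (fun=> c) (fun _ _ => 0).
Proof.
split=> [y v _|y v w a|V hV]; first exact: is_derive_cst.
- by rewrite mulr0 addr0.
- exact: regularGL_const.
Qed.

Lemma hld_coord i j : has_line_derivative (fun x => x i j) (fun _ v => v i j).
Proof.
split=> [y v _|y v w a|V hV]; first exact: is_derive_line_coord.
- by rewrite !mxE.
- exact: hV.
Qed.

Lemma hld_add F H DF DH : has_line_derivative F DF -> has_line_derivative H DH ->
  has_line_derivative (fun x => F x + H x) (fun y v => DF y v + DH y v).
Proof.
move=> [dF lF rF] [dH lH rH]; split=> [y v uy|y v w a|V hV].
- exact: (is_deriveD (dF y v uy) (dH y v uy)).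
- by rewrite lF lH mulrDr addrACA.
- by apply: regularGL_add; [exact: rF|exact: rH].
Qed.

Lemma hld_mul F H DF DH : regularGL F -> regularGL H ->
  has_line_derivative F DF -> has_line_derivative H DH ->
  has_line_derivative (fun x => F x * H x)
    (fun y v => F y * DH y v + H y * DF y v).
Proof.
move=> gF gH [dF lF rF] [dH lH rH]; split=> [y v uy|y v w a|V hV].
- have := is_deriveM (dF y v uy) (dH y v uy).
  by rewrite /= scale0r addr0.
- by rewrite lF lH !mulrDr !(mulrCA _ a) addrACA.
- by apply: regularGL_add; apply: regularGL_mul => //; [exact: rH|exact: rF].
Qed.

Lemma hld_sum (I : Type) (r : seq I) (F : I -> M -> C) :
  (forall i, exists D, has_line_derivative (F i) D) ->
  exists D, has_line_derivative (fun x => \sum_(i <- r) F i x) D.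
Proof.
move=> hF; elim: r => [|i r [D hD]].
  rewrite (_ : (fun _ => _) = fun=> 0); last by apply/funext => x; rewrite big_nil.
  by eexists; exact: hld_const.
rewrite (_ : (fun _ => _) = fun x => F i x + \sum_(j <- r) F j x);
  last by apply/funext => x; rewrite big_cons.
by have [Di hDi] := hF i; eexists; exact: hld_add hDi hD.
Qed.

Lemma hld_prod (I : Type) (r : seq I) (F : I -> M -> C) :
  (forall i, regularGL (F i)) ->
  (forall i, exists D, has_line_derivative (F i) D) ->
  exists D, has_line_derivative (fun x => \prod_(i <- r) F i x) D.
Proof.
move=> gF hF; elim: r => [|i r [D hD]].
  rewrite (_ : (fun _ => _) = fun=> 1); last by apply/funext => x; rewrite big_nil.
  by eexists; exact: hld_const.
rewrite (_ : (fun _ => _) = fun x => F i x * \prod_(j <- r) F j x);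
  last by apply/funext => x; rewrite big_cons.
have [Di hDi] := hF i; eexists; apply: hld_mul hDi hD => //.
exact: regularGL_prod.
Qed.

Lemma hld_det : exists D, has_line_derivative (fun x => \det x) D.
Proof.
apply: hld_sum => s.
have [||D hD] := @hld_prod _ (index_enum 'I_N) (fun i x => x i (s i)).
- by move=> i; exact: regularGL_coord.
- by move=> i; eexists; exact: hld_coord.
eexists; apply: (hld_mul _ _ (hld_const _) hD).
  exact: regularGL_const.
by apply: regularGL_prod => i; exact: regularGL_coord.
Qed.

Lemma regularGL_hld F : regularGL F -> exists D, has_line_derivative F D.
Proof.
elim=> [c|i j||{}F H gF [DF hF] gH [DH hH]|{}F H gF [DF hF] gH [DH hH]].
- by eexists; exact: hld_const.
- by eexists; exact: hld_coord.
- have [D [dD lD rD]] := hld_det.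
  exists (fun y v => - ((\det y)^-1 * (\det y)^-1 * D y v)).
  split=> [y v uy|y v w a|V hV].
  + have d0 : \det y != 0 by rewrite -unitfE -unitmxE.
    have dy := dD y v uy.
    have d0' : (fun t : C^o => \det (y + t *: v) : C^o) 0 != 0.
      by rewrite /= scale0r addr0.
    split; first by apply: derivableV => //; exact: ex_derive.
    rewrite deriveV //.
    rewrite derive_val /= scale0r addr0 expr2 invfM.
    exact: mulNr.
  + by rewrite lD mulrDr opprD (mulrCA _ a) mulrN.
  + under eq_fun do rewrite -mulN1r.
    apply: regularGL_mul; first exact: regularGL_const.
    apply: regularGL_mul; last exact: rD.
    by apply: regularGL_mul; exact: regularGL_invdet.
- by eexists; exact: hld_add hF hH.
- by eexists; exact: hld_mul hF hH.
Qed.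

Lemma lineDE F D y v : has_line_derivative F D -> y \in unitmx ->
  lineD F y v = D y v.
Proof. by move=> [dF _ _] uy; rewrite /lineD derive1E; have [] := dF y v uy. Qed.

Lemma lineD_linear F y a v w : regularGL F -> y \in unitmx ->
  lineD F y (a *: v + w) = a * lineD F y v + lineD F y w.
Proof.
move=> /regularGL_hld[D hD] uy; rewrite !(lineDE _ hD) //.
by have [_ lD _] := hD; exact: lD.
Qed.

Lemma extendP A (f : A -> C) : regular_on f ->
  regularGL (extend f) /\ forall y : A, f y = extend f (val y).
Proof.
move=> [F gF fF]; rewrite /extend; case: xgetP => [F' -> //|].
by move=> /(_ F)/not_andP[].
Qed.

Lemma regularGL_extend A (f : A -> C) : regularGL (extend f).
Proof.
rewrite /extend; case: xgetP => [F -> []//|_]; exact: regularGL_const.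
Qed.

Lemma lineD_extend A (f : A -> C) F y v : A `<=` [set x | x \in unitmx] ->
  A y -> tangent A y v -> regularGL F -> (forall z : A, f z = F (val z)) ->
  lineD (extend f) y v = lineD F y v.
Proof.
move=> AGL Ay tv gF fF.
have [gE fE] : regularGL (extend f) /\ forall z : A, f z = extend f (val z).
  by apply: extendP; exists F.
have gd : regularGL (fun x => extend f x + -1 * F x).
  by apply: regularGL_add => //; apply: regularGL_mul => //; exact: regularGL_const.
have uy : y \in unitmx by exact: AGL.
have [DE hE] := regularGL_hld gE; have [DF hF] := regularGL_hld gF.
have d0 : lineD (fun x => extend f x + -1 * F x) y v = 0.
  apply: (tv _ gd) => x Ax.
  by rewrite mulN1r -[x]/(val (exist _ x (mem_set Ax) : A)) -fE -fF subrr.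
have hE' := hld_add hE (hld_mul (regularGL_const _) gF (hld_const (-1)) hF).
rewrite (lineDE v hE' uy) in d0; rewrite (lineDE v hE uy) (lineDE v hF uy).
by move: d0; rewrite mulr0 addr0 mulN1r => /eqP; rewrite subr_eq0 => /eqP.
Qed.

(* The coordinate ring C[A]. *)
Definition regular_pred A : pred (A -> C^o) := fun f => `[< @regular_on A f >].
Arguments regular_pred A : clear implicits.

Record coord_ring A := CoordRing {
  coord_fun :> A -> C^o ;
  _ : coord_fun \in regular_pred A }.

HB.instance Definition _ A := [isSub for @coord_fun A].
HB.instance Definition _ A := [Choice of coord_ring A by <:].

Lemma regular_pred_subring A : subring_closed (regular_pred A).
Proof.
split=> [|f g /asboolP[F gF hF] /asboolP[H gH hH]
         |f g /asboolP[F gF hF] /asboolP[H gH hH]]; apply/asboolP.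
- by exists (fun=> 1) => //; exact: regularGL_const.
- exists (fun x => F x + -1 * H x) => [|y]; last by rewrite -hF -hH mulN1r.
  by apply: regularGL_add => //; apply: regularGL_mul => //; exact: regularGL_const.
- by exists (fun x => F x * H x) => [|y]; [exact: regularGL_mul|rewrite -hF -hH].
Qed.

HB.instance Definition _ A :=
  GRing.SubChoice_isSubComPzRing.Build _ _ (coord_ring A)
    (@regular_pred_subring A).

Lemma regular_pred_submod A : subsemimod_closed (regular_pred A).
Proof.
split=> [|a f /asboolP[F gF hF]].
  split=> [|f g /asboolP[F gF hF] /asboolP[H gH hH]]; apply/asboolP.
    by exists (fun=> 0) => //; exact: regularGL_const.
  by exists (fun x => F x + H x) => [|y]; [exact: regularGL_add|rewrite -hF -hH].
apply/asboolP; exists (fun x => a * F x) => [|y]; last by rewrite -hF.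
by apply: regularGL_mul => //; exact: regularGL_const.
Qed.

HB.instance Definition _ A :=
  GRing.SubZmodule_isSubLmodule.Build _ _ _ (coord_ring A)
    (@regular_pred_submod A).

(* [to_coord f] is f as an element of C[A], and 0 if f is not regular. *)
Definition to_coord A (f : A -> C) : coord_ring A := insubd 0 (f : A -> C^o).

Lemma to_coordE A (f : A -> C) : regular_on f -> to_coord f = f :> (A -> C).
Proof. by move=> hf; apply: insubdK; exact/asboolP. Qed.

End RegularFunctions.
Arguments coord_ring {R N} A.

Section AlgebraicGroups.
Context {R : realType} {N : nat}.
Local Notation C := R[i].
Local Notation M := 'M[C]_N.

(* Closed subgroups of GL(N). *)
Definition algebraic_group (G : set M) : Prop :=
  [/\ zariski_closed G, G 1%:M,
      forall g h, G g -> G h -> G (g *m h) &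
      forall g, G g -> G (invmx g)].

Definition unipotent (U : set M) : Prop :=
  forall u, U u -> exists m : nat, (u - 1%:M) ^+ m = 0.

(* The unipotent radical is trivial. *)
Definition reductive (G : set M) : Prop :=
  algebraic_group G /\
  forall U : set M, algebraic_group U -> zariski_connected U -> unipotent U ->
    U `<=` G -> (forall g u, G g -> U u -> U (g *m u *m invmx g)) ->
    U = [set 1%:M].

(* theta is a total function on matrices; only its restriction to G matters. *)
Definition involutive_automorphism (G : set M) (theta : M -> M) : Prop :=
  [/\ forall g, G g -> G (theta g),
      regular_map (fun g : G => theta (val g)),
      forall g h, G g -> G h -> theta (g *m h) = theta g *m theta h &
      forall g, G g -> theta (theta g) = g].

End AlgebraicGroups.

Section SymmetricSpace.
Context {R : realType} {N : nat}.
Local Notation C := R[i].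
Local Notation M := 'M[C]_N.
Variables (G : set M) (theta : M -> M).

Definition Lie_algebra : set M := tangent G 1%:M.

Definition dtheta (x : M) : M := diffmx (fun g : G => theta (val g)) 1%:M x.

Definition fixed_group : set M := [set g | G g /\ theta g = g].

Definition sym_space : set M := [set g *m invmx (theta g) | g in G].

Local Notation K := fixed_group.
Local Notation P := sym_space.
Local Notation CP := (coord_ring P).

Definition p_space : set M := [set x | Lie_algebra x /\ dtheta x = - x].

(* theta_y = Ad(y)^-1 o theta *)
Definition theta_at (y x : M) : M := invmx y *m dtheta x *m y.

Definition proj_at (y x : M) : M := 2^-1 *: (x - theta_at y x).

(* The action of K on P by conjugation: k y k^-1 is in P for k in K, see
   [kactE]. *)
Definition kact (k : M) (y : P) : P := insubd y (k *m val y *m invmx k).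

Definition pullback (k : M) (f : CP) : CP := to_coord (fun y => f (kact k y)).

(* C[P]^K *)
Definition invariants : set CP := [set f | forall k, K k -> pullback k f = f].

(* Vector fields on the affine variety P are the derivations of C[P]. *)
Definition vector_fields : set (CP -> CP) :=
  [set X : CP -> CP |
    (forall (a : C) (f g : CP), X (a *: f + g) = a *: X f + X g) /\
    (forall f g : CP, X (f * g) = X f * g + f * X g)].

Definition invariant_vector_fields : set (CP -> CP) :=
  [set X | vector_fields X /\
           forall k f, K k -> X (pullback k f) = pullback k (X f)].

Definition lie_bracket (X Y : CP -> CP) : CP -> CP :=
  fun f => X (Y f) - Y (X f).

Definition submodule (J : set CP) (S T : set (CP -> CP)) : Prop :=
  [/\ S `<=` T, S (fun=> 0),
      forall X Y, S X -> S Y -> S (fun f => X f + Y f) &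
      forall g X, J g -> S X -> S (fun f => g * X f)].

Definition lie_subalgebra (S T : set (CP -> CP)) : Prop :=
  [/\ S `<=` T, S (fun=> 0),
      forall (a : C) X Y, S X -> S Y -> S (fun f => a *: X f + Y f) &
      forall X Y, S X -> S Y -> S (lie_bracket X Y)].

(* For Phi regular the formula does define an element of C[P], see [tildeE]. *)
Definition tilde (Phi : P -> M) (f : CP) : CP :=
  to_coord (fun y : P =>
    lineD (extend f) (val y) (val y *m proj_at (val y) (Phi y))).

Definition flat_map (Phi : P -> M) : Prop :=
  [/\ regular_map Phi,
      forall y, p_space (Phi y),
      forall k y, K k -> Phi (kact k y) = k *m Phi y *m invmx k &
      forall y, val y *m Phi y *m invmx (val y) = Phi y].

Definition flat_vector_fields : set (CP -> CP) :=
  [set X | exists2 Phi, flat_map Phi & X = tilde Phi].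

Definition circledast (Phi Psi : P -> M) (y : P) : M :=
  diffmx Psi (val y) (val y *m Phi y) - diffmx Phi (val y) (val y *m Psi y).

Lemma regularGL_conj (k l : M) (F : M -> C) : l *m k = 1%:M -> regularGL F ->
  regularGL (fun y => F (k *m y *m l)).
Proof.
move=> kl; elim=> [c|i j||{}F H gF hF gH hH|{}F H gF hF gH hH].
- exact: regularGL_const.
- apply: (regularGL_mulmx (V := fun y => k *m y) (W := fun=> l)) => {}i {}j.
    apply: (regularGL_mulmx (V := fun=> k) (W := fun y => y)) => {}i {}j.
      exact: regularGL_const.
    exact: regularGL_coord.
  exact: regularGL_const.
- rewrite (_ : (fun _ => _) = fun y => (\det y)^-1); first exact: regularGL_invdet.
  by apply/funext => y; rewrite !det_mulmx mulrC mulrA -det_mulmx kl det1 mul1r.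
- exact: regularGL_add.
- exact: regularGL_mul.
Qed.

Lemma regularGL_lineD1 (F : M -> C) (V : M -> M) : regularGL F ->
  (forall i j, regularGL (fun x => V x i j)) ->
  regularGL (fun x => lineD F 1%:M (V x)).
Proof.
move=> gF gV.
have u1 : (1%:M : M) \in unitmx by exact: unitmx1.
have F0 : lineD F 1%:M 0 = 0.
  by have := lineD_linear 1 0 0 gF u1; rewrite scaler0 addr0 mul1r => /eqP;
     rewrite -subr_eq subrr eq_sym => /eqP.
have Fsum I (r : seq I) (c : I -> C) (v : I -> M) :
    lineD F 1%:M (\sum_(i <- r) c i *: v i) =
    \sum_(i <- r) c i * lineD F 1%:M (v i).
  elim: r => [|i r IHr]; first by rewrite !big_nil.
  by rewrite !big_cons lineD_linear// IHr.
rewrite (_ : (fun _ => _) = fun x => \sum_i \sum_j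
    V x i j * lineD F 1%:M (delta_mx i j)).
  apply: regularGL_sum => i; apply: regularGL_sum => j.
  by apply: regularGL_mul => //; exact: regularGL_const.
apply/funext => x; rewrite [in LHS](matrix_sum_delta (V x)).
by rewrite pair_big/= Fsum pair_big.
Qed.

Hypotheses (hG : algebraic_group G) (htheta : involutive_automorphism G theta).

Lemma group_unitmx (g : M) : G g -> g \in unitmx.
Proof. by have [[S _ ->] _ _ _] := hG => -[]. Qed.

Lemma sym_space_unitmx (y : M) : P y -> y \in unitmx.
Proof.
have [hth _ _ _] := htheta; case=> g Gg <-.
by rewrite unitmx_mul unitmx_inv !group_unitmx//; exact: hth.
Qed.

Lemma kactE (k : M) (y : P) : K k -> val (kact k y) = k *m val y *m invmx k.
Proof.
move=> [Gk thk]; apply: insubdK; rewrite inE.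
have /set_mem[g Gg <-] := valP y; have [_ _ thM _] := htheta.
have [_ _ GM _] := hG; have [hth _ _ _] := htheta.
exists (k *m g); first exact: GM.
have uk := group_unitmx Gk; have ug := group_unitmx (hth _ Gg).
rewrite thM// thk -!mulmxA; congr (_ *m (_ *m _)).
have ukg : k *m theta g \in unitmx by rewrite unitmx_mul uk ug.
rewrite -[RHS](mulmxK ukg) mulmxA -[X in X *m _ *m _]mulmxA mulVmx// mulmx1.
by rewrite mulVmx ?mul1mx//; exact: group_unitmx (hth _ Gg).
Qed.

Lemma pullbackE (k : M) (f : CP) (y : P) : K k ->
  pullback k f y = f (kact k y).
Proof.
move=> Kk; rewrite /pullback to_coordE//.
have /asboolP[F gF hF] := valP f; have [Gk _] := Kk.
exists (fun y => F (k *m y *m invmx k)).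
  by apply: regularGL_conj => //; rewrite mulVmx// group_unitmx.
by move=> z; rewrite hF kactE.
Qed.

Lemma tildeE (Phi : P -> M) (f : CP) (y : P) : regular_map Phi ->
  tilde Phi f y = lineD (extend f) (val y) (val y *m proj_at (val y) (Phi y)).
Proof.
move=> rPhi; rewrite /tilde to_coordE//.
have /asboolP rf := valP f; have [gE _] := extendP rf.
have [D hD] := regularGL_hld gE; have [_ _ rD] := hD.
pose Phi' (x : M) : M := \matrix_(i, j) extend (fun z : P => Phi z i j) x.
have gPhi' i j : regularGL (fun x => Phi' x i j).
  by under eq_fun do rewrite mxE; exact: regularGL_extend.
have Phi'E (z : P) : Phi z = Phi' (val z).
  by apply/matrixP => i j; rewrite mxE; have [_ ->] := extendP (rPhi i j).
pose I' (x : M) : M := \matrix_(i, j) ((\det x)^-1 * (\adj x) i j).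
have gI' i j : regularGL (fun x => I' x i j).
  by under eq_fun do rewrite mxE; exact: regularGL_adj.
pose T (x : M) := dtheta (Phi' x).
have gT i j : regularGL (fun x => T x i j).
  under eq_fun do rewrite mxE.
  by apply: regularGL_lineD1 => //; exact: regularGL_extend.
pose V x := x *m (2^-1 *: (Phi' x - I' x *m T x *m x)).
exists (fun x => D x (V x)).
  apply: rD => i j; apply: regularGL_mulmx => {}i {}j.
    exact: regularGL_coord.
  have gB : regularGL (fun x => (I' x *m T x *m x) i j).
    apply: (regularGL_mulmx (V := fun x => I' x *m T x) (W := fun x => x)).
      exact: regularGL_mulmx.
    exact: regularGL_coord.
  rewrite (_ : (fun _ => _) =
      fun x => 2^-1 * (Phi' x i j + -1 * (I' x *m T x *m x) i j)).
    apply: regularGL_mul; first exact: regularGL_const.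
    apply: regularGL_add => //; apply: regularGL_mul => //.
    exact: regularGL_const.
  apply/funext => x; rewrite mulN1r.
  by rewrite mxE; congr (_ * _); rewrite mxE; congr (_ + _); rewrite mxE.
move=> z; have uz := sym_space_unitmx (set_mem (valP z)).
rewrite (lineDE _ hD uz) /V /proj_at /theta_at /T -Phi'E.
suff -> : I' (val z) = invmx (val z) by [].
by apply/matrixP => i j; rewrite mxE (invmx_adjE _ _ uz).
Qed.

End SymmetricSpace.

(* Main.v *)
(* Everything is formal except that [Phi y] and [Psi y] commute for flat [Phi]
   and [Psi]: both the flatness of [Phi \circledast Psi] and the formula for the
   bracket reduce to it.  Differentiating [y Phi = Phi y] along [y Psi] shows
   that the commutator [xi] of [Phi] and [Psi] satisfies [y xi = [y, a]] for some
   [a]; as [xi] commutes with [y], it vanishes wherever [y] is diagonalizable.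

   Suppose [xi <> 0] somewhere on P, and choose [y] with the maximal number of
   distinct eigenvalues among the points of P with [xi y <> 0].  On the open set
   [xi <> 0] the eigenvalues cannot split further at [y], so to first order the
   traces [tr (f x)], for [f] vanishing on the spectrum of [y], do not vary along
   the tangent vectors [x y - y (d theta) x] of P.  If [nu] is the logarithm of
   the unipotent part of [y], this says that [nu] lies in the radical of the form
   [tr (x w) + tr ((d theta) x (d theta) w)] on the Lie algebra of G.  Since the
   Lie algebra contains the complex conjugates of the semisimple parts of its
   elements, this radical consists of nilpotent matrices; as it is stable under
   Ad G, Engel's theorem gives [tr (nu g) = 0] for all [g] in G, so the unipotent
   part of [y] lies in [U = {u | tr (u g) = tr g for all g in G}].  This is a
   normal unipotent subgroup of G, connected because it contains the curves
   [t |-> u ^ t], hence trivial as G is reductive.  So [y] is diagonalizable, and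
   [xi y = 0], a contradiction.

   Semisimple parts are obtained from the action on the functions on GL(N): a
   subspace stable under an operator is stable under functions of its semisimple
   part. *)

From HB Require Import structures.
Require Import Defs.
From mathcomp Require Import all_boot all_order all_algebra separable.
From mathcomp Require Import perm complex ring.
From mathcomp Require Import boolp classical_sets functions reals.
From mathcomp Require Import topology normedtype derive.

Set Implicit Arguments.
Unset Strict Implicit.
Unset Printing Implicit Defensive.

Import Order.TTheory GRing.Theory Num.Theory numFieldNormedType.Exports.

Local Open Scope classical_set_scope.
Local Open Scope ring_scope.
Local Open Scope complex_scope.

(** * Spectrum and interpolation *)

(** Density of the diagonalizable points of P is classically read off from Cartan subspaces or a
    compact form. Here G is only a closed group of matrices with trivial unipotent radical, so
    density is replaced by a local extremal choice. The trace form of GL(N) takes the place of the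
    Killing form. As theta need not preserve it, it is symmetrized; this is also the shape that the
    tangent vectors force, because (d theta) nu = - nu. Complex conjugation enters as a merely
    additive map on eigenvalues: under a derivation the weights of a product of functions add up, so
    additivity is enough to pass from the coordinates to all regular functions. Statements along u ^
    t are checked at natural exponents, where they concern powers of u, and extend to all t because
    they are polynomial in t. *)

Section MatrixSpectrum.
Context {C : numClosedFieldType} {n : nat}.
Local Notation M := 'M[C]_n.+1.
Implicit Types (x T : M) (p q : {poly C}) (s : seq C).

Lemma horner_mx_trig T p : is_trig_mx T ->
  is_trig_mx (horner_mx T p) /\ forall i, horner_mx T p i i = p.[T i i].
Proof.
move=> /is_trig_mxP tT; elim/poly_ind: p => [|p c [/is_trig_mxP tp dp]].
  by rewrite rmorph0; split=> [|i]; rewrite ?mx0_is_trig// mxE horner0.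
rewrite rmorphD rmorphM /= horner_mx_X horner_mx_C.
split=> [|i]; first apply/is_trig_mxP => i j ij.
  rewrite 2!mxE big1 => [|k _]; last first.
    case: (ltnP i k) => [/tp->|ki]; first by rewrite mul0r.
    by rewrite tT ?mulr0//; exact: leq_ltn_trans ij.
  by rewrite mxE add0r -(inj_eq val_inj) (ltn_eqF ij).
rewrite hornerMXaddC 2!mxE (bigD1 i)//= big1 => [|k ki]; last first.
  case: (ltngtP i k) => [/tp->|/tT->|/val_inj ik]; rewrite ?mul0r ?mulr0//.
  by rewrite ik eqxx in ki.
by rewrite addr0 dp [X in _ + X]mxE eqxx mulr1n.
Qed.

(** Schur triangularization: a polynomial in a triangular matrix has the values of the polynomial on
    its diagonal. The list keeps multiplicities, which traces and determinants need. *)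
Lemma spectrum_exists x : exists s,
  [/\ char_poly x = \prod_(z <- s) ('X - z%:P),
      forall p, \tr (horner_mx x p) = \sum_(z <- s) p.[z] &
      forall p, \det (horner_mx x p) = \prod_(z <- s) p.[z]].
Proof.
have [P /unitarymx_unit uP tT] := Schur x (ltn0Sn n).
pose T := P *m x *m invmx P; rewrite /similar_to conjumx// -/T in tT.
have xE p : horner_mx x p = invmx P *m horner_mx T p *m P.
  by rewrite horner_mx_uconj// !mulmxA mulVmx// mul1mx mulmxKV.
exists [seq T i i | i <- enum 'I_n.+1]; split=> [|p|p].
- rewrite big_map big_enum -(char_poly_trig tT) /char_poly.
  have uPX : map_mx polyC P \in unitmx by rewrite map_unitmx.
  have -> : char_poly_mx T =
      map_mx polyC P *m char_poly_mx x *m invmx (map_mx polyC P).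
    rewrite /char_poly_mx /T !map_mxM map_invmx mulmxBr mulmxBl.
    by rewrite scalar_mxC mulmxK.
  by rewrite !det_mulmx det_inv mulrAC divrr ?mul1r// -unitmxE.
- rewrite xE mxtrace_mulC mulmxA mulmxV// mul1mx big_map big_enum.
  by apply: eq_bigr => i _; have [_ ->] := horner_mx_trig p tT.
- rewrite xE !det_mulmx mulrAC -det_mulmx mulVmx// det1 mul1r big_map big_enum.
  have [/det_trig-> dT] := horner_mx_trig p tT.
  by apply: eq_bigr => i _; rewrite dT.
Qed.

Definition spectrum x : seq C := sval (cid (spectrum_exists x)).

Lemma char_poly_spectrum x :
  char_poly x = \prod_(z <- spectrum x) ('X - z%:P).
Proof. by rewrite /spectrum; case: cid => s []. Qed.

Lemma trace_horner_mx x p : \tr (horner_mx x p) = \sum_(z <- spectrum x) p.[z].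
Proof. by rewrite /spectrum; case: cid => s []. Qed.

Lemma det_horner_mx x p : \det (horner_mx x p) = \prod_(z <- spectrum x) p.[z].
Proof. by rewrite /spectrum; case: cid => s []. Qed.

Lemma size_spectrum x : size (spectrum x) = n.+1.
Proof.
have := size_char_poly x.
by rewrite char_poly_spectrum size_prod_XsubC => -[].
Qed.

Lemma coprimep_XsubC_exp (a b : C) k l : a != b ->
  coprimep (('X - a%:P) ^+ k) (('X - b%:P) ^+ l).
Proof.
move=> ab; apply/coprimep_expl/coprimep_expr/coprimep_XsubC2.
by rewrite subr_eq0 eq_sym.
Qed.

Lemma coprimep_prod_XsubC_exp s (a : C) k l : a \notin s ->
  coprimep (('X - a%:P) ^+ k) (\prod_(z <- s) ('X - z%:P) ^+ l z).
Proof.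
elim: s => [|b s IHs]; first by rewrite big_nil coprimep1.
rewrite inE big_cons negb_or => /andP[ab /IHs cs].
by rewrite coprimepMr cs coprimep_XsubC_exp.
Qed.

Lemma dvdp_prod_XsubC_exp s (k : C -> nat) q : uniq s ->
  (forall z, z \in s -> ('X - z%:P) ^+ k z %| q) ->
  \prod_(z <- s) ('X - z%:P) ^+ k z %| q.
Proof.
elim: s => [|a s IHs] /=; first by rewrite big_nil dvd1p.
move=> /andP[as_ us] h; rewrite big_cons Gauss_dvdp ?h ?mem_head//=.
  by apply: IHs => // z zs; apply: h; rewrite inE zs orbT.
exact: coprimep_prod_XsubC_exp.
Qed.

(** No multiplicity exceeds the size [n.+1], so this single exponent serves at every eigenvalue and
    the sizes of Jordan blocks never matter. *)
Lemma horner_mx_eq0 x q :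
  (forall z, z \in spectrum x -> ('X - z%:P) ^+ n.+1 %| q) -> horner_mx x q = 0.
Proof.
move=> h; apply/mxminpoly_minP/(dvdp_trans (mxminpoly_dvd_char x)).
rewrite char_poly_spectrum -prodr_undup_exp_count.
apply: dvdp_prod_XsubC_exp => [|z]; first exact: undup_uniq.
rewrite mem_undup => /h; apply: dvdp_trans; apply: dvdp_exp2l.
by rewrite -(size_spectrum x) count_size.
Qed.

(** Chinese remainder theorem. Since [p] agrees with the constant [f z] to order [k], for large [k]
    it yields [f] of the semisimple part of a matrix. *)
Lemma hermite_interpolation (f : C -> C) k s :
  exists p, forall z, z \in s -> ('X - z%:P) ^+ k %| p - (f z)%:P.
Proof.
suff H t : uniq t ->
    exists p, forall z, z \in t -> ('X - z%:P) ^+ k %| p - (f z)%:P.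
  have [p hp] := H _ (undup_uniq s).
  by exists p => z zs; apply: hp; rewrite mem_undup.
elim: t => [|a t IHt] /=; first by exists 0.
move=> /andP[at_ /IHt[p hp]].
have /Bezout_eq1_coprimepP[[u v] /= uv] :=
  @coprimep_prod_XsubC_exp t a k (fun=> k) at_.
set Q := \prod_(_ <- _) _ in uv *.
(* Modulo the [k]-th power of ['X - a%:P] the factor [v * Q] is 1, and it vanishes to order [k] at
   the other nodes, so only the residue at [a] changes. *)
exists (p + v * Q * ((f a)%:P - p)) => z; rewrite inE => /orP[/eqP->|zt].
  have -> : p + v * Q * ((f a)%:P - p) - (f a)%:P =
      u * ('X - a%:P) ^+ k * (p - (f a)%:P).
    have -> : v * Q = 1 - u * ('X - a%:P) ^+ k by rewrite -uv addrC addKr.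
    ring.
  by rewrite dvdp_mulr// dvdp_mull.
rewrite addrAC; apply: dvdp_add; first exact: hp.
apply/dvdp_mulr/dvdp_mull; rewrite /Q (big_rem z zt)/=; exact: dvdp_mulIl.
Qed.

End MatrixSpectrum.

(** * Engel's theorem through traces *)

(** Infinitely many natural roots suffice. This form is needed when only some of the powers of a
    unipotent matrix are known to lie in a closed set. *)
Lemma poly_frequently_eq0 (K : numDomainType) (q : {poly K}) :
  (forall k : nat, exists2 m, (k <= m)%N & q.[m%:R] = 0) -> q = 0.
Proof.
have [d] := ubnP (size q); elim: d q => // d IHd q qd h.
have [m _ /rootP/factor_theorem[p qE]] := h 0%N.
suff p0 : p = 0 by rewrite qE p0 mul0r.
have [->//|p0] := eqVneq p 0.
apply: IHd => [|k].
  by move: qd; rewrite qE size_Mmonic ?monicXsubC// size_XsubC addn2.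
have [l kl] := h (maxn k m.+1).
rewrite qE hornerM hornerXsubC => /eqP; rewrite mulf_eq0 subr_eq0 eqr_nat.
rewrite (gtn_eqF (leq_trans (leq_maxr _ _) kl)) orbF => /eqP pl.
by exists l => //; exact: leq_trans (leq_maxl _ _) kl.
Qed.

Lemma poly_nat_eq0 (K : numDomainType) (q : {poly K}) :
  (forall k : nat, q.[k%:R] = 0) -> q = 0.
Proof. by move=> h; apply: poly_frequently_eq0 => k; exists k. Qed.

Section NilpotentMatrices.
Context {C : numClosedFieldType} {n : nat}.
Local Notation M := 'M[C]_n.+1.
Implicit Types (x y a b : M) (p q : {poly C}) (s : seq M).

Lemma spectrum_nilp x k z : x ^+ k = 0 -> z \in spectrum x -> z = 0.
Proof.
move=> xk zs; have : root (mxminpoly x) z.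
  by rewrite root_mxminpoly char_poly_spectrum root_prod_XsubC.
have /dvdpP[q qE] : mxminpoly x %| 'X^k.
  by apply/mxminpoly_minP; rewrite rmorphXn /= horner_mx_X.
move=> /rootP rz; have := congr1 (horner^~ z) qE.
by rewrite hornerM rz mulr0 hornerXn => /eqP; rewrite expf_eq0 => /andP[_ /eqP].
Qed.

Lemma trace_nilp x k : x ^+ k = 0 -> \tr x = 0.
Proof.
move=> xk; rewrite -[x]horner_mx_X trace_horner_mx.
by apply: big1_seq => z /andP[_ zs]; rewrite hornerX (spectrum_nilp xk zs).
Qed.

Lemma interpolation (f : C -> C) (s : seq C) :
  exists p, forall z, z \in s -> p.[z] = f z.
Proof.
have [p hp] := hermite_interpolation f 1 s; exists p => z /hp.
by rewrite expr1 dvdp_XsubCl => /rootP/eqP;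
  rewrite hornerD hornerN hornerC subr_eq0 => /eqP.
Qed.

Lemma nilp_spectrum x : (forall z, z \in spectrum x -> z = 0) -> x ^+ n.+1 = 0.
Proof.
move=> h; rewrite -[x in LHS]horner_mx_X -rmorphXn.
by apply: horner_mx_eq0 => z /h->; rewrite subr0.
Qed.

(** A polynomial that is 0 at 0 and 1 at the nonzero eigenvalues takes at [x] a value whose trace
    counts these eigenvalues; without constant term, that value is a combination of positive powers
    of [x]. *)
Lemma nilp_trace x : (forall k, \tr (x ^+ k.+1) = 0) -> x ^+ n.+1 = 0.
Proof.
move=> h; apply: nilp_spectrum => z zs; apply/eqP/negPn/negP => z0.
(* The node 0 is added in case [x] is invertible. *)
have [p hp] := interpolation (fun z => (z != 0)%:R) (0 :: spectrum x).
have /factor_theorem[q pE] : root p 0 by rewrite /root hp ?mem_head// eqxx.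
have tr0 r k : \tr (horner_mx x r * x ^+ k.+1) = 0.
  elim/poly_ind: r k => [|r c IHr] k; first by rewrite rmorph0 mul0r mxtrace0.
  rewrite rmorphD rmorphM /= horner_mx_X horner_mx_C mulrDl -mulrA -exprS.
  by rewrite mxtraceD IHr add0r -scalemx1 -scalerAl mxtraceZ mul1r h mulr0.
have : \tr (horner_mx x p) = 0.
  by rewrite pE subr0 rmorphM /= horner_mx_X -[x in _ * x]expr1 tr0.
rewrite trace_horner_mx big_seq (eq_bigr (fun z => (z != 0)%:R)); last first.
  by move=> w ws; rewrite hp// inE ws orbT.
move=> /eqP; rewrite psumr_eq0 // => /allP/(_ _ zs).
by rewrite zs z0 /= oner_eq0.
Qed.

(* The partial products applied to a row vector are [n.+2] vectors [w i] of a
   space of dimension [n.+1].  A linear relation between them, with first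
   nonzero coefficient at [j], gives [w j = w j *m b] with [b] nilpotent. *)
Lemma nil_algebra_prod (A : M -> Prop) s :
  (forall a b, A a -> A b -> A (a + b)) -> (forall c a, A a -> A (c *: a)) ->
  (forall a b, A a -> A b -> A (a * b)) -> (forall a, A a -> a ^+ n.+1 = 0) ->
  (forall a, a \in s -> A a) -> size s = n.+1 -> \prod_(a <- s) a = 0.
Proof.
move=> AD AZ AM Anil As ss.
apply/row_matrixP => i0; rewrite row0; set u := row _ _.
pose w (i : 'I_n.+2) : 'rV[C]_n.+1 := row i0 (\prod_(a <- take i s) a).
pose W := \matrix_i w i.
have kW : kermx W != 0.
  by rewrite kermx_eq0 /row_free ltn_eqF// ltnS rank_leq_col.
have [c /sub_kermxP cW c0] := rowV0Pn kW.
have /rV0Pn[j0 cj0] : c != 0 by [].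
case: (arg_minnP (P := fun i => c 0 i != 0) (@nat_of_ord _) cj0) => j cj jmin.
have wP (i : 'I_n.+2) : (j < i)%N -> exists2 b, A b & w i = w j *m b.
  move=> ji; exists (\prod_(a <- drop j (take i s)) a).
    have : forall a, a \in drop j (take i s) -> A a.
      by move=> a /mem_drop/mem_take; exact: As.
    have : drop j (take i s) != [::].
      have si : size (take i s) = i by rewrite size_takel// ss -ltnS ltn_ord.
      by rewrite -size_eq0 size_drop si subn_eq0 -ltnNge.
    elim: (drop _ _) => // a t IHt _ h; rewrite big_cons.
    case: t IHt h => [|b t] IHt h.
      by rewrite big_nil mulr1; apply: h; exact: mem_head.
    apply: AM; first by apply: h; exact: mem_head.
    by apply: IHt => // d dt; apply: h; rewrite inE dt orbT.
  rewrite /w -[in LHS](cat_take_drop j (take i s)) big_cat /= take_takel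
    1?ltnW//.
  by rewrite row_mul.
have wN : w ord_max = u by rewrite /w /u take_oversize// ss.
suff wj0 : w j = 0.
  rewrite -wN; have [jm|/wP[b _ ->]] := leqP (ord_max : 'I_n.+2) j;
    last by rewrite wj0 mul0mx.
  suff <- : j = ord_max :> 'I_n.+2 by [].
  by apply/ord_inj/eqP; rewrite eqn_leq jm andbT -ltnS ltn_ord.
have [b Ab wb] : exists2 b, A b \/ b = 0 & w j = w j *m b.
  have cwE : \sum_i c 0 i *: w i = 0.
    rewrite -[RHS]cW; apply/rowP => k; rewrite summxE !mxE.
    by apply: eq_bigr => i _; rewrite !mxE.
  rewrite (bigD1 j)//= in cwE.
  have [b Ab bE] : exists2 b, A b \/ b = 0 & \sum_(i | i != j) c 0 i *: w i =
    w j *m b.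
    elim/big_rec: _ => [|i t ij [b Ab ->]];
      first by exists 0; [right|rewrite mulmx0].
    have [ci0|ci0] := eqVneq (c 0 i) 0;
      first by exists b; rewrite ?ci0 ?scale0r ?add0r.
    have /wP[b' Ab' ->] : (j < i)%N.
      by rewrite ltn_neqAle eq_sym (inj_eq val_inj) ij jmin.
    exists (c 0 i *: b' + b); last by rewrite mulmxDr scalemxAr.
    left; case: Ab => [Ab|->]; last by rewrite addr0; exact: AZ.
    by apply: AD => //; exact: AZ.
  rewrite bE in cwE; exists (- (c 0 j)^-1 *: b).
    by case: Ab => [/AZ Ab|->]; [left|right; rewrite scaler0].
  rewrite -scalemxAr; move/eqP: cwE; rewrite addrC addr_eq0 => /eqP->.
  by rewrite scalerN scaleNr opprK scalerA mulVf// scale1r.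
have wbk k : w j = w j *m b ^+ k.
  elim: k => [|k IHk]; first by rewrite expr0 mulmx1.
  by rewrite exprSr mulmxA -IHk.
rewrite (wbk n.+1); case: Ab => [/Anil->|->]; first by rewrite mulmx0.
by rewrite exprS mul0r mulmx0.
Qed.

Section Engel.
Variable S : M -> Prop.
Hypotheses (SD : forall a b, S a -> S b -> S (a + b))
  (SZ : forall (c : C) a, S a -> S (c *: a))
  (SB : forall a b, S a -> S b -> S (a * b - b * a))
  (Snil : forall a, S a -> a ^+ n.+1 = 0).

(** First-order expansion of a power without commutativity. The remainder is polynomial in [t], so
    the coefficient of [t] vanishes if the left side is 0 for all natural [t]. The factor [Y]
    absorbs one factor of the power in the induction. *)
Lemma trace_pencil x y m Y : exists r : {poly C}, forall t : C,
  \tr ((x + t *: y) ^+ m * Y) = \tr (x ^+ m * Y) +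
    t * (\sum_(i < m) \tr (x ^+ i * y * x ^+ (m - i.+1) * Y)) + t ^+ 2 * r.[t].
Proof.
elim: m Y => [|m IHm] Y.
  by exists 0 => t; rewrite !expr0 big_ord0 horner0 !mulr0 !addr0.
have [r1 h1] := IHm (x * Y); have [r2 h2] := IHm (y * Y).
exists ((\sum_(i < m) \tr (x ^+ i * y * x ^+ (m - i.+1) * (y * Y)))%:P + r1 +
  'X * r2) => t.
rewrite exprSr -mulrA [(x + _) * Y]mulrDl mulrDr mxtraceD h1.
rewrite -[t *: y * Y]scalerAl -[_ * (t *: _)]scalerAr mxtraceZ h2 big_ord_recr
  /= subnn expr0 mulr1.
have -> : x ^+ m.+1 * Y = x ^+ m * (x * Y) by rewrite exprSr mulrA.
have -> : \sum_(i < m) \tr (x ^+ i * y * x ^+ (m.+1 - i.+1) * Y) =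
    \sum_(i < m) \tr (x ^+ i * y * x ^+ (m - i.+1) * (x * Y)).
  by apply: eq_bigr => i _; rewrite subSn// exprSr !mulrA.
rewrite -[x ^+ m * y * Y]mulrA.
rewrite !hornerE /=; ring.
Qed.

(* The trace of a product is symmetric modulo traces of shorter products, so
   by polarization it is determined by the traces of powers. *)
Lemma trace_prod_nil s : (forall a, a \in s -> S a) -> s != [::] ->
  \tr (\prod_(a <- s) a) = 0.
Proof.
have [k] := ubnP (size s); elim: k s => // k IHk s /ltnSE sk Ss s0.
have [sk'|sk'] := ltnP (size s) k; first exact: IHk.
have {sk sk'} sk : size s = k by apply/eqP; rewrite eqn_leq sk sk'.
(* Exchanging two neighbours costs a product in which they are replaced by their bracket; this lies
   in [S], so the product is one factor shorter and [IHk] applies. *)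
have move_front s1 y s2 : (forall a, a \in s1 ++ s2 -> S a) -> S y ->
    (size s1 + size s2).+1 = k ->
    \tr (\prod_(a <- s1) a * y * \prod_(a <- s2) a) =
    \tr (y * \prod_(a <- s1) a * \prod_(a <- s2) a).
  elim/last_ind: s1 s2 => [|s1 b IHs1] s2 Sa Sy sz;
    first by rewrite big_nil mulr1 mul1r.
  rewrite -cats1 big_cat big_seq1 /=.
  have Sb : S b by apply: Sa; rewrite mem_cat mem_rcons mem_head.
  have bracket0 : \tr (\prod_(a <- s1 ++ (b * y - y * b) :: s2) a) = 0.
    apply: IHk.
    - by rewrite size_cat /= -sz size_rcons addSnnS.
    - move=> a; rewrite mem_cat inE orbCA => /predU1P[->|as_]; first exact: SB.
      by apply: Sa; rewrite mem_cat mem_rcons inE -orbA as_ orbT.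
    - by case: (s1).
  rewrite big_cat big_cons /= mulrBl mulrBr raddfB /= in bracket0.
  move/eqP: bracket0; rewrite subr_eq0 => /eqP bracket0.
  have IH := IHs1 (b :: s2); rewrite big_cons !mulrA in IH.
  rewrite !mulrA -[RHS]IH //=; last by rewrite -sz size_rcons addSnnS.
    by rewrite -mulrA -[in LHS]mulrA mulrA -!mulrA in bracket0 *.
  by move=> a as_; apply: Sa; rewrite cat_rcons.
(* Here [j] arbitrary factors follow a power of a single [x]. The case [j = 0] is nilpotency,
   [j = k] is the claim, and the step replaces [x] by [x + t *: y]. *)
suff H j x ys : (forall a, a \in ys -> S a) -> S x -> (size ys = j)%N ->
    (j <= k)%N -> \tr (x ^+ (k - j) * \prod_(a <- ys) a) = 0.
  have Sh : S (head 0 s) by case: s s0 Ss {sk} => //= a t _; apply;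
    exact: mem_head.
  by rewrite -(H k _ s Ss Sh sk (leqnn k)) subnn expr0 mul1r.
elim: j x ys => [|j IHj] x ys Sys Sx sys jk.
  have -> : ys = [::] by case: ys sys {Sys}.
  rewrite big_nil mulr1 subn0; have := Snil Sx => xn.
  have : (x ^+ k) ^+ n.+1 = 0.
    rewrite -exprM mulnC exprM xn expr0n -sk size_eq0; by case: (s) s0.
  exact: trace_nilp.
case/lastP: ys Sys sys => // ys y Sys; rewrite size_rcons => -[sys].
have Sy : S y by apply: Sys; rewrite mem_rcons mem_head.
have {}Sys a : a \in ys -> S a
  by move=> ay; apply: Sys; rewrite mem_rcons inE ay orbT.
set Y := \prod_(a <- ys) a; rewrite -cats1 big_cat big_seq1 /= -/Y mulrA.
set m := (k - j.+1)%N; have mE : (k - j = m.+1)%N by rewrite /m subnSK.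
have [r hr] := trace_pencil x y m.+1 Y.
set L := \sum_(i < _) _ in hr.
have L0 : L = 0.
  suff /polyP/(_ 0) : L%:P + 'X * r = 0
    by rewrite coefD coefC coefXM coef0 addr0.
  suff : 'X * (L%:P + 'X * r) = 0
    by move=> /eqP; rewrite mulf_eq0 polyX_eq0 => /eqP.
  apply: poly_nat_eq0 => t; have := hr t%:R; rewrite -mE !IHj ?(ltnW jk)//;
    last first.
    by apply: SD => //; exact: SZ.
  by rewrite add0r !hornerE /= => /esym; rewrite expr2; move <-; ring.
(* By [move_front] every position of [y] gives the same trace, and [m.+1] is invertible in
   characteristic 0. *)
have LE : L = m.+1%:R * \tr (y * x ^+ m * Y).
  rewrite mulr_natl -[in RHS](card_ord m.+1) -sumr_const; apply: eq_bigr => i _.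
  have := move_front (nseq i x) y (nseq (m - i) x ++ ys);
    rewrite big_cat !big_nseq /=.
  rewrite -!Monoid.iteropE -!/(GRing.exp _ _).
  rewrite -/Y subSS !mulrA => ->//.
  - by rewrite -[_ * _ * x ^+ (m - i)]mulrA -exprD subnKC// -ltnS.
  - move=> a; rewrite !mem_cat !mem_nseq =>
    /or3P[/andP[_ /eqP->]|/andP[_ /eqP->]|]//.
    exact: Sys.
  - by rewrite size_cat !size_nseq sys addnA subnKC -1?ltnS// -addSn -mE subnK//
    ltnW.
move: L0; rewrite LE => /eqP; rewrite mulf_eq0 pnatr_eq0 /= => /eqP.
by rewrite -mulrA mxtrace_mulC mulmxE.
Qed.

(** The unit is left out so that all elements can have trace 0. Products grow by one generator on
    the left, which lets the trace argument move that generator into a list. *)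
Inductive nonunital_span : M -> Prop :=
| nonunital_span_gen a : S a -> nonunital_span a
| nonunital_span_mul a b : S a -> nonunital_span b -> nonunital_span (a * b)
| nonunital_span_add a b :
    nonunital_span a -> nonunital_span b -> nonunital_span (a + b)
| nonunital_span_scale c a : nonunital_span a -> nonunital_span (c *: a).

Lemma nonunital_spanM a b :
  nonunital_span a -> nonunital_span b -> nonunital_span (a * b).
Proof.
move=> ha hb; elim: ha => [{}a Sa|{}a c Sa _ h|{}a c _ ha _ hc|c {}a _ ha].
- exact: nonunital_span_mul.
- by rewrite -mulrA; exact: nonunital_span_mul.
- by rewrite mulrDl; exact: nonunital_span_add.
- by rewrite -scalerAl; exact: nonunital_span_scale.
Qed.

Lemma trace_nonunital_span a : nonunital_span a -> \tr a = 0.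
Proof.
suff H : nonunital_span a -> forall s, (forall b, b \in s -> S b) ->
    \tr (\prod_(b <- s) b * a) = 0.
  by move=> /H/(_ [::]); rewrite big_nil mul1r; apply.
elim=> [{}a Sa|{}a b Sa _ h|{}a b _ ha _ hb|c {}a _ ha] s Ss.
- have := @trace_prod_nil (rcons s a).
  rewrite -cats1 big_cat big_seq1 /=; apply; last by case: (s).
  by move=> b; rewrite mem_cat inE => /orP[/Ss//|/eqP->].
- have := h (rcons s a); rewrite -cats1 big_cat big_seq1 /= mulrA; apply => b'.
  by rewrite mem_cat inE => /orP[/Ss//|/eqP->].
- by rewrite mulrDr mxtraceD ha// hb// addr0.
- by rewrite -scalerAr mxtraceZ ha// mulr0.
Qed.

Lemma nilp_nonunital_span a : nonunital_span a -> a ^+ n.+1 = 0.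
Proof.
move=> ha; apply: nilp_trace => k; apply: trace_nonunital_span.
elim: k => [|k IHk]; first by rewrite expr1.
by rewrite exprS; exact: nonunital_spanM.
Qed.

Lemma Engel_prod s : (forall a, a \in s -> S a) -> size s = n.+1 ->
  \prod_(a <- s) a = 0.
Proof.
move=> Ss; apply: (nil_algebra_prod (A := nonunital_span)) =>
  [a b|c a|a b|a|a /Ss].
- exact: nonunital_span_add.
- exact: nonunital_span_scale.
- exact: nonunital_spanM.
- exact: nilp_nonunital_span.
- exact: nonunital_span_gen.
Qed.

(** Moving every [g] to the right turns (x g)^k into a product of k conjugates of [x] followed by
    g^k. For k = n + 1 the conjugates multiply to 0 by [Engel_prod], so x g is nilpotent. *)
Lemma trace_mul_normalizer x g : g \in unitmx ->
  (forall a, S a -> S (g *m a *m invmx g)) -> S x -> \tr (x *m g) = 0.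
Proof.
move=> ug Sg Sx.
pose c k := iter k (fun a => g *m a *m invmx g) x.
have Sc k : S (c k) by elim: k => //= k; exact: Sg.
have cS k : g ^+ k *m x = c k *m g ^+ k.
  elim: k => [|k IHk]; first by rewrite expr0 mul1mx mulmx1.
  rewrite !exprS -!mulmxE -mulmxA IHk /= !mulmxA -[_ *m invmx g *m g]mulmxA.
  by rewrite mulVmx// mulmx1.
have E k : (x *m g) ^+ k = (\prod_(a <- [seq c i | i <- iota 0 k]) a) *m g ^+ k.
  elim: k => [|k IHk]; first by rewrite big_nil !expr0 mulmx1.
  have -> : iota 0 k.+1 = iota 0 k ++ [:: k] by rewrite -addn1 iotaD.
  rewrite exprSr IHk map_cat big_cat /= big_seq1.
  by rewrite -!mulmxE mulmxA -[_ *m g ^+ k *m x]mulmxA cS exprSr !mulmxA.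
apply: (@trace_nilp _ n.+1); rewrite E Engel_prod ?mul0mx//.
  by move=> _ /mapP[i _ ->].
by rewrite size_map size_iota.
Qed.

End Engel.
End NilpotentMatrices.

(** * Generalized weight decompositions *)

Section Weights.
Context {K : fieldType} {E : lmodType K}.
Variable T : E -> E.
Hypothesis Tlin : forall a u v, T (a *: u + v) = a *: T u + T v.
Implicit Types (u v : E) (c d : K) (S : E -> Prop) (L : seq (E * K)).

Definition shift c u := T u - c *: u.

Lemma shift_linear c a u v : shift c (a *: u + v) = a *: shift c u + shift c v.
Proof.
rewrite /shift Tlin scalerDr scalerA [c * a]mulrC -scalerA scalerBr.
by rewrite opprD addrACA.
Qed.

Lemma iter_shift_linear c k a u v :
  iter k (shift c) (a *: u + v) = a *: iter k (shift c) u + iter k (shift c) v.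
Proof. by elim: k => //= k ->; exact: shift_linear. Qed.

Lemma iter_shiftD c k u v :
  iter k (shift c) (u + v) = iter k (shift c) u + iter k (shift c) v.
Proof. by have := iter_shift_linear c k 1 u v; rewrite !scale1r. Qed.

Lemma iter_shift0 c k : iter k (shift c) 0 = 0.
Proof.
by have /eqP := iter_shiftD c k 0 0;
  rewrite addr0 -subr_eq subrr eq_sym => /eqP.
Qed.

Lemma iter_shiftZ c k a u : iter k (shift c) (a *: u) = a *: iter k (shift c) u.
Proof.
by have := iter_shift_linear c k a u 0; rewrite !addr0 iter_shift0 addr0.
Qed.

Lemma shiftC c d u : shift c (shift d u) = shift d (shift c u).
Proof.
have TZ a v : T (a *: v) = a *: T v.
  have := Tlin a v 0; rewrite !addr0; have := Tlin 1 0 0.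
  by rewrite !scale1r addr0 => /eqP; rewrite -subr_eq subrr => /eqP <-;
    rewrite addr0.
have TN v : T (- v) = - T v by rewrite -scaleN1r TZ scaleN1r.
have TD v w : T (v + w) = T v + T w by have := Tlin 1 v w; rewrite !scale1r.
rewrite /shift !TD !TN !TZ !scalerBr !scalerA [d * c]mulrC !opprB.
rewrite -!addrA; congr (_ + _); rewrite addrCA [RHS]addrCA; congr (_ + _).
exact: addrC.
Qed.

Lemma iter_shiftC c d k l u : iter k (shift c) (iter l (shift d) u) =
  iter l (shift d) (iter k (shift c) u).
Proof.
elim: k => //= k ->; elim: l => //= l IHl; by rewrite shiftC IHl.
Qed.

Section Stable.
Variable S : E -> Prop.
Hypotheses (S0 : S 0) (SD : forall u v, S u -> S v -> S (u + v))
  (SZ : forall a u, S u -> S (a *: u)) (ST : forall u, S u -> S (T u)).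

Lemma shift_stable c u : S u -> S (shift c u).
Proof.
by move=> Su; rewrite /shift -scaleNr; apply: SD;
  [exact: ST|exact: SZ].
Qed.

Lemma iter_shift_stable c k u : S u -> S (iter k (shift c) u).
Proof. by move=> Su; elim: k => //= k; exact: shift_stable. Qed.

(** This is a statement about the quotient by [S], which is never formed: a nonzero vector has at
    most one generalized eigenvalue, because [shift c u - shift d u] is [(d - c) *: u]. *)
Lemma coprime_shifts c d k l u : c != d ->
  S (iter k (shift c) u) -> S (iter l (shift d) u) -> S u.
Proof.
move=> cd; have [m] := ubnP (k + l); elim: m k l u => // m IHm [|k] [|l] u //.
rewrite ltnS => klm hk hl.
have Sc : S (shift c u).
  apply: (IHm k l.+1); rewrite -?iterSr//.
  by rewrite -[shift c u]/(iter 1 (shift c) u) iter_shiftC; exact: shift_stable.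
have Sd : S (shift d u).
  apply: (IHm k.+1 l); rewrite -?iterSr//; first by rewrite addnS in klm.
  by rewrite -[shift d u]/(iter 1 (shift d) u) iter_shiftC; exact: shift_stable.
have -> : u = (d - c)^-1 *: (shift c u + -1 *: shift d u).
  rewrite scaleN1r /shift opprB [X in _ *: X]addrC addrA subrK -scalerBl scalerA
    mulVf.
    by rewrite scale1r.
  by rewrite subr_eq0 eq_sym.
by apply/SZ/SD => //; exact: SZ.
Qed.

Lemma S_sum (I : Type) (r : seq I) (F : I -> E) :
  (forall i, S (F i)) -> S (\sum_(i <- r) F i).
Proof. by move=> h; elim/big_rec: _ => // i u _; exact: SD. Qed.

(** Generalized weight spaces are independent modulo [S], so a sum that lies in [S] has all its
    weight components in [S], and these may be recombined with any coefficients. *)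
Lemma weight_components m L (f : K -> K) :
  (forall e, e \in L -> S (iter m (shift e.2) e.1)) ->
  S (\sum_(e <- L) e.1) -> S (\sum_(e <- L) f e.2 *: e.1).
Proof.
have [k] := ubnP (size L); elim: k L f => // k IHk [|[u0 c0] L] f /=.
  by rewrite !big_nil.
rewrite ltnS !big_cons /= => Lk hL Ssum.
have {}hL0 : S (iter m (shift c0) u0) by apply: (hL (u0, c0)); exact: mem_head.
have {}hL e : e \in L -> S (iter m (shift e.2) e.1).
  by move=> eL; apply: hL; rewrite inE eL orbT.
(* [N] sends the leading term into [S] and keeps the other terms weight vectors modulo [S], so the
   induction applies to the shorter list. *)
pose N := iter m (shift c0).
have Nsum (r : seq (E * K)) (g : K -> K) :
    N (\sum_(e <- r) g e.2 *: e.1) = \sum_(e <- r) g e.2 *: N e.1.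
  elim: r => [|e r IHr]; first by rewrite !big_nil /N iter_shift0.
  by rewrite !big_cons /N iter_shift_linear -/N IHr.
have SN g : S (N (\sum_(e <- L) g e.2 *: e.1)).
  rewrite Nsum; have := IHk [seq (N e.1, e.2) | e <- L] g.
  rewrite size_map !big_map /=; apply => //.
    move=> _ /mapP[e eL ->] /=; rewrite /N iter_shiftC.
    by apply: iter_shift_stable; exact: hL.
  have -> : \sum_(e <- L) N e.1 = N (u0 + \sum_(e <- L) e.1) + -1 *: N u0.
    rewrite /N iter_shiftD -/N scaleN1r addrAC subrr add0r.
    have := Nsum L (fun=> 1); under eq_bigr do rewrite scale1r.
    by move=> ->; apply: eq_bigr => e _; rewrite scale1r.
  by apply: SD; [exact: iter_shift_stable|exact: SZ].
(* Weights may repeat in the list, so the terms of weight [d] are collected. If [d] is not [c0],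
   both [N] and a power of [shift d] send [Y d] into [S]. *)
pose Y d := \sum_(e <- L) (e.2 == d)%:R *: e.1.
have SY d : d != c0 -> S (Y d).
  move=> dc; apply: (coprime_shifts dc (k := m) (l := m));
    last exact: (SN (fun c => (c == d)%:R)).
  rewrite /Y; elim: L hL {SN Lk Ssum Nsum Y} => [|e L IHL] hL.
    by rewrite big_nil iter_shift0.
  rewrite big_cons iter_shiftD iter_shiftZ; apply: SD.
    have [<-|_] := eqVneq e.2 d; last by rewrite scale0r.
    by apply/SZ/hL; exact: mem_head.
  by apply: IHL => e' e'L; apply: hL; rewrite inE e'L orbT.
(* The component of weight [c0] is traded for the total sum; this is the origin of the coefficients
   [f d - f c0]. *)
have -> : f c0 *: u0 + \sum_(e <- L) f e.2 *: e.1 =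
    f c0 *: (u0 + \sum_(e <- L) e.1) +
    \sum_(d <- undup [seq e.2 | e <- L]) (f d - f c0) *: Y d.
  rewrite scalerDr -addrA; congr (_ + _).
  under [X in _ + X]eq_bigr do rewrite scaler_sumr.
  rewrite exchange_big /= scaler_sumr -big_split /=.
  rewrite !big_seq; apply: eq_bigr => e eL.
  rewrite (bigD1_seq e.2) ?undup_uniq ?mem_undup ?map_f//= eqxx scale1r.
  rewrite big1 ?addr0; last by move=> d /negPf de;
    rewrite eq_sym de scale0r scaler0.
  by rewrite -scalerDl addrC subrK.
apply: SD; first exact: SZ.
apply: S_sum => d; have [->|dc] := eqVneq d c0; first by rewrite subrr scale0r.
by apply/SZ/SY.
Qed.

End Stable.
End Weights.

Section NilpotentOnProducts.
Context {E : pzRingType} (N N1 N2 p q : E -> E).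
Hypotheses (Nadd : forall u v, N (u + v) = N u + N v)
  (p0 : p 0 = 0) (q0 : q 0 = 0)
  (NM : forall u v, N (u * v) = N1 u * p v + q u * N2 v)
  (pN2 : forall v, N2 (p v) = p (N2 v)) (qN1 : forall u, N1 (q u) = q (N1 u)).

(** Leibniz rule: in each term an application of [N] uses up one unit of [k] or of [l]. The twists
    [p] and [q] are identities for a derivation; for an automorphism T they come from (T - cd)(uv) =
    (T - c)u Tv + cu (T - d)v. *)
Lemma iter_prod_eq0 k l u v : iter k N1 u = 0 -> iter l N2 v = 0 ->
  iter (k + l) N (u * v) = 0.
Proof.
have N0 : N 0 = 0 by have /eqP := Nadd 0 0;
  rewrite addr0 -subr_eq subrr eq_sym => /eqP.
have itN0 m : iter m N 0 = 0 by elim: m => //= m ->.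
have itND m a b : iter m N (a + b) = iter m N a + iter m N b.
  by elim: m => //= m ->.
have itp m a : iter m N2 (p a) = p (iter m N2 a) by elim: m => //= m ->.
have itq m a : iter m N1 (q a) = q (iter m N1 a) by elim: m => //= m ->.
have [m] := ubnP (k + l); elim: m k l u v => // m IHm [|k] [|l] u v klm.
- by move=> /= -> _; rewrite mul0r.
- by move=> /= -> _; rewrite mul0r; exact: (itN0 l.+1).
- by move=> _ /= ->; rewrite mulr0; exact: (itN0 _.+1).
move=> hu hv; rewrite addSn iterSr NM itND.
rewrite ltnS in klm.
have -> : iter (k + l.+1) N (N1 u * p v) = 0.
  by apply: IHm; rewrite -?iterSr ?itp ?hv ?p0.
rewrite addnS -addSn IHm ?addr0//; first by rewrite addSnnS.
  by rewrite itq hu q0.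
by rewrite -iterSr.
Qed.

End NilpotentOnProducts.

(** * Functions of the semisimple part of a matrix *)

Section FunctionalCalculus.
Context {C : numClosedFieldType} {n : nat}.
Local Notation M := 'M[C]_n.+1.
Implicit Types (a : M) (f : C -> C) (p : {poly C}).

Definition mxfun_poly f a : {poly C} :=
  sval (cid (hermite_interpolation f n.+1 (spectrum a))).

(* [f] applied to the semisimple part of [a]. *)
Definition mxfun f a : M := horner_mx a (mxfun_poly f a).

Definition eigproj a c : M := mxfun (fun z => (z == c)%:R) a.

Lemma mxfun_polyP f a z : z \in spectrum a ->
  ('X - z%:P) ^+ n.+1 %| mxfun_poly f a - (f z)%:P.
Proof. by rewrite /mxfun_poly; case: cid => p /= h /h. Qed.

Lemma mxfun_poly_horner f a z : z \in spectrum a -> (mxfun_poly f a).[z] = f z.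
Proof.
move=> /(mxfun_polyP f) h; have : 'X - z%:P %| mxfun_poly f a - (f z)%:P.
  by apply: dvdp_trans h; rewrite exprS dvdp_mulIl.
by rewrite dvdp_XsubCl => /rootP/eqP;
  rewrite hornerD hornerN hornerC subr_eq0 => /eqP.
Qed.

(** The interpolating polynomial is a choice; the matrix does not depend on it. *)
Lemma mxfunE f a p :
  (forall z, z \in spectrum a -> ('X - z%:P) ^+ n.+1 %| p - (f z)%:P) ->
  horner_mx a p = mxfun f a.
Proof.
move=> hp; apply/eqP; rewrite -subr_eq0 /mxfun -rmorphB;
  apply/eqP/horner_mx_eq0.
move=> z zs; have -> : p - mxfun_poly f a =
    (p - (f z)%:P) - (mxfun_poly f a - (f z)%:P) by ring.
by apply: dvdp_sub; [exact: hp|exact: mxfun_polyP].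
Qed.

Lemma sum_eigproj f a :
  \sum_(c <- undup (spectrum a)) f c *: eigproj a c = mxfun f a.
Proof.
pose p := \sum_(c <- undup (spectrum a)) f c *: mxfun_poly
  (fun z => (z == c)%:R) a.
rewrite -(@mxfunE f a p) => [|z zs].
  by rewrite /p linear_sum; apply: eq_bigr => c _; rewrite linearZ.
have -> : (f z)%:P = \sum_(c <- undup (spectrum a)) f c *: ((z == c)%:R)%:P.
  rewrite (bigD1_seq z) ?mem_undup ?undup_uniq//= eqxx big1 ?addr0 =>
    [|c /negPf].
    by rewrite -mul_polyC mulr1.
  by rewrite eq_sym => ->; rewrite scaler0.
rewrite /p -sumrB; apply: (big_ind (fun q => _ %| q)) => [|q r|c _].
- exact: dvdp0.
- exact: dvdp_add.
- by rewrite -scalerBr -mul_polyC dvdp_mull// mxfun_polyP.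
Qed.

Lemma sum_eigproj1 a : \sum_(c <- undup (spectrum a)) eigproj a c = 1.
Proof.
have -> : 1 = horner_mx a 1 by rewrite rmorph1.
rewrite (@mxfunE (fun=> 1)).
  by rewrite -sum_eigproj; apply: eq_bigr => c _; rewrite scale1r.
by move=> z _; rewrite subrr dvdp0.
Qed.

(** The projection vanishes to full order at the other eigenvalues, so only the behaviour of a
    polynomial at [c] counts on its image. *)
Lemma horner_mx_eigproj a p q c :
  ('X - c%:P) ^+ n.+1 %| p - q ->
  horner_mx a p * eigproj a c = horner_mx a q * eigproj a c.
Proof.
move=> pq; apply/eqP; rewrite -subr_eq0 -mulrBl -rmorphB -rmorphM.
apply/eqP/horner_mx_eq0 => z zs; have [->|zc] := eqVneq z c;
  first exact: dvdp_mulr.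
apply: dvdp_mull; have := mxfun_polyP (fun z => (z == c)%:R) zs.
by rewrite (negPf zc) subr0.
Qed.

Lemma eigproj_nilp a c : (a - c%:A) ^+ n.+1 * eigproj a c = 0.
Proof.
have -> : (a - c%:A) ^+ n.+1 = horner_mx a (('X - c%:P) ^+ n.+1).
  by rewrite rmorphXn rmorphB /= horner_mx_X horner_mx_C scalemx1.
by rewrite (@horner_mx_eigproj _ _ 0) ?rmorph0 ?mul0r// subr0.
Qed.

Lemma mxfun_eigproj f a c : c \in spectrum a ->
  mxfun f a * eigproj a c = f c *: eigproj a c.
Proof.
move=> ca; rewrite [mxfun f a]/mxfun (horner_mx_eigproj _ (mxfun_polyP f ca)).
by rewrite horner_mx_C -scalemx1 -scalerAl mul1r.
Qed.

Lemma mxfunM f g a : mxfun f a * mxfun g a = mxfun (fun z => f z * g z) a.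
Proof.
rewrite -[RHS]sum_eigproj -[mxfun g a]sum_eigproj mulr_sumr.
rewrite big_seq [RHS]big_seq; apply: eq_bigr => c; rewrite mem_undup => ca.
by rewrite -scalerAr mxfun_eigproj// scalerA mulrC.
Qed.

Lemma trace_mxfun f a p :
  \tr (mxfun f a * horner_mx a p) = \sum_(z <- spectrum a) f z * p.[z].
Proof.
rewrite -rmorphM trace_horner_mx big_seq [RHS]big_seq.
by apply: eq_bigr => z za; rewrite hornerM mxfun_poly_horner.
Qed.

Lemma det_mxfun f a : \det (mxfun f a) = \prod_(z <- spectrum a) f z.
Proof.
rewrite det_horner_mx big_seq [RHS]big_seq.
by apply: eq_bigr => z za; rewrite mxfun_poly_horner.
Qed.

Lemma det_spectrum a : \det a = \prod_(z <- spectrum a) z.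
Proof.
rewrite -[a in LHS]horner_mx_X det_horner_mx.
by apply: eq_bigr => z _; rewrite hornerX.
Qed.

Lemma trace_spectrum a : \tr a = \sum_(z <- spectrum a) z.
Proof.
rewrite -[a in LHS]horner_mx_X trace_horner_mx.
by apply: eq_bigr => z _; rewrite hornerX.
Qed.

Lemma spectrum_unit a z : a \in unitmx -> z \in spectrum a -> z != 0.
Proof.
rewrite unitmxE unitfE det_spectrum prodf_seq_neq0 => /allP h.
exact: h.
Qed.

End FunctionalCalculus.

(** * Directional derivatives of regular functions *)

(* Locked: the definition of [lineD] as a limit must not be unfolded by
   unification. *)
HB.lock Definition dirD (R : realType) (N : nat) (F : 'M[R[i]]_N -> R[i])
    (y v : 'M[R[i]]_N) : R[i] := lineD F y v.

HB.lock Definition jac (R : realType) (N : nat) (V : 'M[R[i]]_N -> 'M[R[i]]_N)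
    (y v : 'M[R[i]]_N) : 'M[R[i]]_N :=
  \matrix_(i, j) dirD (fun x => V x i j) y v.

Section Calculus.
Context {R : realType} {N : nat}.
Local Notation C := R[i].
Local Notation M := 'M[C]_N.
Implicit Types (A : set M) (F H : M -> C) (V W : M -> M) (x y v w k l : M).

Definition regular_mx V := forall i j, regularGL (fun x => V x i j).

Lemma regularGLN F : regularGL F -> regularGL (fun x => - F x).
Proof.
move=> gF; under eq_fun do rewrite -mulN1r.
by apply: regularGL_mul => //; exact: regularGL_const.
Qed.

Lemma regularGLB F H : regularGL F -> regularGL H ->
  regularGL (fun x => F x - H x).
Proof. by move=> gF gH; apply: regularGL_add => //; exact: regularGLN. Qed.

Lemma regularGLZ c F : regularGL F -> regularGL (fun x => c * F x).
Proof. by move=> gF; apply: regularGL_mul => //; exact: regularGL_const. Qed.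

Lemma regular_mxid : regular_mx id.
Proof. by move=> i j; exact: regularGL_coord. Qed.

Lemma regular_mxc k : regular_mx (fun=> k).
Proof. by move=> i j; exact: regularGL_const. Qed.

Lemma regular_mxM V W : regular_mx V -> regular_mx W ->
  regular_mx (fun x => V x *m W x).
Proof. by move=> gV gW i j; exact: regularGL_mulmx. Qed.

Lemma regular_mxD V W : regular_mx V -> regular_mx W ->
  regular_mx (fun x => V x + W x).
Proof.
by move=> gV gW i j; under eq_fun do rewrite mxE;
  exact: regularGL_add.
Qed.

Lemma regular_mxB V W : regular_mx V -> regular_mx W ->
  regular_mx (fun x => V x - W x).
Proof.
by move=> gV gW i j; under eq_fun do rewrite !mxE;
  exact: regularGLB.
Qed.

Lemma dirDE F y v : dirD F y v = lineD F y v.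
Proof. by rewrite dirD.unlock. Qed.

Lemma dirD_linear F y a v w : regularGL F -> y \in unitmx ->
  dirD F y (a *: v + w) = a * dirD F y v + dirD F y w.
Proof. by move=> gF uy; rewrite !dirDE lineD_linear. Qed.

Lemma regularGL_dirD F V : regularGL F -> regular_mx V ->
  exists2 H, regularGL H & forall y, y \in unitmx -> H y = dirD F y (V y).
Proof.
move=> gF gV; have [D hD] := regularGL_hld gF; have [_ _ rD] := hD.
by exists (fun y => D y (V y)) => [|y uy];
  [exact: rD|rewrite dirDE (lineDE _ hD)].
Qed.

Lemma regularGL_mulmx2 k l F : regularGL F ->
  regularGL (fun y => F (k *m y *m l)).
Proof.
elim=> [c|i j||{}F H _ gF _ gH|{}F H _ gF _ gH].
- exact: regularGL_const.
- apply: regular_mxM; last exact: regular_mxc.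
  by apply: regular_mxM; [exact: regular_mxc|exact: regular_mxid].
- under eq_fun do rewrite !det_mulmx !invfM.
  apply: regularGL_mul; last exact: regularGL_const.
  by apply: regularGL_mul; [exact: regularGL_const|exact: regularGL_invdet].
- exact: regularGL_add.
- exact: regularGL_mul.
Qed.

Lemma dirD_mulmx2 k l F y v :
  dirD (fun x => F (k *m x *m l)) y v = dirD F (k *m y *m l) (k *m v *m l).
Proof.
rewrite !dirDE; apply: (congr1 (fun f : C^o -> C^o => derive1 f 0));
  apply/funext => t.
by rewrite mulmxDr mulmxDl -scalemxAr -scalemxAl.
Qed.

Lemma dirDc c y v : dirD (fun=> c) y v = 0.
Proof. rewrite dirDE; exact: (derive1_cst (c : C^o) 0). Qed.

Lemma dirD_coord i j y v : dirD (fun x => x i j) y v = v i j.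
Proof.
by rewrite dirDE /lineD derive1E;
  have [] := is_derive_line_coord y v i j.
Qed.

Lemma dirD_add F H y v : regularGL F -> regularGL H -> y \in unitmx ->
  dirD (fun x => F x + H x) y v = dirD F y v + dirD H y v.
Proof.
move=> /regularGL_hld[DF hF] /regularGL_hld[DH hH] uy.
by rewrite !dirDE (lineDE _ (hld_add hF hH))// (lineDE _ hF)// (lineDE _ hH).
Qed.

Lemma dirD_mul F H y v : regularGL F -> regularGL H -> y \in unitmx ->
  dirD (fun x => F x * H x) y v = F y * dirD H y v + H y * dirD F y v.
Proof.
move=> gF gH uy; have [DF hF] := regularGL_hld gF;
  have [DH hH] := regularGL_hld gH.
by rewrite !dirDE (lineDE _ (hld_mul gF gH hF hH))// (lineDE _ hF)//
  (lineDE _ hH).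
Qed.

Lemma dirD_scale c F y v : regularGL F -> y \in unitmx ->
  dirD (fun x => c * F x) y v = c * dirD F y v.
Proof.
by move=> gF uy; rewrite dirD_mul ?dirDc ?mulr0 ?addr0//;
  exact: regularGL_const.
Qed.

Lemma dirD_opp F y v : regularGL F -> y \in unitmx ->
  dirD (fun x => - F x) y v = - dirD F y v.
Proof.
by move=> gF uy; under eq_fun do rewrite -mulN1r; rewrite dirD_scale// mulN1r.
Qed.

Lemma dirD_sub F H y v : regularGL F -> regularGL H -> y \in unitmx ->
  dirD (fun x => F x - H x) y v = dirD F y v - dirD H y v.
Proof. by move=> gF gH uy; rewrite dirD_add ?dirD_opp//; exact: regularGLN. Qed.

Lemma dirD_sum (I : Type) (r : seq I) (F : I -> M -> C) y v :
  (forall i, regularGL (F i)) -> y \in unitmx ->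
  dirD (fun x => \sum_(i <- r) F i x) y v = \sum_(i <- r) dirD (F i) y v.
Proof.
move=> gF uy; elim: r => [|i r IHr].
  by under eq_fun do rewrite big_nil; rewrite dirDc big_nil.
under eq_fun do rewrite big_cons; rewrite big_cons dirD_add ?IHr//.
exact: regularGL_sum.
Qed.

Lemma dirD0 F y : regularGL F -> y \in unitmx -> dirD F y 0 = 0.
Proof.
move=> gF uy; have /eqP := dirD_linear 1 0 0 gF uy.
by rewrite scaler0 addr0 mul1r -subr_eq subrr eq_sym => /eqP.
Qed.

Lemma dirDZ F y a v : regularGL F -> y \in unitmx ->
  dirD F y (a *: v) = a * dirD F y v.
Proof.
by move=> gF uy; have := dirD_linear a v 0 gF uy; rewrite !addr0 dirD0// addr0.
Qed.

(** GL(N) is open: the determinant is continuous along the line, so the line stays invertible near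
    0. Values at singular matrices carry no meaning, and identities are only available on GL(N). *)
Lemma dirD_local F H y v : y \in unitmx ->
  (forall x, x \in unitmx -> F x = H x) -> dirD F y v = dirD H y v.
Proof.
move=> uy FH; rewrite !dirDE /lineD !derive1E; have [D hD] := @hld_det R N;
  have [dD _ _] := hD.
have [ddet _] := dD y v uy.
have cdet : {for (0 : C^o),
  continuous (fun t : C^o => \det (y + t *: v) : C^o)}.
  by apply/differentiable_continuous/derivable1_diffP.
have d0 : \det (y + (0 : C^o) *: v) != 0.
  by rewrite scale0r addr0 -unitfE -unitmxE.
apply: (@near_eq_derive C C^o C^o (fun t => F (y + t *: v))
  (fun t => H (y + t *: v)) 0 1).
near=> t; apply: FH; rewrite unitmxE unitfE.
near: t; exact: (cvgr_neq0 _ cdet d0).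
Unshelve. all: by end_near. Qed.

Lemma jacE V y v i j : jac V y v i j = dirD (fun x => V x i j) y v.
Proof. by rewrite jac.unlock mxE. Qed.

Lemma jacc k y v : jac (fun=> k) y v = 0.
Proof. by apply/matrixP => i j; rewrite jacE mxE; exact: dirDc. Qed.

Lemma jacid y v : jac id y v = v.
Proof. by apply/matrixP => i j; rewrite jacE; exact: dirD_coord. Qed.

Lemma jacM V W y v : regular_mx V -> regular_mx W -> y \in unitmx ->
  jac (fun x => V x *m W x) y v = jac V y v *m W y + V y *m jac W y v.
Proof.
move=> gV gW uy; apply/matrixP => i j;
  rewrite jacE [RHS]mxE ![X in _ + X]mxE ![X in X + _]mxE.
under eq_fun do rewrite mxE; rewrite dirD_sum//; last first.
  by move=> a; exact: regularGL_mul.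
rewrite -big_split; apply: eq_bigr => a _ /=.
rewrite (dirD_mul _ (gV i a) (gW a j) uy) !jacE addrC.
by congr (_ + _); exact: mulrC.
Qed.

Lemma jacD V W y v : regular_mx V -> regular_mx W -> y \in unitmx ->
  jac (fun x => V x + W x) y v = jac V y v + jac W y v.
Proof.
move=> gV gW uy; apply/matrixP => i j; rewrite jacE [RHS]mxE.
by under eq_fun do rewrite mxE; rewrite (dirD_add _ (gV i j) (gW i j) uy) !jacE.
Qed.

Lemma jacB V W y v : regular_mx V -> regular_mx W -> y \in unitmx ->
  jac (fun x => V x - W x) y v = jac V y v - jac W y v.
Proof.
move=> gV gW uy; apply/matrixP => i j; rewrite jacE [RHS]mxE.
by under eq_fun do rewrite mxE [X in _ + X]mxE;
  rewrite (dirD_sub _ (gV i j) (gW i j) uy) [X in _ = _ + X]mxE !jacE.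
Qed.

Lemma jac_linear V y a v w : regular_mx V -> y \in unitmx ->
  jac V y (a *: v + w) = a *: jac V y v + jac V y w.
Proof.
move=> gV uy.
apply/matrixP => i j; rewrite jacE (dirD_linear _ _ _ (gV i j) uy).
by rewrite [RHS]mxE [X in _ = X + _]mxE !jacE.
Qed.

Lemma jac_mulmx2 k l V y v :
  jac (fun x => V (k *m x *m l)) y v = jac V (k *m y *m l) (k *m v *m l).
Proof.
by apply/matrixP => i j; rewrite !jacE (dirD_mulmx2 k l (fun x => V x i j)).
Qed.

Lemma regular_mx_mulmx2 k l V : regular_mx V ->
  regular_mx (fun x => V (k *m x *m l)).
Proof. by move=> gV i j; exact: (regularGL_mulmx2 k l (gV i j)). Qed.

Definition scalar_linear (L : M -> C) :=
  forall a v w, L (a *: v + w) = a * L v + L w.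

Lemma scalar_linearE L : scalar_linear L ->
  forall v, L v = \sum_i \sum_j v i j * L (delta_mx i j).
Proof.
move=> Llin v; rewrite [in LHS](matrix_sum_delta v).
have L0 : L 0 = 0.
  have /eqP := Llin 1 0 0; rewrite scaler0 addr0 mul1r.
  by rewrite -subr_eq subrr eq_sym => /eqP.
have Lsum (r : seq ('I_N * 'I_N)) (c : 'I_N * 'I_N -> C) u :
    L (\sum_(i <- r) c i *: u i) = \sum_(i <- r) c i * L (u i).
  by elim: r => [|i r IHr]; rewrite ?big_nil// !big_cons Llin IHr.
by rewrite !pair_big Lsum.
Qed.

Lemma regularGL_linear L V : scalar_linear L -> regular_mx V ->
  regularGL (fun x => L (V x)).
Proof.
move=> Llin gV; under eq_fun do rewrite (scalar_linearE Llin).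
apply: regularGL_sum => i; apply: regularGL_sum => j.
by apply: regularGL_mul => //; exact: regularGL_const.
Qed.

Lemma dirD_linear_comp L V y v : scalar_linear L -> regular_mx V ->
  y \in unitmx -> dirD (fun x => L (V x)) y v = L (jac V y v).
Proof.
move=> Llin gV uy; under eq_fun do rewrite (scalar_linearE Llin).
have gm i j : regularGL (fun x => V x i j * L (delta_mx i j)).
  by apply: regularGL_mul => //; exact: regularGL_const.
rewrite dirD_sum//; last by move=> i; exact: regularGL_sum.
rewrite [RHS](scalar_linearE Llin); apply: eq_bigr => i _.
rewrite dirD_sum//; apply: eq_bigr => j _.
rewrite dirD_mul//; last exact: regularGL_const.
by rewrite dirDc mulr0 add0r mulrC jacE.
Qed.

Lemma dirD_invdet y v : y \in unitmx ->
  dirD (fun x => (\det x)^-1) y v =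
    - ((\det y)^-1 ^+ 2 * dirD (fun x => \det x) y v).
Proof.
move=> uy; have d0 : \det y != 0 by rewrite -unitfE -unitmxE.
have gd : regularGL (fun x : M => \det x)
  by exact: (regularGL_det regular_mxid).
have /(_ R)gi := @regularGL_invdet.
have : dirD (fun x : M => \det x * (\det x)^-1) y v = 0.
  rewrite (@dirD_local _ (fun=> 1)) ?dirDc// => x.
  by rewrite unitmxE unitfE => /divff.
rewrite dirD_mul// => /eqP; rewrite addr_eq0 => /eqP h.
apply: (mulfI d0); rewrite h mulrN expr2 !mulrA divff// mul1r.
by [].
Qed.

End Calculus.

(** * Chain rule, commutators and polynomial curves *)

Section RegularCalculus.
Context {R : realType} {N : nat}.
Local Notation C := R[i].
Local Notation M := 'M[C]_N.
Implicit Types (A : set M) (F H : M -> C) (V W : M -> M) (x y v w k l : M).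

(** The inverse determinant is the only generator that is not polynomial. Its case usually follows
    by differentiating det times 1/det = 1, so the induction first supplies the case of the
    determinant. *)
Lemma regularGL_ind_det (P : (M -> C) -> Prop) :
  (forall c, P (fun=> c)) -> (forall i j, P (fun x => x i j)) ->
  (forall F H, regularGL F -> P F -> regularGL H -> P H ->
    P (fun x => F x + H x)) ->
  (forall F H, regularGL F -> P F -> regularGL H -> P H ->
    P (fun x => F x * H x)) ->
  (P (fun x => \det x) -> P (fun x => (\det x)^-1)) ->
  forall F, regularGL F -> P F.
Proof.
move=> Pc Px PD PM Pi.
have Pdet : P (fun x => \det x).
  have Psum (I : Type) (r : seq I) (F : I -> M -> C) :
      (forall i, regularGL (F i) /\ P (F i)) ->
        P (fun x => \sum_(i <- r) F i x).
    move=> hF; elim: r => [|i r IHr]; first by under eq_fun do rewrite big_nil.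
    under eq_fun do rewrite big_cons; have [gF PF] := hF i.
    by apply: PD => //; apply: regularGL_sum => j; have [] := hF j.
  have Pprod (I : Type) (r : seq I) (F : I -> M -> C) :
      (forall i, regularGL (F i) /\ P (F i)) ->
        P (fun x => \prod_(i <- r) F i x).
    move=> hF; elim: r => [|i r IHr]; first by under eq_fun do rewrite big_nil.
    under eq_fun do rewrite big_cons; have [gF PF] := hF i.
    by apply: PM => //; apply: regularGL_prod => j; have [] := hF j.
  have gprod (s : 'S_N) : regularGL (fun x : M => \prod_i x i (s i)).
    by apply: regularGL_prod => i; exact: regularGL_coord.
  apply: Psum => s; split.
    by apply: regularGL_mul => //; exact: regularGL_const.
  apply: PM => //; first exact: regularGL_const.
  by apply: Pprod => i; split; [exact: regularGL_coord|exact: Px].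
move=> F; elim=> [c|i j||{}F H gF PF gH PH|{}F H gF PF gH PH].
- exact: Pc.
- exact: Px.
- exact: Pi.
- exact: PD.
- exact: PM.
Qed.

Lemma tangentP A y v : tangent A y v <->
  forall F, regularGL F -> (forall x, A x -> F x = 0) -> dirD F y v = 0.
Proof.
by split=> h F gF F0; [rewrite dirDE|rewrite -dirDE]; exact: h.
Qed.

Section Tangent.
Variable A : set M.
Hypothesis AGL : A `<=` [set x | x \in unitmx].

Lemma dirD_tangent F H y v : A y -> tangent A y v -> regularGL F ->
  regularGL H -> (forall x, A x -> F x = H x) -> dirD F y v = dirD H y v.
Proof.
move=> Ay tv gF gH FH; have uy := AGL Ay.
have gB := regularGLB gF gH.
have : dirD (fun x => F x - H x) y v = 0.
  by move/tangentP: tv; apply=> // x /FH->; rewrite subrr.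
by rewrite (dirD_sub _ gF gH uy) => /eqP; rewrite subr_eq0 => /eqP.
Qed.

Lemma jac_tangent V W y v : A y -> tangent A y v -> regular_mx V ->
  regular_mx W -> (forall x, A x -> V x = W x) -> jac V y v = jac W y v.
Proof.
move=> Ay tv gV gW VW; apply/matrixP => i j; rewrite !jacE.
by apply: dirD_tangent => // x /VW->.
Qed.

Lemma tangent_linear y a v w : A y -> tangent A y v -> tangent A y w ->
  tangent A y (a *: v + w).
Proof.
move=> Ay /tangentP tv /tangentP tw; apply/tangentP => F gF F0.
by rewrite (dirD_linear _ _ _ gF (AGL Ay)) tv// tw// mulr0 addr0.
Qed.

(* Over the points where [V] is invertible only on [A], [F \o V] need not be
   regular on GL(N), but it agrees on [A] with a regular function. *)
Lemma regularGL_comp V (d : M -> C) : regular_mx V -> regularGL d ->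
  (forall x, A x -> d x * \det (V x) = 1) ->
  forall F, regularGL F -> exists H, [/\ regularGL H,
    forall x, A x -> H x = F (V x) &
    forall y v, A y -> tangent A y v ->
      dirD H y v = dirD F (V y) (jac V y v)].
Proof.
move=> gV gd dV.
have d0 y : A y -> \det (V y) != 0.
  by move=> /dV; apply: contra_eq_neq => ->; rewrite mulr0 eq_sym oner_eq0.
have uV y : A y -> V y \in unitmx by move=> /d0; rewrite unitmxE unitfE.
apply: regularGL_ind_det => [c|i j|F1 F2 g1 [H1 [gH1 e1 D1]] g2 [H2 [gH2 e2 D2]]
    |F1 F2 g1 [H1 [gH1 e1 D1]] g2 [H2 [gH2 e2 D2]]|[H [gH eH DH]]].
- exists (fun=> c); split=> [|x _|y v _ _]; first exact: regularGL_const.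
    by [].
  exact: (etrans (dirDc _ _ _) (esym (dirDc _ _ _))).
- exists (fun x => V x i j); split=> [|x _|y v _ _]; first exact: gV.
    by [].
  by rewrite [RHS]dirD_coord jacE.
- exists (fun x => H1 x + H2 x); split=> [|x Ax|y v Ay tv].
  + exact: regularGL_add.
  + by rewrite (e1 _ Ax) (e2 _ Ax).
  + rewrite (dirD_add _ gH1 gH2 (AGL Ay)) (dirD_add _ g1 g2 (uV _ Ay)).
    by rewrite (D1 _ _ Ay tv) (D2 _ _ Ay tv).
- exists (fun x => H1 x * H2 x); split=> [|x Ax|y v Ay tv].
  + exact: regularGL_mul.
  + by rewrite (e1 _ Ax) (e2 _ Ax).
  + rewrite (dirD_mul _ gH1 gH2 (AGL Ay)) (dirD_mul _ g1 g2 (uV _ Ay)).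
    by rewrite (D1 _ _ Ay tv) (D2 _ _ Ay tv) (e1 _ Ay) (e2 _ Ay).
- have dE x : A x -> d x = (\det (V x))^-1.
    by move=> Ax; apply: (mulIf (d0 _ Ax)); rewrite dV// mulVf// d0.
  exists d; split=> [|x Ax|y v Ay tv]; [exact: gd|exact: dE|].
  have gdH := regularGL_mul gd gH.
  (* On [A] the function [H] is [\det (V x)]; the relation [d * H = 1] there determines the
     derivative of [d] along [A]. *)
  have : dirD (fun x => d x * H x) y v = 0.
    rewrite (dirD_tangent Ay tv gdH (regularGL_const 1)); first exact: dirDc.
    by move=> x Ax; rewrite (eH _ Ax) (dV _ Ax).
  rewrite (dirD_mul _ gd gH (AGL Ay)) (eH _ Ay) (DH _ _ Ay tv) => /eqP.
  rewrite addrC addr_eq0 => /eqP h.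
  rewrite (dirD_invdet _ (uV _ Ay)) -(dE _ Ay).
  apply: (mulfI (d0 _ Ay)); rewrite h mulrN; congr (- _).
  rewrite -[LHS]mul1r -[X in X * _ = _](dV _ Ay); ring.
Qed.

Lemma tangent_map (B : set M) V (d : M -> C) y v : regular_mx V ->
  regularGL d ->
  (forall x, A x -> d x * \det (V x) = 1) -> (forall x, A x -> B (V x)) ->
  A y -> tangent A y v -> tangent B (V y) (jac V y v).
Proof.
move=> gV gd dV AB Ay tv; apply/tangentP => F gF F0.
have [H [gH eH DH]] := regularGL_comp gV gd dV gF.
rewrite -(DH _ _ Ay tv); move/tangentP: tv; apply=> // x Ax.
by rewrite (eH _ Ax); exact: F0 (AB _ Ax).
Qed.

End Tangent.

Section Commutator.
Variables V W : M -> M.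
Hypotheses (gV : regular_mx V) (gW : regular_mx W).

Let delta F y := dirD (fun x => dirD F x (W x)) y (V y) -
  dirD (fun x => dirD F x (V x)) y (W y) -
  dirD F y (jac W y (V y) - jac V y (W y)).

(** The mixed products of first derivatives are symmetric in [V] and [W] and cancel, which makes the
    second-order part a derivation as well. *)
Let delta_mul F H y : regularGL F -> regularGL H -> y \in unitmx ->
  delta (fun x => F x * H x) y = F y * delta H y + H y * delta F y.
Proof.
move=> gF gH uy.
have step U : regular_mx U -> forall v,
    dirD (fun x => dirD (fun x => F x * H x) x (U x)) y v =
    F y * dirD (fun x => dirD H x (U x)) y v + dirD H y (U y) * dirD F y v +
    (H y * dirD (fun x => dirD F x (U x)) y v + dirD F y (U y) * dirD H y v).
  move=> gU v; have [FU gFU FUE] := regularGL_dirD gF gU.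
  have [HU gHU HUE] := regularGL_dirD gH gU.
  have E x : x \in unitmx -> dirD (fun x => F x * H x) x (U x) =
      F x * HU x + H x * FU x.
    by move=> ux; rewrite (dirD_mul _ gF gH ux) (FUE _ ux) (HUE _ ux).
  apply: (etrans (dirD_local v uy E)).
  rewrite (dirD_add _ (regularGL_mul gF gHU) (regularGL_mul gH gFU) uy).
  rewrite (dirD_mul _ gF gHU uy) (dirD_mul _ gH gFU uy) (FUE _ uy) (HUE _ uy).
  by rewrite (dirD_local v uy HUE) (dirD_local v uy FUE).
rewrite /delta (step _ gW) (step _ gV) (dirD_mul _ gF gH uy).
ring.
Qed.

(* The commutator of two vector fields is the vector field
   [jac W V - jac V W]: both sides are derivations, so it is enough to compare
   them on the coordinates. *)
Lemma dirD_commutator F y : regularGL F -> y \in unitmx ->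
  dirD (fun x => dirD F x (W x)) y (V y) -
  dirD (fun x => dirD F x (V x)) y (W y) =
  dirD F y (jac W y (V y) - jac V y (W y)).
Proof.
move=> gF uy; apply/eqP; rewrite -subr_eq0; apply/eqP; rewrite -/(delta F y).
have cst_delta c : delta (fun=> c) y = 0.
  rewrite /delta dirDc subr0.
  have z U : (fun x : M => dirD (fun=> c) x (U x)) = fun=> 0.
    by apply/funext => x; exact: dirDc.
  by rewrite !z !dirDc subrr.
elim/regularGL_ind_det: gF => [c|i j|F1 F2 g1 h1 g2 h2|F1 F2 g1 h1 g2 h2|hdet].
- exact: cst_delta.
- rewrite /delta dirD_coord;
  have z U : (fun x : M => dirD (fun x => x i j) x (U x)) = fun x => U x i j.
    by apply/funext => x; exact: dirD_coord.
  by rewrite !z -!jacE; apply/eqP; rewrite subr_eq0 !mxE.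
- have step U : regular_mx U -> forall v,
      dirD (fun x => dirD (fun x => F1 x + F2 x) x (U x)) y v =
      dirD (fun x => dirD F1 x (U x)) y v + dirD (fun x => dirD F2 x (U x)) y v.
    move=> gU v; have [U1 gU1 U1E] := regularGL_dirD g1 gU.
    have [U2 gU2 U2E] := regularGL_dirD g2 gU.
    have E x : x \in unitmx -> dirD (fun x => F1 x + F2 x) x (U x) =
      U1 x + U2 x.
      by move=> ux; rewrite (dirD_add _ g1 g2 ux) (U1E _ ux) (U2E _ ux).
    apply: (etrans (dirD_local v uy E)).
    rewrite (dirD_add _ gU1 gU2 uy).
    by rewrite (dirD_local v uy U1E) (dirD_local v uy U2E).
  rewrite -[RHS](addr0 0) -{1}h1 -h2 /delta (step _ gW) (step _ gV)
    (dirD_add _ g1 g2 uy).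
  ring.
- by rewrite (delta_mul g1 g2 uy) h1 h2 !mulr0 addr0.
- have gd : regularGL (fun x : M => \det x)
  by exact: (regularGL_det (@regular_mxid R N)).
  have gi : regularGL (fun x : M => (\det x)^-1) by exact: regularGL_invdet.
  have d0 : \det y != 0 by rewrite -unitfE -unitmxE.
  have := delta_mul gd gi uy; rewrite hdet mulr0 addr0.
  have -> : delta (fun x : M => \det x * (\det x)^-1) y = 0.
    have e1 x : x \in unitmx -> \det x * (\det x)^-1 = 1 :> C.
      by rewrite unitmxE unitfE => /divff.
    have z U v : dirD (fun x => dirD (fun x => \det x * (\det x)^-1) x (U x))
      y v = 0.
      rewrite (@dirD_local _ _ _ (fun=> 0) _ _ uy); first exact: dirDc.
      by move=> x ux; rewrite (dirD_local _ ux e1); exact: dirDc.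
    by rewrite /delta !z (dirD_local _ uy e1) dirDc subrr subr0.
  by move/esym/eqP; rewrite mulf_eq0 (negPf d0) => /eqP.
Qed.

End Commutator.

(** With determinant 1 along the curve even the inverse determinant restricts to a polynomial in t,
    and so does every regular function. *)
Lemma regularGL_curve (c : 'M[{poly C}]_N) :
  (forall t, \det (map_mx (horner^~ t) c) = 1) ->
  forall F, regularGL F -> exists q : {poly C},
    (forall t, F (map_mx (horner^~ t) c) = q.[t]) /\
    dirD F (map_mx (horner^~ 0) c) (map_mx (fun p => p^`().[0]) c) = q^`().[0].
Proof.
move=> det1c; have u0 : map_mx (horner^~ 0) c \in unitmx.
  by rewrite unitmxE det1c unitr1.
apply: regularGL_ind_det => [a|i j|F1 F2 g1 [q1 [e1 D1]] g2 [q2 [e2 D2]]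
    |F1 F2 g1 [q1 [e1 D1]] g2 [q2 [e2 D2]]|[q [eq Dq]]].
- exists a%:P; split=> [t|]; first by rewrite hornerC.
  by rewrite dirDc derivC horner0.
- exists (c i j); split=> [t|]; first by rewrite mxE.
  by rewrite dirD_coord mxE.
- exists (q1 + q2); split=> [t|]; first by rewrite hornerD e1 e2.
  by rewrite (dirD_add _ g1 g2 u0) derivD hornerD D1 D2.
- exists (q1 * q2); split=> [t|]; first by rewrite hornerM e1 e2.
  by rewrite (dirD_mul _ g1 g2 u0) derivM hornerD !hornerM D1 D2 e1 e2 addrC
    [q2.[0] * _]mulrC.
- exists 1; split=> [t|]; first by rewrite det1c invr1 hornerC.
  rewrite (dirD_invdet _ u0) Dq.
  have -> : q = 1.
    apply/eqP; rewrite -subr_eq0; apply/eqP/poly_nat_eq0 => k.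
    by rewrite hornerD hornerN hornerC -eq det1c subrr.
  by rewrite derivC horner0 mulr0 oppr0.
Qed.

End RegularCalculus.

(** * Vector fields on closed subsets *)

Lemma tangent_GL (R : realType) (N : nat) (y v : 'M[R[i]]_N) :
  y \in unitmx -> tangent [set x : 'M[R[i]]_N | x \in unitmx] y v.
Proof.
move=> uy; apply/tangentP => F gF F0.
by rewrite (dirD_local v uy F0); exact: dirDc.
Qed.

HB.lock Definition vfield (R : realType) (N : nat) (A : set 'M[R[i]]_N)
    (W : 'M[R[i]]_N -> 'M[R[i]]_N) (f : coord_ring A) : coord_ring A :=
  to_coord (fun y : A => lineD (extend f) (val y) (W (val y))).

Section Derivations.
Context {R : realType} {N : nat}.
Local Notation C := R[i].
Local Notation M := 'M[C]_N.
Variable A : set M.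
Hypothesis AGL : A `<=` [set x | x \in unitmx].
Implicit Types (f g : coord_ring A) (F : M -> C) (y : A).

Lemma coord_inj f g : (forall y, f y = g y) -> f = g.
Proof. by move=> fg; apply: val_inj; apply/funext. Qed.

Lemma coordD f g y : (f + g) y = f y + g y. Proof. by []. Qed.
Lemma coordM f g y : (f * g) y = f y * g y. Proof. by []. Qed.
Lemma coordZ (a : C) f y : (a *: f) y = a * f y. Proof. by []. Qed.
Lemma coordB f g y : (f - g) y = f y - g y. Proof. by []. Qed.

Lemma coord_sum (I : Type) (r : seq I) (F : I -> coord_ring A) y :
  (\sum_(i <- r) F i) y = \sum_(i <- r) F i y.
Proof. by elim/big_rec2: _ => // i a b _ <-. Qed.

Lemma coord_regular f : regular_on (f : A -> C).
Proof. by have /asboolP := valP f. Qed.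

Lemma extend_coordE f y : f y = extend f (val y).
Proof. by have [_ ->] := extendP (coord_regular f). Qed.

Lemma coord_set_val y : A (val y).
Proof. exact: set_mem (valP y). Qed.

Definition mkA x (Ax : A x) : A := exist _ x (mem_set Ax).

Variable W : M -> M.
Hypotheses (gW : regular_mx W) (tW : forall x, A x -> tangent A x (W x)).

(** Tangency makes the derivative independent of the extension, so a computation may use whichever
    extension suits it in place of [extend f]. *)
Lemma vfieldE F f y : regularGL F -> (forall z, f z = F (val z)) ->
  vfield W f y = dirD F (val y) (W (val y)).
Proof.
move=> gF fF; have [H gH HE] := regularGL_dirD (regularGL_extend f) gW.
rewrite vfield.unlock to_coordE -?dirDE.
  apply: (@dirD_tangent _ _ _ AGL) => //; first exact: coord_set_val.
  - by apply: tW; exact: coord_set_val.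
  - exact: regularGL_extend.
  - by move=> x Ax; rewrite -[x]/(val (mkA Ax)) -extend_coordE fF.
exists H => // z; rewrite -dirDE HE//; exact: AGL (coord_set_val z).
Qed.

Lemma vfield_linear (a : C) f g : vfield W (a *: f + g) =
  a *: vfield W f + vfield W g.
Proof.
have gf := regularGL_extend f; have gg := regularGL_extend g.
apply: coord_inj => y; have uy := AGL (coord_set_val y).
rewrite coordD coordZ (vfieldE _ gf (extend_coordE f))
  (vfieldE _ gg (extend_coordE g)).
rewrite (@vfieldE (fun x => a * extend f x + extend g x)).
- by rewrite (dirD_add _ (regularGLZ a gf) gg uy) (dirD_scale _ _ gf uy).
- by apply: regularGL_add => //; exact: regularGLZ.
- by move=> z; rewrite coordD coordZ -!extend_coordE.
Qed.

Lemma vfield_mul f g : vfield W (f * g) = vfield W f * g + f * vfield W g.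
Proof.
have gf := regularGL_extend f; have gg := regularGL_extend g.
apply: coord_inj => y; have uy := AGL (coord_set_val y).
rewrite coordD !coordM (vfieldE _ gf (extend_coordE f))
  (vfieldE _ gg (extend_coordE g)).
rewrite (@vfieldE (fun x => extend f x * extend g x)).
- rewrite (dirD_mul _ gf gg uy) -!extend_coordE addrC; congr (_ + _);
  exact: mulrC.
- exact: regularGL_mul.
- by move=> z; rewrite coordM -!extend_coordE.
Qed.

End Derivations.

Lemma vfield_bracket (R : realType) (N : nat) (A : set 'M[R[i]]_N)
    (V W Z : 'M[R[i]]_N -> 'M[R[i]]_N) :
  A `<=` [set x | x \in unitmx] ->
  regular_mx V -> regular_mx W -> regular_mx Z ->
  (forall y, A y -> tangent A y (V y)) ->
  (forall y, A y -> tangent A y (W y)) ->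
  (forall y, A y -> tangent A y (Z y)) ->
  (forall y, A y -> Z y = jac W y (V y) - jac V y (W y)) ->
  forall f : coord_ring A,
  vfield V (vfield W f) - vfield W (vfield V f) = vfield Z f.
Proof.
move=> AGL gV gW gZ tV tW tZ ZE f; apply: coord_inj => y.
have gf := regularGL_extend f; have Ay := coord_set_val y; have uy := AGL _ Ay.
have [HV gHV HVE] := regularGL_dirD gf gV.
have [HW gHW HWE] := regularGL_dirD gf gW.
rewrite coordB (vfieldE AGL gZ tZ y gf (extend_coordE f)) ZE//.
rewrite (vfieldE AGL gV tV y gHW); last first.
  by move=> z; rewrite (vfieldE AGL gW tW z gf (extend_coordE f)) HWE//;
    exact: AGL (coord_set_val z).
rewrite (vfieldE AGL gW tW y gHV); last first.
  by move=> z; rewrite (vfieldE AGL gV tV z gf (extend_coordE f)) HVE//;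
    exact: AGL (coord_set_val z).
by rewrite (dirD_local _ uy HVE) (dirD_local _ uy HWE) dirD_commutator.
Qed.

(** * Weight decompositions of the regular functions on GL(N) *)

Section WeightDecomposition.
Context {R : realType} {N : nat}.
Local Notation C := R[i].
Local Notation M := 'M[C]_N.
Local Notation GL := [set x : M | x \in unitmx].
Local Notation O := (coord_ring GL).
Implicit Types (u v : O) (F : M -> C) (y : GL).

Definition restr F : O := to_coord (fun y : GL => F (val y)).

Lemma restrE F y : regularGL F -> restr F y = F (val y).
Proof. by move=> gF; rewrite /restr to_coordE//; exists F. Qed.

Lemma restr_extend u : u = restr (extend u).
Proof.
apply: coord_inj => y; rewrite restrE; first exact: extend_coordE.
exact: regularGL_extend.
Qed.

Variables (T T' : O -> O) (f : C -> C) (comp : C -> C -> C).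
Hypotheses (Tlin : forall a u v, T (a *: u + v) = a *: T u + T v)
  (Tprod : forall c d, exists p q : O -> O,
    [/\ p 0 = 0, q 0 = 0,
        forall u v, shift T (comp c d) (u * v) =
          shift T c u * p v + q u * shift T d v,
        forall v, shift T d (p v) = p (shift T d v) &
        forall u, shift T c (q u) = q (shift T c u)])
  (T'prod : forall c d u v, T' u = f c *: u -> T' v = f d *: v ->
    T' (u * v) = f (comp c d) *: (u * v)).

(* On sums of such vectors [T'] is [f] applied to the semisimple part of [T];
   hence every [T]-stable subspace is [T']-stable. *)
Definition weight_decomposable u := exists m (L : seq (O * C)),
  (forall e, e \in L ->
    iter m (shift T e.2) e.1 = 0 /\ T' e.1 = f e.2 *: e.1) /\
  u = \sum_(e <- L) e.1.

Lemma iter_shift_leq c k m u : (k <= m)%N -> iter k (shift T c) u = 0 ->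
  iter m (shift T c) u = 0.
Proof. by move=> /subnK <- h; rewrite iterD h (iter_shift0 Tlin). Qed.

Lemma weight_decomposableD u v : weight_decomposable u ->
  weight_decomposable v -> weight_decomposable (u + v).
Proof.
move=> [m [L [hL ->]]] [m' [L' [hL' ->]]].
exists (maxn m m'), (L ++ L'); rewrite big_cat; split=> // e.
rewrite mem_cat => /orP[/hL|/hL'] [h ->]; split=> //; apply: iter_shift_leq h.
  exact: leq_maxl.
exact: leq_maxr.
Qed.

(** [comp] is the law by which the weights of two factors combine: addition for a derivation,
    multiplication for a translation. *)
Lemma weight_decomposableM u v : weight_decomposable u ->
  weight_decomposable v -> weight_decomposable (u * v).
Proof.
move=> [m [L [hL ->]]] [m' [L' [hL' ->]]].
exists (m + m')%N, [seq (e.1 * e'.1, comp e.2 e'.2) | e <- L, e' <- L'].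
split; last first.
  rewrite big_allpairs_dep mulr_suml; apply: eq_bigr => e _.
  by rewrite mulr_sumr.
move=> _ /allpairsP[[e e'] /= [/hL[h1 h2] /hL'[h1' h2'] ->]] /=.
split; last exact: T'prod.
have [p [q [p0 q0 pq cp cq]]] := Tprod e.2 e'.2.
exact: (iter_prod_eq0 (fun u v => iter_shiftD Tlin _ 1 u v) p0 q0 pq cp cq).
Qed.

Lemma weight_decomposable1 u c m : iter m (shift T c) u = 0 ->
  T' u = f c *: u -> weight_decomposable u.
Proof.
move=> h h'; exists m, [:: (u, c)]; rewrite big_seq1; split=> // e.
by rewrite inE => /eqP->.
Qed.

Hypotheses (wd_cst : forall c, weight_decomposable (restr (fun=> c)))
  (wd_coord : forall i j, weight_decomposable (restr (fun x => x i j)))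
  (wd_invdet : weight_decomposable (restr (fun x => (\det x)^-1))).

Lemma weight_decomposable_all u : weight_decomposable u.
Proof.
rewrite (restr_extend u); elim: (regularGL_extend u) =>
  [c|i j||F H gF wF gH wH|F H gF wF gH wH].
- exact: wd_cst.
- exact: wd_coord.
- exact: wd_invdet.
- have -> : restr (fun x => F x + H x) = restr F + restr H.
    by apply: coord_inj => y; rewrite coordD !restrE//; exact: regularGL_add.
  exact: weight_decomposableD.
- have -> : restr (fun x => F x * H x) = restr F * restr H.
    by apply: coord_inj => y; rewrite coordM !restrE//; exact: regularGL_mul.
  exact: weight_decomposableM.
Qed.

End WeightDecomposition.

Section StableSubspace.
Context {R : realType} {N : nat}.
Local Notation C := R[i].
Local Notation M := 'M[C]_N.
Local Notation GL := [set x : M | x \in unitmx].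
Local Notation O := (coord_ring GL).
Implicit Types (u v : O).
Variables (T T' : O -> O) (f : C -> C).
Hypotheses (Tlin : forall a u v, T (a *: u + v) = a *: T u + T v)
  (T'D : forall u v, T' (u + v) = T' u + T' v)
  (T_weights : forall u, weight_decomposable T T' f u).
Variable S : O -> Prop.
Hypotheses (S0 : S 0) (SD : forall u v, S u -> S v -> S (u + v))
  (SZ : forall a u, S u -> S (a *: u)) (ST : forall u, S u -> S (T u)).

Let T'0 : T' 0 = 0.
Proof.
by have /eqP := T'D 0 0; rewrite addr0 -subr_eq subrr eq_sym => /eqP.
Qed.

Let T'_sum (L : seq (O * C)) : T' (\sum_(e <- L) e.1) = \sum_(e <- L) T' e.1.
Proof. by elim: L => [|e L IHL]; rewrite ?big_nil// !big_cons T'D IHL. Qed.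

(** The exact decomposition of [u] is compared with [L], which is one only modulo [S]:
    [weight_components] applies to their difference. The empty [L] gives stability of [S] under
    [T']. *)
Lemma stable_sub_weights u (L : seq (O * C)) m :
  (forall e, e \in L -> S (iter m (shift T e.2) e.1)) ->
  S (u - \sum_(e <- L) e.1) -> S (T' u - \sum_(e <- L) f e.2 *: e.1).
Proof.
move=> hL; have [m' [L' [hL' ->]]] := T_weights u => Su.
pose L1 := L' ++ [seq (-1 *: e.1, e.2) | e <- L].
have E (g : C -> C) : \sum_(e <- L1) g e.2 *: e.1 =
    \sum_(e <- L') g e.2 *: e.1 - \sum_(e <- L) g e.2 *: e.1.
  rewrite big_cat big_map /= -sumrN; congr (_ + _); apply: eq_bigr => e _.
  by rewrite scaleN1r scalerN.
have -> : T' (\sum_(e <- L') e.1) = \sum_(e <- L') f e.2 *: e.1.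
  rewrite T'_sum big_seq [RHS]big_seq; apply: eq_bigr => e /hL'[_].
  by [].
rewrite -E; apply: (weight_components Tlin S0 SD SZ ST (m := maxn m m')) =>
  [e|].
  rewrite mem_cat => /orP[/hL'[h _]|/mapP[e' /hL h ->]] /=.
    by rewrite (iter_shift_leq Tlin _ h) ?leq_maxr.
  rewrite (iter_shiftZ Tlin); apply: SZ.
  rewrite -(subnK (leq_maxl m m')) iterD.
  exact: (iter_shift_stable SD SZ ST).
have := E (fun=> 1); under eq_bigr do rewrite scale1r.
move=> ->; under [X in X - _]eq_bigr do rewrite scale1r.
by under [X in _ - X]eq_bigr do rewrite scale1r.
Qed.

Lemma stable_T' u : S u -> S (T' u).
Proof.
move=> Su; have := @stable_sub_weights u [::] 0; rewrite !big_nil !subr0.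
by apply.
Qed.

(* The matrix of functions [Th] transforms under [T] by right multiplication
   by [x], up to [S]; then it transforms under [T'] by [f] of the semisimple
   part of [x]. *)
Lemma stable_matrix (Th : 'I_N -> 'I_N -> O) (x : M) (r : seq C)
    (pi : C -> M) (w : C -> C) m :
  (forall i j (a : M),
    S (T (\sum_k a k j *: Th i k) - \sum_k (x *m a) k j *: Th i k)) ->
  \sum_(c <- r) pi c = 1%:M ->
  (forall c, c \in r -> iter m (fun a => x *m a - w c *: a) (pi c) = 0) ->
  forall i j,
    S (T' (Th i j) - \sum_k (\sum_(c <- r) f (w c) *: pi c) k j *: Th i k).
Proof.
move=> hT pi1 pinil i j.
pose th (a : M) := \sum_k a k j *: Th i k.
have thD a b : th (a + b) = th a + th b.
  by rewrite /th -big_split; apply: eq_bigr => k _; rewrite mxE scalerDl.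
have thZ c a : th (c *: a) = c *: th a.
  by rewrite /th scaler_sumr; apply: eq_bigr => k _; rewrite mxE scalerA.
have th0 : th 0 = 0 by rewrite /th big1// => k _; rewrite mxE scale0r.
have th_sum (g : C -> M) s : th (\sum_(c <- s) g c) = \sum_(c <- s) th (g c).
  by elim: s => [|c s IHs]; rewrite ?big_nil ?th0// !big_cons thD IHs.
have SB u v : S u -> S v -> S (u - v).
  by move=> Su Sv; rewrite -scaleN1r; apply: SD => //; exact: SZ.
(* Modulo [S], the map [th] carries left multiplication by [x] to [T], hence also the shifts to the
   shifts. *)
have shift_th c k a : S (iter k (shift T c) (th a) -
    th (iter k (fun a => x *m a - c *: a) a)).
  elim: k => [|k IHk] /=; first by rewrite subrr.
  set u := iter k _ _ in IHk *; set b := iter k _ a in IHk *.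
  have -> : shift T c u - th (x *m b - c *: b) =
      shift T c (u - th b) + (T (th b) - th (x *m b)).
    have thB : th (x *m b - c *: b) = th (x *m b) - c *: th b.
      by rewrite -scaleNr thD thZ scaleNr.
    have shB v1 v2 : shift T c (v1 - v2) = shift T c v1 - shift T c v2.
      have := iter_shift_linear Tlin c 1 (-1) v2 v1 => /=.
      by rewrite !scaleN1r addrC => ->; rewrite addrC.
    by rewrite shB thB [shift T c (th b)]/shift !opprB -[RHS]addrA;
      congr (_ + _); rewrite subrKA.
  apply: SD; last exact: hT.
  exact: (iter_shift_stable SD SZ ST c 1).
(* The matrices [pi c] sum to 1, so [Th i j], which is [th 1%:M], is the sum of the [th (pi c)];
   these have weight [w c] modulo [S]. *)
have := @stable_sub_weights (Th i j) [seq (th (pi c), w c) | c <- r] m.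
rewrite !big_map /= -th_sum pi1.
have -> : th 1%:M = Th i j.
  rewrite /th (bigD1 j)//= mxE eqxx scale1r big1 ?addr0// => k kj.
  by rewrite mxE (negPf kj) scale0r.
rewrite subrr => H.
rewrite -/(th (\sum_(c <- r) f (w c) *: pi c)).
have <- : \sum_(c <- r) f (w c) *: th (pi c) =
    th (\sum_(c <- r) f (w c) *: pi c).
  by rewrite th_sum; apply: eq_bigr => c _; rewrite thZ.
apply: H => // _ /mapP[c cr ->] /=.
by have := shift_th (w c) m (pi c); rewrite pinil// th0 subr0.
Qed.

End StableSubspace.

Section DetDerivative.
Context {R : realType} {n : nat}.
Local Notation C := R[i].
Local Notation M := 'M[C]_n.+1.

Lemma is_derive_horner (q : {poly C}) (a : C) :
  is_derive (a : C^o) 1 (fun t : C^o => q.[t] : C^o) (q^`().[a]).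
Proof.
elim/poly_ind: q => [|q c IHq].
  under eq_fun do rewrite horner0.
  by rewrite derivC horner0; exact: is_derive_cst.
under eq_fun do rewrite hornerMXaddC.
rewrite derivD derivM derivX derivC addr0 mulr1 hornerD hornerM hornerX.
have h := is_deriveD (is_deriveM IHq (is_derive_id (a : C^o) 1))
  (is_derive_cst (c : C^o) (a : C^o) 1).
rewrite addr0 in h; apply: (is_derive_eq h).
by rewrite addrC; congr (_ + _); [exact: mulrC|exact: mulr1].
Qed.

(** Jacobi's formula. Multiplicativity reduces it to y = 1, where det (1 + t x) is the product of
    the 1 + t z over the eigenvalues z. *)
Lemma dirD_det (y x : M) : y \in unitmx ->
  dirD (fun z => \det z) y (y *m x) = \tr x * \det y.
Proof.
move=> uy; have gd : regularGL (fun z : M => \det z)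
  by exact: (regularGL_det (@regular_mxid R n.+1)).
have u1 : (1%:M : M) \in unitmx by exact: unitmx1.
have := dirD_mulmx2 y 1%:M (fun z : M => \det z) 1%:M x.
rewrite !mulmx1 => <-.
under eq_fun do rewrite mulmx1 det_mulmx.
rewrite (dirD_scale _ _ gd u1) mulrC; congr (_ * _).
pose q : {poly C} := \prod_(z <- spectrum x) (1 + z%:P * 'X).
have qE (t : C) : \det (1%:M + t *: x) = q.[t].
  have -> : 1%:M + t *: x = horner_mx x (1 + t%:P * 'X).
    rewrite rmorphD rmorphM rmorph1 /= horner_mx_X !horner_mx_C.
    by rewrite -[in RHS]mulmxE mul_scalar_mx.
  rewrite det_horner_mx /q horner_prod; apply: eq_bigr => z _.
  by rewrite !hornerE mulrC.
rewrite dirDE /lineD; under eq_fun do rewrite qE.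
rewrite derive1E; have [_ ->] := is_derive_horner q 0.
rewrite trace_spectrum /q; elim: (spectrum x) => [|z s IHs].
  by rewrite !big_nil derivC horner0.
have dz : (1 + z%:P * 'X : {poly C})^`() = z%:P.
  by rewrite derivD derivC derivM derivC derivX mul0r mulr1 !add0r.
rewrite !big_cons derivM dz hornerD !hornerM IHs; congr (_ + _).
  by rewrite hornerC horner_prod big1 ?mulr1// => w _; rewrite !hornerE.
by rewrite !hornerE.
Qed.

End DetDerivative.

(** * Jordan decomposition in an algebraic group and its Lie algebra *)

Section RightTranslations.
Context {R : realType} {n : nat}.
Local Notation C := R[i].
Local Notation M := 'M[C]_n.+1.
Local Notation GL := [set x : M | x \in unitmx].
Local Notation O := (coord_ring GL).
Implicit Types (u v : O) (F : M -> C) (x : M) (g : GL).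

Lemma GL_unit g : val g \in unitmx. Proof. exact: (coord_set_val g). Qed.

(** The parameter [a] turns right translation by [x], and its infinitesimal version, into left
    multiplication of [a] by [x]; taking eigenprojections for [a] then gives weight vectors. *)
Definition entry (a : M) i j : O := restr (fun y => (y *m a) i j).

Lemma entryE (a : M) i j g : entry a i j g = (val g *m a) i j.
Proof.
by rewrite /entry restrE//; apply: regular_mxM;
  [exact: regular_mxid|exact: regular_mxc].
Qed.

Lemma entry_lin (c : C) (a b : M) i j : entry (c *: a + b) i j =
  c *: entry a i j + entry b i j.
Proof.
by apply: coord_inj => g; rewrite coordD coordZ !entryE mulmxDr -scalemxAr !mxE.
Qed.

Lemma entryZ (c : C) (a : M) i j : entry (c *: a) i j = c *: entry a i j.
Proof. by apply: coord_inj => g; rewrite coordZ !entryE -scalemxAr mxE. Qed.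

Lemma entryB (a b : M) i j : entry (a - b) i j = entry a i j - entry b i j.
Proof. by apply: coord_inj => g; rewrite coordB !entryE mulmxBr !mxE. Qed.

Lemma entry0 i j : entry 0 i j = 0.
Proof. by apply: coord_inj => g; rewrite entryE mulmx0 mxE. Qed.

Lemma entry_sum (r : seq C) (a : C -> M) i j :
  entry (\sum_(c <- r) a c) i j = \sum_(c <- r) entry (a c) i j.
Proof.
elim: r => [|c r IHr]; first by rewrite !big_nil entry0.
by rewrite !big_cons -IHr -[a c]scale1r entry_lin !scale1r.
Qed.

(* The coordinates decompose along the generalized eigenspaces of [x]. *)
Section Coordinates.
Variables (T T' : O -> O) (f : C -> C) (x : M).
Hypotheses (Tlin : forall a u v, T (a *: u + v) = a *: T u + T v)
  (T_entry : forall a i j, T (entry a i j) = entry (x *m a) i j)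
  (T'_entry : forall a i j, T' (entry a i j) = entry (mxfun f x *m a) i j)
  (wd0 : weight_decomposable T T' f 0).

Lemma weight_decomposable_coord i j :
  weight_decomposable T T' f (restr (fun y => y i j)).
Proof.
have -> : restr (fun y : M => y i j) = entry 1%:M i j.
  by rewrite /entry; under [in RHS]eq_fun do rewrite mulmx1.
have -> : 1%:M = \sum_(c <- undup (spectrum x)) eigproj x c
  by rewrite sum_eigproj1.
rewrite entry_sum big_seq; apply: big_rec => // c u; rewrite mem_undup => cx.
apply: weight_decomposableD => //.
apply: (weight_decomposable1 (c := c) (m := n.+1)); last first.
  by rewrite T'_entry mulmxE mxfun_eigproj// entryZ.
have E k a : iter k (shift T c) (entry a i j) =
  entry ((x - c%:A) ^+ k *m a) i j.
  elim: k => [|k IHk]; first by rewrite expr0 mul1mx.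
  rewrite iterS IHk /shift T_entry -entryZ -entryB; congr (entry _ i j).
  by rewrite !mulmxE exprS -mulrA mulrBl -scalerAl mul1r.
by rewrite E mulmxE eigproj_nilp entry0.
Qed.

End Coordinates.

(** The left-invariant vector field of [x], that is, infinitesimal right translation. *)
Definition lderiv x : O -> O := vfield (fun y => y *m x).

Lemma regular_mx_rmul x : regular_mx (fun y : M => y *m x).
Proof. by apply: regular_mxM; [exact: regular_mxid|exact: regular_mxc]. Qed.

Lemma lderivE x u F g : regularGL F -> (forall z, u z = F (val z)) ->
  lderiv x u g = dirD F (val g) (val g *m x).
Proof.
move=> gF uF; apply: (vfieldE _ (regular_mx_rmul x) _ g gF uF) => // y uy.
exact: tangent_GL.
Qed.

Lemma lderiv_linear x a u v : lderiv x (a *: u + v) =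
  a *: lderiv x u + lderiv x v.
Proof.
apply: vfield_linear => //; first exact: regular_mx_rmul.
by move=> y uy; exact: tangent_GL.
Qed.

Lemma lderiv_mul x u v : lderiv x (u * v) = lderiv x u * v + u * lderiv x v.
Proof.
apply: vfield_mul => //; first exact: regular_mx_rmul.
by move=> y uy; exact: tangent_GL.
Qed.

Lemma lderivD x u v : lderiv x (u + v) = lderiv x u + lderiv x v.
Proof. by have := lderiv_linear x 1 u v; rewrite !scale1r. Qed.

Lemma lderiv_entry x a i j : lderiv x (entry a i j) = entry (x *m a) i j.
Proof.
apply: coord_inj => g.
have gF : regularGL (fun y : M => (y *m a) i j) by exact: regular_mx_rmul.
rewrite (lderivE x g gF) => [|z]; last exact: entryE.
rewrite -(jacE (fun y => y *m a)) jacM; last exact: GL_unit.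
- by rewrite jacid jacc mulmx0 addr0 entryE mulmxA.
- exact: regular_mxid.
- exact: regular_mxc.
Qed.

Section Additive.
Variables (f : C -> C) (x : M).
Hypothesis fD : forall a b, f (a + b) = f a + f b.

Let f0 : f 0 = 0.
Proof. by have /eqP := fD 0 0; rewrite addr0 -subr_eq subrr eq_sym => /eqP. Qed.

Let fN a : f (- a) = - f a.
Proof. by apply/eqP; rewrite -addr_eq0 -fD addNr f0. Qed.

Let f_sum (s : seq C) : f (\sum_(z <- s) z) = \sum_(z <- s) f z.
Proof. by elim: s => [|z s IHs]; rewrite ?big_nil// !big_cons fD IHs. Qed.

Lemma lderiv_prod c d : exists p q : O -> O,
  [/\ p 0 = 0, q 0 = 0,
      forall u v, shift (lderiv x) (c + d) (u * v) =
        shift (lderiv x) c u * p v + q u * shift (lderiv x) d v,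
      forall v, shift (lderiv x) d (p v) = p (shift (lderiv x) d v) &
      forall u, shift (lderiv x) c (q u) = q (shift (lderiv x) c u)].
Proof.
exists id, id; split=> // u v; apply: coord_inj => g.
rewrite /shift lderiv_mul coordB coordZ !coordD !coordM !coordB !coordZ.
ring.
Qed.

Lemma lderiv_mxfun_prod c d u v : lderiv (mxfun f x) u = f c *: u ->
  lderiv (mxfun f x) v = f d *: v ->
  lderiv (mxfun f x) (u * v) = f (c + d) *: (u * v).
Proof.
move=> hu hv; apply: coord_inj => g.
rewrite lderiv_mul hu hv fD coordZ !coordD !coordM !coordZ; ring.
Qed.

(** The weights are 0 on constants, the eigenvalues of [x] on coordinates and [- \tr x] on the
    inverse determinant; additivity of [f] matches the last one with the trace of [mxfun f x]. *)
Lemma lderiv_weights u :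
  weight_decomposable (lderiv x) (lderiv (mxfun f x)) f u.
Proof.
have wd_cst c : weight_decomposable (lderiv x) (lderiv (mxfun f x)) f
  (restr (fun=> c)).
  have h y : lderiv y (restr (fun=> c)) = 0.
    apply: coord_inj => g; rewrite (lderivE y g (regularGL_const c));
      first exact: dirDc.
    by move=> z; rewrite restrE//; exact: regularGL_const.
  apply: (weight_decomposable1 (c := 0) (m := 1)); last by rewrite h f0 scale0r.
  by rewrite /= /shift h scale0r subrr.
apply: (weight_decomposable_all (@lderiv_linear x)
  (comp := +%R) lderiv_prod lderiv_mxfun_prod) => // [i j|].
  apply: weight_decomposable_coord => //.
  - exact: lderiv_linear.
  - exact: lderiv_entry.
  - exact: lderiv_entry.
  - have <- : restr (fun=> 0) = 0 :> O.
      by apply: coord_inj => g; rewrite restrE//; exact: regularGL_const.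
    exact: wd_cst.
have gi := @regularGL_invdet R n.+1.
have h y : lderiv y (restr (fun z => (\det z)^-1)) =
    - \tr y *: restr (fun z => (\det z)^-1).
  apply: coord_inj => g; rewrite (lderivE y g gi) => [|z]; last exact: restrE.
  rewrite (dirD_invdet _ (GL_unit g)) (dirD_det _ (GL_unit g)) coordZ restrE//.
  rewrite mulNr mulrCA expr2 -mulrA mulVf ?mulr1// -unitfE -unitmxE.
  exact: GL_unit.
apply: (weight_decomposable1 (c := - \tr x) (m := 1)).
  by rewrite /= /shift h subrr.
rewrite h fN [\tr x]trace_spectrum f_sum -[mxfun f x]mulr1
  -(rmorph1 (horner_mx x)).
by rewrite trace_mxfun; under eq_bigr do rewrite hornerC mulr1.
Qed.

End Additive.

Definition rtrans x u : O := restr (fun y => extend u (y *m x)).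

Definition GLmul g x (ux : x \in unitmx) : GL :=
  mkA (A := GL) (x := val g *m x)
    (eq_trans (unitmx_mul _ _) (introT andP (conj (GL_unit g) ux))).

Lemma rtransE x (ux : x \in unitmx) u g : rtrans x u g = u (GLmul g ux).
Proof.
rewrite /rtrans restrE; first by rewrite extend_coordE.
have := regularGL_mulmx2 1%:M x (regularGL_extend u).
by under eq_fun do rewrite mul1mx.
Qed.

Lemma rtrans_linear x (ux : x \in unitmx) a u v :
  rtrans x (a *: u + v) = a *: rtrans x u + rtrans x v.
Proof. by apply: coord_inj => g; rewrite coordD coordZ !(rtransE ux). Qed.

Lemma rtransM x (ux : x \in unitmx) u v : rtrans x (u * v) =
  rtrans x u * rtrans x v.
Proof. by apply: coord_inj => g; rewrite coordM !(rtransE ux). Qed.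

Lemma rtransD x (ux : x \in unitmx) u v : rtrans x (u + v) =
  rtrans x u + rtrans x v.
Proof. by apply: coord_inj => g; rewrite coordD !(rtransE ux). Qed.

Lemma rtrans_restr x (ux : x \in unitmx) F g : regularGL F ->
  rtrans x (restr F) g = F (val g *m x).
Proof. by move=> gF; rewrite (rtransE ux) restrE. Qed.

Lemma rtrans_entry x (ux : x \in unitmx) a i j : rtrans x (entry a i j) =
  entry (x *m a) i j.
Proof. by apply: coord_inj => g; rewrite (rtransE ux) !entryE mulmxA. Qed.

Lemma mxfun_id_unit x : x \in unitmx -> mxfun id x \in unitmx.
Proof. by rewrite !unitmxE det_mxfun -det_spectrum. Qed.

Lemma rtrans_weights x (ux : x \in unitmx) u :
  weight_decomposable (rtrans x) (rtrans (mxfun id x)) id u.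
Proof.
have us := mxfun_id_unit ux.
have wd_cst c : weight_decomposable (rtrans x) (rtrans (mxfun id x)) id
  (restr (fun=> c)).
  have h y : y \in unitmx -> rtrans y (restr (fun=> c)) = restr (fun=> c).
    move=> uy; apply: coord_inj => g; rewrite (rtrans_restr uy) ?restrE//;
    exact: regularGL_const.
  apply: (weight_decomposable1 (c := 1) (m := 1)); last by rewrite h// scale1r.
  by rewrite /= /shift h// scale1r subrr.
apply: (weight_decomposable_all (rtrans_linear ux)
  (comp := *%R)) => // [c d|c d v w hv hw|i j|].
(* The twists of an automorphism: translation of the right factor, the scalar [c] on the left
   one. *)
- exists (rtrans x), (fun u => c *: u); split=> [||v w|v|v].
  + by apply: coord_inj => g; rewrite (rtransE ux).
  + exact: scaler0.
  + apply: coord_inj => g.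
    rewrite /shift (rtransM ux) coordB coordZ !coordD !coordM !coordB !coordZ;
      ring.
  + have := rtrans_linear ux (- d) v (rtrans x v).
    by rewrite /shift addrC scaleNr => ->; rewrite scaleNr addrC.
  + have := rtrans_linear ux c v 0; rewrite !addr0.
    have -> : rtrans x 0 = 0 by apply: coord_inj => g; rewrite (rtransE ux).
    by rewrite addr0 /shift => ->; rewrite scalerBr !scalerA mulrC.
- apply: coord_inj => g; rewrite (rtransM us) hv hw !coordM !coordZ coordM;
  ring.
- apply: (weight_decomposable_coord (x := x)) => //.
  + exact: rtrans_linear.
  + exact: rtrans_entry.
  + exact: rtrans_entry.
  + have <- : restr (fun=> 0) = 0 :> O.
      by apply: coord_inj => g; rewrite restrE//; exact: regularGL_const.
    exact: wd_cst.
have gi := @regularGL_invdet R n.+1.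
have h y : y \in unitmx -> rtrans y (restr (fun z => (\det z)^-1)) =
    (\det y)^-1 *: restr (fun z => (\det z)^-1).
  move=> uy; apply: coord_inj => g.
  by rewrite (rtrans_restr uy)// coordZ restrE// det_mulmx invfM mulrC.
apply: (weight_decomposable1 (c := (\det x)^-1) (m := 1)).
  by rewrite /= /shift h// subrr.
by rewrite h// det_mxfun -det_spectrum.
Qed.

End RightTranslations.

(** * The Lie algebra of G and tangent vectors of P *)

Section InverseMap.
Context {R : realType} {N : nat}.
Local Notation C := R[i].
Local Notation M := 'M[C]_N.

(** [invmx] is defined by cases; the cofactor formula is a regular expression on all matrices. *)
Definition reg_inv (x : M) : M := \matrix_(i, j) ((\det x)^-1 * (\adj x) i j).

Lemma regular_mx_inv : regular_mx reg_inv.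
Proof. by move=> i j; under eq_fun do rewrite mxE; exact: regularGL_adj. Qed.

Lemma reg_invE x : x \in unitmx -> reg_inv x = invmx x.
Proof. by move=> ux; apply/matrixP => i j; rewrite mxE (invmx_adjE _ _ ux). Qed.

End InverseMap.

Section Group.
Context {R : realType} {N : nat}.
Local Notation C := R[i].
Local Notation M := 'M[C]_N.
Local Notation GL := [set x : M | x \in unitmx].
Variables (G : set M) (theta : M -> M).
Hypotheses (hG : algebraic_group G) (htheta : involutive_automorphism G theta).
Implicit Types (x y g h : M) (F : M -> C).

Lemma group_GL : G `<=` GL.
Proof. by move=> g; exact: group_unitmx. Qed.

Lemma group1 : G 1%:M. Proof. by case: hG. Qed.
Lemma groupM g h : G g -> G h -> G (g *m h).
Proof. by case: hG => _ _ + _; apply. Qed.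

Lemma groupV g : G g -> G (invmx g). Proof. by case: hG => _ _ _; apply. Qed.

Lemma group_closed x : x \in unitmx ->
  (forall F, regularGL F -> (forall g, G g -> F g = 0) -> F x = 0) -> G x.
Proof.
case: hG => -[S SR GE] _ _ _ ux h; rewrite GE; split=> // F SF.
by apply: h; [exact: SR|rewrite GE => g [_]; exact].
Qed.

Lemma theta_group g : G g -> G (theta g).
Proof. by case: htheta => + _ _ _; apply. Qed.

Lemma thetaM g h : G g -> G h -> theta (g *m h) = theta g *m theta h.
Proof. by case: htheta => _ _ + _; apply. Qed.

Lemma thetaK g : G g -> theta (theta g) = g.
Proof. by case: htheta => _ _ _; apply. Qed.

Lemma theta_unit g : G g -> theta g \in unitmx.
Proof. by move=> /theta_group/group_GL. Qed.

Lemma theta1 : theta 1%:M = 1%:M.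
Proof.
have u := theta_unit group1; have := thetaM group1 group1; rewrite mulmx1 => E.
by apply: (can_inj (mulKmx u)); rewrite mulmx1 -E.
Qed.

Lemma thetaV g : G g -> theta (invmx g) = invmx (theta g).
Proof.
move=> Gg; have ug := group_GL Gg; have ut := theta_unit Gg.
rewrite -[LHS]mulmx1 -(mulmxV ut) mulmxA -thetaM//; last exact: groupV.
by rewrite mulVmx// theta1 mul1mx.
Qed.

(** Off G the map [theta] is arbitrary and need not be differentiable, so derivatives are taken of a
    regular extension; along tangent vectors of G the choice is immaterial. *)
Definition Theta x : M :=
  \matrix_(i, j) extend (fun g : G => theta (val g) i j) x.

Lemma regular_mx_Theta : regular_mx Theta.
Proof. by move=> i j; under eq_fun do rewrite mxE; exact: regularGL_extend. Qed.

Lemma ThetaE g : G g -> Theta g = theta g.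
Proof.
move=> Gg; apply/matrixP => i j; rewrite mxE.
case: htheta => _ /(_ i j)/extendP[_ h] _ _.
by rewrite -[g]/(val (mkA Gg)) -h.
Qed.

Lemma dthetaE x : dtheta G theta x = jac Theta 1%:M x.
Proof.
apply/matrixP => i j; rewrite jacE mxE dirDE; congr (lineD _ _ _).
by apply/funext => y; rewrite mxE.
Qed.

Local Notation g_ := (Lie_algebra G).
Local Notation dth := (dtheta G theta).
Let u1 : (1%:M : M) \in unitmx := unitmx1 _ _.

Lemma dtheta_linear (a : C) x y : dth (a *: x + y) = a *: dth x + dth y.
Proof. by rewrite !dthetaE jac_linear//; exact: regular_mx_Theta. Qed.

Lemma dtheta0 : dth 0 = 0.
Proof.
have /eqP := dtheta_linear 1 0 0; rewrite !scale1r addr0.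
by rewrite -subr_eq subrr eq_sym => /eqP.
Qed.

Lemma dthetaZ (a : C) x : dth (a *: x) = a *: dth x.
Proof. by have := dtheta_linear a x 0; rewrite !addr0 dtheta0 addr0. Qed.

Lemma Lie_linear (a : C) x y : g_ x -> g_ y -> g_ (a *: x + y).
Proof. by apply: tangent_linear; [exact: group_GL|exact: group1]. Qed.

Lemma Lie0 : g_ 0.
Proof. by apply/tangentP => F gF _; rewrite dirD0. Qed.

Lemma LieZ (a : C) x : g_ x -> g_ (a *: x).
Proof. by move=> gx; have := Lie_linear a gx Lie0; rewrite addr0. Qed.

Lemma LieD x y : g_ x -> g_ y -> g_ (x + y).
Proof. by move=> gx gy; rewrite -[x]scale1r; exact: Lie_linear. Qed.

Lemma Lie_ltrans g x : G g -> g_ x -> tangent G g (g *m x).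
Proof.
move=> Gg /tangentP tx; apply/tangentP => F gF F0.
have := dirD_mulmx2 g 1%:M F 1%:M x; rewrite !mulmx1 => <-.
apply: tx => [|h Gh]; first exact: regularGL_mulmx2.
by rewrite mulmx1 F0//; exact: groupM.
Qed.

Lemma jac_Theta g x : G g -> g_ x -> jac Theta g (g *m x) = theta g *m dth x.
Proof.
move=> Gg tx; have := jac_mulmx2 g 1%:M Theta 1%:M x; rewrite !mulmx1 => <-.
rewrite (jac_tangent group_GL (W := fun h => theta g *m Theta h) group1 tx).
- rewrite jacM//; [|exact: regular_mxc|exact: regular_mx_Theta].
  by rewrite jacc mul0mx add0r dthetaE.
- by apply: regular_mx_mulmx2; exact: regular_mx_Theta.
- by apply: regular_mxM; [exact: regular_mxc|exact: regular_mx_Theta].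
- move=> h Gh; rewrite mulmx1 !ThetaE//; last exact: groupM.
  exact: thetaM.
Qed.

Lemma Lie_Ad g x : G g -> g_ x -> g_ (g *m x *m invmx g).
Proof.
move=> Gg /tangentP tx; apply/tangentP => F gF F0.
have := dirD_mulmx2 g (invmx g) F 1%:M x.
rewrite mulmx1 mulmxV; last exact: group_GL.
move=> <-; apply: tx => [|h Gh]; first exact: regularGL_mulmx2.
by apply: F0; apply: groupM; [exact: groupM|exact: groupV].
Qed.

Lemma dtheta_Ad g x : G g -> g_ x ->
  dth (g *m x *m invmx g) = theta g *m dth x *m invmx (theta g).
Proof.
move=> Gg tx; have ug := group_GL Gg; rewrite !dthetaE.
have := jac_mulmx2 g (invmx g) Theta 1%:M x; rewrite mulmx1 mulmxV// => <-.
have r1 : regular_mx (fun h => theta g *m Theta h).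
  by apply: regular_mxM; [exact: regular_mxc|exact: regular_mx_Theta].
rewrite (jac_tangent group_GL (W :=
  fun h => theta g *m Theta h *m invmx (theta g)) group1 tx).
- rewrite jacM//; last exact: regular_mxc.
  rewrite jacM//; [|exact: regular_mxc|exact: regular_mx_Theta].
  by rewrite !jacc mul0mx add0r mulmx0 addr0.
- by apply: regular_mx_mulmx2; exact: regular_mx_Theta.
- by apply: regular_mxM => //; exact: regular_mxc.
- move=> h Gh; have Gv := groupV Gg; have Ggh := groupM Gg Gh.
  by rewrite !ThetaE// ?thetaM// ?thetaV//; exact: groupM.
Qed.

(** Derivative at g = 1 of L(g y g^-1). It serves twice: with [L] running through the equations of
    the Lie algebra, and with [L] the pairing against a fixed element in the trace form. *)
Lemma bracket_Ad (L : M -> C) x y : scalar_linear L -> g_ x ->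
  (forall g, G g -> L (g *m y *m invmx g) = 0) -> L (x *m y - y *m x) = 0.
Proof.
move=> Llin tx L0.
have rid : regular_mx (fun g : M => g *m y).
  by apply: regular_mxM; [exact: regular_mxid|exact: regular_mxc].
have rV : regular_mx (fun g : M => g *m y *m reg_inv g).
  by apply: regular_mxM => //; exact: regular_mx_inv.
have <- : jac (fun g => g *m y *m reg_inv g) 1%:M x = x *m y - y *m x.
  have ji : jac (@reg_inv R N) 1%:M x = - x.
    have : jac (fun g : M => reg_inv g *m g) 1%:M x = 0.
      rewrite (jac_tangent (A := GL) (W := fun=> 1%:M) _ u1) ?jacc//.
      - exact: tangent_GL.
      - by apply: regular_mxM; [exact: regular_mx_inv|exact: regular_mxid].
      - exact: regular_mxc.
      - by move=> h uh; rewrite reg_invE// mulVmx.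
    rewrite jacM//; [|exact: regular_mx_inv|exact: regular_mxid].
    rewrite jacid reg_invE// invmx1 mulmx1 mul1mx => /eqP.
    by rewrite addr_eq0 => /eqP.
  rewrite jacM//; last exact: regular_mx_inv.
  rewrite jacM//; [|exact: regular_mxid|exact: regular_mxc].
  rewrite jacid jacc mulmx0 addr0 reg_invE// invmx1 mulmx1 mul1mx ji.
  by rewrite mulmxN.
rewrite -dirD_linear_comp//; move/tangentP: tx; apply.
  exact: regularGL_linear.
by move=> g Gg; rewrite reg_invE ?L0//; exact: group_GL.
Qed.

Lemma Lie_bracket x y : g_ x -> g_ y -> g_ (x *m y - y *m x).
Proof.
move=> tx ty; apply/tangentP => F gF F0.
apply: (bracket_Ad (L := dirD F 1%:M)) => // [a v w|g Gg];
  first exact: dirD_linear.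
by have /tangentP := Lie_Ad Gg ty; apply.
Qed.

Local Notation P := (sym_space G theta).

Lemma sym_space_action h y : G h -> P y -> P (h *m y *m invmx (theta h)).
Proof.
move=> Gh [g Gg <-]; exists (h *m g); first exact: groupM.
rewrite thetaM//.
have uh := theta_unit Gh; have ug := theta_unit Gg.
have uhg : theta h *m theta g \in unitmx by rewrite unitmx_mul uh.
rewrite -[RHS](mulmxK uhg); congr (_ *m _).
by rewrite !mulmxA mulmxKV// mulmxKV.
Qed.

(** Derivative at h = 1 of the orbit map sending h to h y theta(h)^-1, which takes G into P. *)
Lemma sym_space_tangent x y : P y -> g_ x -> tangent P y (x *m y - y *m dth x).
Proof.
move=> Py tx; have uy := sym_space_unitmx hG htheta Py.
have GGL := group_GL; have rTh := regular_mx_Theta.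
have dinv h : G h -> \det h * \det (reg_inv h) = 1.
  by move=> /GGL uh; rewrite reg_invE// -det_mulmx mulmxV// det1.
have gdet : regularGL (fun x : M => \det x)
  by exact: (regularGL_det (@regular_mxid R N)).
(* On G, theta(h)^-1 is [Theta] after inversion, a composite that agrees on G with a regular
   function by [regularGL_comp]. *)
have Tex i j : exists H, regularGL H /\ forall h, G h ->
  H h = invmx (theta h) i j.
  have [H [gH eH _]] := regularGL_comp GGL (@regular_mx_inv R N) gdet dinv
    (rTh i j).
  exists H; split=> // h Gh; rewrite eH// reg_invE; last exact: GGL.
  by rewrite ThetaE ?thetaV//; exact: groupV.
pose T h : M := \matrix_(i, j) sval (cid (Tex i j)) h.
have rT : regular_mx T.
  by move=> i j; under eq_fun do rewrite mxE; case: cid => H [].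
have TE h : G h -> T h = invmx (theta h).
  by move=> Gh; apply/matrixP => i j; rewrite mxE; case: cid => H [_ E] /=;
    exact: E.
have dT : jac T 1%:M x = - dth x.
  have : jac (fun h => T h *m Theta h) 1%:M x = 0.
    rewrite (jac_tangent GGL (W := fun=> 1%:M) group1 tx) ?jacc//.
    - exact: regular_mxM.
    - exact: regular_mxc.
    - move=> h Gh; rewrite TE// ThetaE// mulVmx//; exact: theta_unit Gh.
  rewrite jacM// TE ?ThetaE//; try exact: group1.
  rewrite theta1 invmx1 mulmx1 mul1mx -dthetaE => /eqP.
  by rewrite addr_eq0 => /eqP.
pose V h := h *m y *m T h.
have rhy : regular_mx (fun h : M => h *m y).
  by apply: regular_mxM; [exact: regular_mxid|exact: regular_mxc].
have rV : regular_mx V by exact: regular_mxM.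
have V1 : V 1%:M = y.
  by rewrite /V TE ?theta1 ?invmx1 ?mulmx1 ?mul1mx//; exact: group1.
have <- : jac V 1%:M x = x *m y - y *m dth x.
  rewrite jacM// jacM//; [|exact: regular_mxid|exact: regular_mxc].
  rewrite jacid jacc mulmx0 addr0 mul1mx dT TE ?theta1 ?invmx1 ?mulmx1
    ?mulmxN//.
  exact: group1.
rewrite -[X in tangent _ X _]V1.
(* The inverse determinant of [V h]; the inverse of theta(h) puts its determinant into the
   numerator. *)
pose d h := (\det h)^-1 * (\det y)^-1 * \det (Theta h).
apply: (tangent_map GGL rV (d := d)) => //; last exact: group1.
- apply: regularGL_mul; last exact: regularGL_det.
  by apply: regularGL_mul; [exact: regularGL_invdet|exact: regularGL_const].
- move=> h Gh; rewrite /d /V !det_mulmx TE// ThetaE// det_inv.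
  have := GGL _ Gh; rewrite /= unitmxE unitfE => dh.
  move: uy; rewrite unitmxE unitfE => dy.
  have := theta_unit Gh; rewrite unitmxE unitfE => dt.
  by field; rewrite dh dy dt.
- by move=> h Gh; rewrite /V TE//; exact: sym_space_action.
Qed.

End Group.

(** * Semisimple parts in G and in its Lie algebra *)

Section SemisimpleParts.
Context {R : realType} {n : nat}.
Local Notation C := R[i].
Local Notation M := 'M[C]_n.+1.
Local Notation GL := [set x : M | x \in unitmx].
Variables (G : set M) (theta : M -> M).
Hypotheses (hG : algebraic_group G) (htheta : involutive_automorphism G theta).
Implicit Types (x y g h : M) (F : M -> C).
Local Notation g_ := (Lie_algebra G).
Local Notation dth := (dtheta G theta).
Local Notation Theta := (Theta G theta).
Let u1 : (1%:M : M) \in unitmx := unitmx1 _ _.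
Let G1 := group1 hG.
Let rTheta := regular_mx_Theta G theta.

Lemma groupX g k : G g -> G (g ^+ k).
Proof.
move=> Gg; elim: k => [|k IHk]; first by rewrite expr0; exact: group1.
by rewrite exprS; exact: (groupM hG).
Qed.

(** The ideal of G. It is stable under translation by elements of G and under the fields of its Lie
    algebra, hence under their semisimple parts. *)
Let S (u : coord_ring GL) := forall z : GL, G (val z) -> u z = 0.

Let S0 : S 0. Proof. by []. Qed.
Let SD u v : S u -> S v -> S (u + v).
Proof. by move=> Su Sv z Gz; rewrite coordD Su// Sv// addr0. Qed.

Let SZ (a : C) u : S u -> S (a *: u).
Proof. by move=> Su z Gz; rewrite coordZ Su// mulr0. Qed.

Let S_restr F : regularGL F -> (forall g, G g -> F g = 0) -> S (restr F).
Proof. by move=> gF F0 z Gz; rewrite restrE// F0. Qed.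

Let S_lderiv x : g_ x -> forall u, S u -> S (lderiv x u).
Proof.
move=> tx u Su z Gz.
rewrite (lderivE x z (regularGL_extend u) (extend_coordE u)).
have /tangentP := Lie_ltrans hG Gz tx; apply; first exact: regularGL_extend.
move=> g Gg; have ug := group_GL hG Gg.
by rewrite -[g]/(val (mkA (A := GL) ug)) -extend_coordE Su.
Qed.

Let S_rtrans x (ux : x \in unitmx) : G x -> forall u, S u -> S (rtrans x u).
Proof.
by move=> Gx u Su z Gz; rewrite (rtransE ux) Su//=; exact: (groupM hG).
Qed.

Let one : GL := mkA (A := GL) u1.

Let th i j : coord_ring GL := restr (fun x => Theta x i j).

Let thE i j z : th i j z = Theta (val z) i j.
Proof. by rewrite restrE//; exact: rTheta. Qed.

Let mulThetaE (a : M) i j z : (\sum_k a k j *: th i k) z =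
  (Theta (val z) *m a) i j.
Proof.
by rewrite coord_sum mxE; apply: eq_bigr => k _; rewrite coordZ thE mulrC.
Qed.

(** Membership is stability of the ideal, evaluated at 1. For the second claim, modulo the ideal
    [lderiv x] acts on the entries [th] of theta as right multiplication by the differential of
    theta at [x], so [stable_matrix] applies. *)
Lemma Lie_mxfun (f : C -> C) x : (forall a b, f (a + b) = f a + f b) -> g_ x ->
  g_ (mxfun f x) /\ dth (mxfun f x) = mxfun f (dth x).
Proof.
move=> fD tx; have wd := lderiv_weights x fD.
have lin := @lderiv_linear R n x.
split.
  apply/tangentP => F gF F0.
  have := stable_T' lin (@lderivD R n (mxfun f x)) wd S0 SD SZ (S_lderiv tx)
    (S_restr gF F0).
  move=> /(_ one G1); rewrite (lderivE _ _ gF) => [|z]; last exact: restrE.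
  by rewrite mul1mx.
have E (a : M) i j z : G (val z) ->
    lderiv x (\sum_k a k j *: th i k) z = (\sum_k (dth x *m a) k j *: th i k) z.
  move=> Gz; rewrite mulThetaE.
  have rT : regular_mx (fun y => Theta y *m a).
    by apply: regular_mxM; [exact: rTheta|exact: regular_mxc].
  rewrite (lderivE _ _ (rT i j)) => [|z']; last exact: mulThetaE.
  have uz := group_GL hG Gz; rewrite -(jacE (fun y => Theta y *m a)) jacM//;
    last exact: regular_mxc.
  by rewrite jacc mulmx0 addr0 (jac_Theta hG htheta Gz tx) (ThetaE htheta Gz)
    mulmxA.
apply/matrixP => i j.
have := stable_matrix lin (@lderivD R n (mxfun f x)) wd S0 SD SZ (S_lderiv tx)
  (Th := th) (x := dth x) (r := undup (spectrum (dth x)))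
  (pi := eigproj (dth x)) (w := id) (m := n.+1).
rewrite sum_eigproj => H.
have {}H := H _ (sum_eigproj1 _) _ i j one G1.
have /eqP : (lderiv (mxfun f x) (th i j) -
   \sum_k mxfun f (dth x) k j *: th i k) one = 0.
  apply: H => [i' j' a z Gz|c _]; first by rewrite coordB E// subrr.
  have P k (a : M) : iter k (fun a : M => dth x *m a - c *: a) a =
    (dth x - c%:A) ^+ k *m a.
    elim: k => [|k IHk]; first by rewrite expr0 mul1mx.
    by rewrite iterS IHk !mulmxE exprS -mulrA mulrBl -scalerAl mul1r.
  by apply: (etrans (P _ _)); rewrite mulmxE eigproj_nilp.
rewrite coordB mulThetaE (ThetaE htheta G1) (theta1 hG htheta) mul1mx /=.
rewrite subr_eq0 => /eqP <-.
rewrite (lderivE _ _ (rTheta i j)) => [|z]; last exact: thE.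
by rewrite mul1mx dthetaE jacE.
Qed.

Lemma group_semisimple_part y : G y -> theta y = invmx y ->
  G (mxfun id y) /\ theta (mxfun id y) = mxfun (fun c => c^-1) y.
Proof.
move=> Gy ty; have uy := group_GL hG Gy; have us := mxfun_id_unit uy.
have wd := rtrans_weights uy; have lin := @rtrans_linear R n y uy.
have Gs : G (mxfun id y).
  apply: (group_closed hG) => // F gF F0.
  have := stable_T' lin (rtransD us) wd S0 SD SZ (S_rtrans uy Gy)
    (S_restr gF F0).
  by move=> /(_ one G1); rewrite (rtrans_restr us)// mul1mx.
split=> //.
have E (a : M) i j z : G (val z) ->
    rtrans y (\sum_k a k j *: th i k) z =
      (\sum_k (invmx y *m a) k j *: th i k) z.
  move=> Gz; rewrite (rtransE uy) !mulThetaE /= !(ThetaE htheta)//;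
    last exact: (groupM hG).
  by rewrite (thetaM htheta)// ty mulmxA.
apply/matrixP => i j.
have := stable_matrix lin (rtransD us) wd S0 SD SZ (S_rtrans uy Gy)
  (Th := th) (x := invmx y) (r := undup (spectrum y))
  (pi := eigproj y) (w := fun c => c^-1) (m := n.+1).
rewrite sum_eigproj => H.
have {}H := H _ (sum_eigproj1 _) _ i j one G1.
have /eqP : (rtrans (mxfun id y) (th i j) -
   \sum_k mxfun (fun c => c^-1) y k j *: th i k) one = 0.
  apply: H => [i' j' a z Gz|c]; first by rewrite coordB E// subrr.
  rewrite mem_undup => cy; have c0 := spectrum_unit uy cy.
  have P k (a : M) : iter k (fun a : M => invmx y *m a - c^-1 *: a) a =
      (invmx y - c^-1%:A) ^+ k *m a.
    elim: k => [|k IHk]; first by rewrite expr0 mul1mx.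
    by rewrite iterS IHk !mulmxE exprS -mulrA mulrBl -scalerAl mul1r.
  have e1 : invmx y * y = 1 by rewrite -mulmxE mulVmx.
  have e1' : y * invmx y = 1 by rewrite -mulmxE mulmxV.
  (* This factorization shows that the eigenprojections of [y] serve for its inverse too, with
     eigenvalue [c^-1]. *)
  have yV : invmx y - c^-1%:A = (- c^-1 *: invmx y) * (y - c%:A).
    have e2 : (- c^-1 *: invmx y) * c%:A = - invmx y.
      by rewrite -scalerAr mulr1 scalerA mulrN divff// scaleN1r.
    by rewrite mulrBr e2 -scalerAl e1 scaleNr opprK addrC.
  have comm : GRing.comm (- c^-1 *: invmx y) (y - c%:A).
    apply: commrB; last by rewrite /GRing.comm -scalerAr mulr1 -scalerAl mul1r.
    by rewrite /GRing.comm -scalerAl -scalerAr e1 e1'.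
  have nil : (invmx y - c^-1%:A) ^+ n.+1 *m eigproj y c = 0.
    rewrite yV (exprMn_comm _ comm) mulmxE -mulrA.
    exact: (etrans (congr1 (fun z => _ * z) (eigproj_nilp y c)) (mulr0 _)).
  exact: (etrans (P _ _) nil).
rewrite coordB mulThetaE (ThetaE htheta G1) (theta1 hG htheta) mul1mx /=.
rewrite subr_eq0 => /eqP <-.
by rewrite (rtransE us) thE /= mul1mx (ThetaE htheta).
Qed.

End SemisimpleParts.

Lemma horner_mx_comp (K : comNzRingType) (m : nat) (y : 'M[K]_m.+1)
    (q p : {poly K}) :
  horner_mx (horner_mx y q) p = horner_mx y (p \Po q).
Proof.
elim/poly_ind: p => [|p c IHp]; first by rewrite comp_poly0 !rmorph0.
rewrite comp_polyD comp_polyM comp_polyX comp_polyC !rmorphD !rmorphM /= IHp.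
by rewrite !horner_mx_X !horner_mx_C.
Qed.

(** * Unipotent elements of a reductive group *)

Section UnipotentCurve.
Context {R : realType} {n : nat}.
Local Notation C := R[i].
Local Notation M := 'M[C]_n.+1.
Implicit Types (u : M) (F : M -> C).

Definition binom_poly k : {poly C} :=
  (k`!%:R)^-1 *: \prod_(i < k) ('X - i%:R%:P).

Lemma binom_polyE k m : (binom_poly k).[m%:R] = 'C(m, k)%:R.
Proof.
have E : (\prod_(i < k) ('X - i%:R%:P : {poly C})).[m%:R] = (m ^_ k)%:R.
  elim: k => [|k IHk]; first by rewrite big_ord0 hornerC ffactn0.
  rewrite big_ord_recr hornerM IHk ffactnSr natrM !hornerE /=.
  have [km|mk] := leqP k m; first by rewrite natrB.
  by rewrite ffact_small// !mul0r.
rewrite hornerZ E -bin_ffact natrM mulrCA mulVf ?mulr1//.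
by rewrite pnatr_eq0 -lt0n fact_gt0.
Qed.

(* The polynomial curve [t |-> u ^ t] through the powers of a unipotent [u]. *)
Definition pow_curve u : 'M[{poly C}]_n.+1 :=
  \matrix_(i, j) \sum_(k < n.+1) ((u - 1) ^+ k) i j *: binom_poly k.

(** The logarithm series: for positive k the binomial polynomial has derivative (-1)^(k-1) / k at 0.
    In this form it is visibly the velocity of [pow_curve] at 0. *)
Definition unip_log u : M :=
  \sum_(k < n.+1) (binom_poly k)^`().[0] *: (u - 1) ^+ k.

Lemma pow_curveE u t : map_mx (horner^~ t) (pow_curve u) =
  \sum_(k < n.+1) (binom_poly k).[t] *: (u - 1) ^+ k.
Proof.
apply/matrixP => i j; rewrite !mxE summxE horner_sum; apply: eq_bigr => k _.
by rewrite hornerZ mxE mulrC.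
Qed.

Lemma deriv_pow_curve u :
  map_mx (fun p : {poly C} => p^`().[0]) (pow_curve u) = unip_log u.
Proof.
apply/matrixP => i j; rewrite !mxE summxE linear_sum horner_sum.
apply: eq_bigr => k _ /=; rewrite derivZ hornerZ [RHS]mxE; exact: mulrC.
Qed.

Variable u : M.
Hypothesis unil : (u - 1) ^+ n.+1 = 0.

Lemma pow_curve_nat (m : nat) : map_mx (horner^~ m%:R) (pow_curve u) = u ^+ m.
Proof.
rewrite pow_curveE; under eq_bigr do rewrite binom_polyE scaler_nat.
rewrite -[in RHS](subrK 1 u) exprD1n.
pose E k := (u - 1) ^+ k *+ 'C(m, k).
rewrite -!(big_mkord xpredT E).
(* Both sums are prolonged to a common length: one by nilpotency of [u - 1], the other because
   binomial coefficients vanish beyond [m]. *)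
have H K L : (K <= L)%N -> (forall k, (K <= k)%N -> E k = 0) ->
    \sum_(0 <= k < K) E k = \sum_(0 <= k < L) E k.
  move=> KL E0; rewrite [RHS](big_cat_nat (n := K))//=.
  by rewrite [X in _ + X]big_nat_cond [X in _ + X]big1 ?addr0// => k
    /andP[/andP[/E0]].
rewrite (H n.+1 (n.+1 + m.+1)%N) ?leq_addr// => [|k nk]; last first.
  by rewrite /E -(subnK nk) exprD unil mulr0 mul0rn.
rewrite [RHS](H m.+1 (n.+1 + m.+1)%N) ?leq_addl// => k mk.
by rewrite /E bin_small// mulr0n.
Qed.

Lemma det_unipotent : \det u = 1.
Proof.
have -> : u = horner_mx (u - 1) (1 + 'X).
  by rewrite rmorphD rmorph1 /= horner_mx_X addrC subrK.
rewrite det_horner_mx big_seq big1// => z zs.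
by rewrite !hornerE (spectrum_nilp unil zs) addr0.
Qed.

Lemma det_pow_curve t : \det (map_mx (horner^~ t) (pow_curve u)) = 1.
Proof.
have E t' : \det (map_mx (horner^~ t') (pow_curve u)) =
  (\det (pow_curve u)).[t'].
  by rewrite -[RHS]/(horner_eval t' _) -det_map_mx.
rewrite E; have -> : \det (pow_curve u) = 1; last by rewrite hornerC.
apply/eqP; rewrite -subr_eq0; apply/eqP/poly_nat_eq0 => k.
rewrite hornerD hornerN hornerC -E pow_curve_nat.
have -> : \det (u ^+ k) = \det u ^+ k.
  by elim: k => [|k IHk]; rewrite ?expr0 ?det1// !exprS det_mulmx IHk.
by rewrite det_unipotent expr1n subrr.
Qed.

Lemma unipotent_curve F : regularGL F -> exists q : {poly C},
  (forall t, F (map_mx (horner^~ t) (pow_curve u)) = q.[t]) /\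
  dirD F 1%:M (unip_log u) = q^`().[0].
Proof.
move=> gF; have [q [qE dq]] := regularGL_curve det_pow_curve gF.
exists q; split=> //; rewrite -dq deriv_pow_curve.
by have := pow_curve_nat 0; rewrite expr0 => ->.
Qed.

(** The powers of [u] are Zariski dense in its curve, so equations valid on the powers hold along
    the curve and to first order at 1. *)
Lemma unipotent_vanish F : regularGL F -> (forall m, F (u ^+ m) = 0) ->
  (forall t, F (map_mx (horner^~ t) (pow_curve u)) = 0) /\
  dirD F 1%:M (unip_log u) = 0.
Proof.
move=> gF F0; have [q [qE ->]] := unipotent_curve gF.
have q0 : q = 0 by apply: poly_nat_eq0 => k; rewrite -qE pow_curve_nat.
by split=> [t|]; rewrite ?qE q0 ?deriv0 horner0.
Qed.

(** The logarithm is [u - 1] times a polynomial in [u - 1] with constant term 1, and such a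
    polynomial is inverted modulo the nilpotency by Bezout. *)
Lemma unip_logE : exists w1 w2 : {poly C},
  unip_log u = (u - 1) * horner_mx u w1 /\ u - 1 = unip_log u * horner_mx u w2.
Proof.
pose p : {poly C} := \sum_(k < n) (binom_poly k.+1)^`().[0] *: 'X^k.
have E : unip_log u = (u - 1) * horner_mx (u - 1) p.
  have b0 : (binom_poly 0)^`().[0] = 0.
    by rewrite /binom_poly big_ord0 derivZ derivC scaler0 horner0.
  rewrite /unip_log big_ord_recl b0 scale0r add0r /p linear_sum mulr_sumr.
  apply: eq_bigr => k _.
  have Z c q : horner_mx (u - 1) (c *: q) = c *: horner_mx (u - 1) q
    by exact: linearZ.
  by rewrite [X in _ = _ * X](Z _ _) rmorphXn /= horner_mx_X -scalerAr -exprS.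
have uE q : horner_mx (u - 1) q = horner_mx u (q \Po ('X - 1)).
  by rewrite -horner_mx_comp rmorphB rmorph1 /= horner_mx_X.
exists (p \Po ('X - 1)).
(* For matrices of size 1 the sum [p] is empty and lacks the constant term 1, but then [u - 1] is
   0. *)
have [n0|n0] := posnP n.
  have e : n.+1 = 1%N by rewrite n0.
  exists 0; have := unil; rewrite [X in _ ^+ X]e expr1 E uE => ->.
  by rewrite !mul0r.
have p0 : p.[0] = 1.
  rewrite /p horner_sum -(prednK n0) big_ord_recl /= hornerZ hornerXn expr0
    mulr1.
  rewrite big1 ?addr0 => [|k _]; last by rewrite hornerZ hornerXn expr0n mulr0.
  rewrite /binom_poly big_ord1 derivZ derivXsubC hornerZ hornerC mulr1.
  exact: invr1.
have cp : coprimep p ('X ^+ n.+1).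
  apply: coprimep_expr; have := coprimep_XsubC p 0.
  by rewrite subr0 /root p0 oner_eq0.
have /Bezout_eq1_coprimepP[[a b] /= ab] := cp.
exists (a \Po ('X - 1)); rewrite -!uE; split=> //.
have := congr1 (horner_mx (u - 1)) ab; rewrite [a * p]mulrC.
rewrite rmorphD !rmorphM rmorph1 rmorphXn /= horner_mx_X unil mulr0 addr0.
by move=> /(congr1 ( *%R (u - 1))); rewrite mulr1 mulrA -E.
Qed.

End UnipotentCurve.

Lemma trace_conj (K : comPzRingType) (m : nat) (g a h b : 'M[K]_m) :
  \tr (g *m a *m h *m b) = \tr (a *m (h *m b *m g)).
Proof. by rewrite -!mulmxA mxtrace_mulC -!mulmxA. Qed.

Section ReductiveGroup.
Context {R : realType} {n : nat}.
Local Notation C := R[i].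
Local Notation M := 'M[C]_n.+1.
Local Notation GL := [set x : M | x \in unitmx].
Variables (G : set M) (theta : M -> M).
Hypotheses (Gred : reductive G) (htheta : involutive_automorphism G theta).
Implicit Types (x y g h u : M) (F : M -> C).

Let hG : algebraic_group G := Gred.1.
Local Notation g_ := (Lie_algebra G).
Local Notation dth := (dtheta G theta).
Let u1 : (1%:M : M) \in unitmx := unitmx1 _ _.

Definition trform x y : C := \tr (x *m y) + \tr (dth x *m dth y).

Definition trform_rad x := g_ x /\ forall y, g_ y -> trform x y = 0.

Lemma trform_linear y : scalar_linear (trform^~ y).
Proof.
move=> a v w; rewrite /trform dtheta_linear// !mulmxDl -!scalemxAl !mxtraceD
  !mxtraceZ.
by rewrite mulrDr addrACA.
Qed.

Lemma trform_Ad g x y : G g -> g_ x -> g_ y ->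
  trform (g *m x *m invmx g) y = trform x (invmx g *m y *m g).
Proof.
move=> Gg tx ty; have ug := group_GL hG Gg; have ut := theta_unit hG htheta Gg.
have := dtheta_Ad hG htheta (groupV hG Gg) ty.
rewrite invmxK (thetaV hG htheta Gg) invmxK /trform => ->.
by rewrite (dtheta_Ad hG htheta Gg tx) !trace_conj.
Qed.

Lemma trform_rad_Ad g x : G g -> trform_rad x -> trform_rad (g *m x *m invmx g).
Proof.
move=> Gg [tx x0]; split=> [|y ty]; first exact: (Lie_Ad hG).
rewrite (trform_Ad Gg tx ty); apply: x0.
by have := Lie_Ad hG (groupV hG Gg) ty; rewrite invmxK.
Qed.

Lemma trform_radD x y : trform_rad x -> trform_rad y -> trform_rad (x + y).
Proof.
move=> [tx x0] [ty y0]; split=> [|z tz]; first exact: LieD.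
by have := trform_linear z 1 x y; rewrite scale1r => ->;
  rewrite (x0 _ tz) (y0 _ tz) mulr0 addr0.
Qed.

Lemma trform_radZ (a : C) x : trform_rad x -> trform_rad (a *: x).
Proof.
move=> [tx x0]; split=> [|z tz]; first exact: LieZ.
have := trform_linear z a x 0; rewrite addr0 (x0 _ tz) mulr0 add0r => ->.
by rewrite /trform dtheta0 !mul0mx mxtrace0 addr0.
Qed.

(** Engel's theorem needs a Lie algebra; stability under Ad G differentiates to stability under
    brackets. *)
Lemma trform_rad_bracket x y : trform_rad x -> trform_rad y ->
  trform_rad (x * y - y * x).
Proof.
move=> [tx _] ry; split=> [|z tz]; last first.
  apply: (bracket_Ad hG (trform_linear z) tx) => g Gg.
  by have [_] := trform_rad_Ad Gg ry; apply.
rewrite -!mulmxE; exact: (Lie_bracket hG tx ry.1).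
Qed.

(* [h], the complex conjugate of the semisimple part of [x], lies in the Lie
   algebra, and [trform x h] is a sum of squared moduli of eigenvalues. *)
Lemma trform_rad_nilp x : trform_rad x -> x ^+ n.+1 = 0.
Proof.
move=> [tx x0]; pose f := fun c : C => Num.conj c.
have [th dh] := @Lie_mxfun R n G theta hG htheta f x (fun a b => rmorphD _ a b)
  tx.
have E (y : M) : \tr (y *m mxfun f y) = \sum_(z <- spectrum y) `|z| ^+ 2.
  rewrite mxtrace_mulC -[y in X in \tr (_ *m X)]horner_mx_X mulmxE trace_mxfun.
  by apply: eq_bigr => z _; rewrite hornerX mulrC normCK.
have := x0 _ th; rewrite /trform dh !E => /eqP.
have pos (s : seq C) : 0 <= \sum_(z <- s) `|z| ^+ 2.
  by apply: sumr_ge0 => z _; exact: exprn_ge0.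
rewrite paddr_eq0// => /andP[+ _]; rewrite psumr_eq0;
  last by move=> z _; exact: exprn_ge0.
move=> /allP h; apply: nilp_spectrum => z /h /=.
by rewrite expf_eq0 normr_eq0 => /andP[_ /eqP].
Qed.

Lemma trform_rad_trace x g : trform_rad x -> G g -> \tr (x *m g) = 0.
Proof.
move=> rx Gg.
exact: (trace_mul_normalizer trform_radD trform_radZ trform_rad_bracket
  trform_rad_nilp (group_GL hG Gg) (fun a => @trform_rad_Ad g a Gg) rx).
Qed.

Definition trace_kernel u := G u /\ forall g, G g -> \tr (u *m g) = \tr g.

(** Splitting off one factor u - 1 leaves the traces of the remaining power against u g and against
    g; both vanish inductively, so all positive powers of u - 1 have trace 0. *)
Lemma trace_kernel_nilp u : trace_kernel u -> (u - 1) ^+ n.+1 = 0.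
Proof.
move=> [Gu ut]; apply: nilp_trace.
suff H k g : G g -> \tr ((u - 1) ^+ k.+1 *m g) = 0.
  by move=> k; have := H k _ (group1 hG); rewrite mulmx1.
elim: k g => [|k IHk] g Gg.
  by rewrite expr1 mulmxBl mul1mx raddfB /= ut// subrr.
rewrite exprSr -mulmxE -mulmxA mulmxBl mul1mx mulmxBr raddfB /= !IHk ?subrr//.
exact: groupM.
Qed.

Lemma trace_kernel_group : algebraic_group trace_kernel.
Proof.
split.
- exists (fun F => regularGL F /\ forall u, trace_kernel u -> F u = 0).
    by move=> F [].
  apply/seteqP; split=> [u ku|u [uu h]].
    by split=> [|F [_ F0]]; [exact: (group_GL hG ku.1)|exact: F0].
  split.
    apply: (group_closed hG) => // F gF F0; apply: h; split=> // v [Gv _].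
    exact: F0.
  move=> g Gg; apply/eqP; rewrite -subr_eq0; apply/eqP.
  apply: (h (fun u => \tr (u *m g) - \tr g)); split.
    apply: regularGLB; last exact: regularGL_const.
    apply: regularGL_sum => i; apply: regular_mxM;
      [exact: regular_mxid|exact: regular_mxc].
  by move=> v [_ ->]//; rewrite subrr.
- by split=> [|g _]; [exact: (group1 hG)|rewrite mul1mx].
- move=> u v [Gu ut] [Gv vt]; split=> [|g Gg]; first exact: (groupM hG).
  by rewrite -mulmxA (ut _ (groupM hG Gv Gg)) (vt _ Gg).
- move=> u [Gu ut]; split=> [|g Gg]; first exact: (groupV hG).
  rewrite -(ut _ (groupM hG (groupV hG Gu) Gg)).
  by rewrite mulmxA (mulmxV (group_GL hG Gu)) mul1mx.
Qed.

(** A closed set with infinitely many powers of u contains the whole curve, in particular 1 and u.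
    One of two closed sets covering the kernel contains infinitely many powers, so each u lies on
    the side of 1. *)
Lemma trace_kernel_connected : zariski_connected trace_kernel.
Proof.
have closed_curve u (B : set M) : trace_kernel u -> zariski_closed B ->
    (forall k : nat, exists2 m, (k <= m)%N & B (u ^+ m)) ->
    forall t, B (map_mx (horner^~ t) (pow_curve u)).
  move=> ku [S SR BE] h t; have unil := trace_kernel_nilp ku.
  rewrite BE; split; first by rewrite /= unitmxE det_pow_curve// unitr1.
  move=> F SF; have [q [qE _]] := unipotent_curve unil (SR _ SF).
  rewrite qE; suff -> : q = 0 by rewrite horner0.
  apply: poly_frequently_eq0 => k; have [m km] := h k.
  by rewrite BE => -[_ /(_ F SF)] Fm; exists m => //; rewrite -qE pow_curve_nat.
move=> B1 B2 cB1 cB2 sub dis.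
have curve0 u : trace_kernel u -> map_mx (horner^~ 0) (pow_curve u) = 1%:M.
  by move=> /trace_kernel_nilp/pow_curve_nat/(_ 0%N) ->.
have curve1 u : trace_kernel u -> map_mx (horner^~ 1) (pow_curve u) = u.
  by move=> /trace_kernel_nilp/pow_curve_nat/(_ 1%N) ->.
have disj u : trace_kernel u -> B1 u -> B2 u -> False.
  by move=> ku b1 b2; suff : set0 u by []; rewrite -dis.
have one_side u : trace_kernel u ->
    (B1 1%:M /\ B1 u) \/ (B2 1%:M /\ B2 u).
  move=> ku; have [h|h] := pselect
    (forall k : nat, exists2 m, (k <= m)%N & B1 (u ^+ m)).
    by left; split; rewrite -?(curve0 _ ku) -?[u in B1 u](curve1 _ ku);
      apply: closed_curve.
  right; have {}h : forall k : nat, exists2 m, (k <= m)%N & B2 (u ^+ m).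
    move: h => /existsNP[k0 h] k; exists (maxn k0 k); first exact: leq_maxr.
    have [b1|//] := sub (u ^+ maxn k0 k) (groupX trace_kernel_group _ ku).
    by exfalso; apply: h; exists (maxn k0 k) => //; exact: leq_maxl.
  by split; rewrite -?(curve0 _ ku) -?[u in B2 u](curve1 _ ku);
    apply: closed_curve.
have k1 := group1 trace_kernel_group.
have [b1|b2] := sub _ k1; [right|left]; rewrite -subset0 => u [ku bu].
  by have [[_ b]|[b _]] := one_side u ku; [exact: (disj u)|exact: (disj 1%:M)].
by have [[b _]|[_ b]] := one_side u ku; [exact: (disj 1%:M)|exact: (disj u)].
Qed.

Lemma trace_kernel_trivial u : trace_kernel u -> u = 1%:M.
Proof.
move=> ku; have [_ H] := Gred.
have E := H trace_kernel trace_kernel_group trace_kernel_connected.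
suff : [set 1%:M] u by [].
rewrite -E//.
- by move=> v kv; exists n.+1; exact: trace_kernel_nilp.
- by move=> v [].
- move=> g v Gg [Gv vt]; have ug := group_GL hG Gg; split=> [|h Gh].
    by apply: groupM => //; [exact: groupM|exact: groupV].
  rewrite -!mulmxA mxtrace_mulC -!mulmxA vt; last first.
    by apply: groupM => //; [exact: groupV|exact: groupM].
  by rewrite mxtrace_mulC -mulmxA mulmxV// mulmx1.
Qed.

(** The equations of G and theta(h) h = 1 hold at all powers of [u], hence to first order along its
    curve. *)
Lemma group_log u : G u -> (u - 1) ^+ n.+1 = 0 -> theta u *m u = 1%:M ->
  g_ (unip_log u) /\ dth (unip_log u) = - unip_log u.
Proof.
move=> Gu unil tu; have rTh := regular_mx_Theta G theta.
split.
  apply/tangentP => F gF F0; have [|_ ->//] := unipotent_vanish unil gF.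
  by move=> m; apply: F0; exact: (groupX hG).
have rE : regular_mx (fun h => Theta G theta h *m h - 1%:M).
  apply: regular_mxB; last exact: regular_mxc.
  by apply: regular_mxM => //; exact: regular_mxid.
have : jac (fun h => Theta G theta h *m h - 1%:M) 1%:M (unip_log u) = 0.
  apply/matrixP => i j; rewrite jacE [RHS]mxE.
  have [|_ ->//] := unipotent_vanish unil (rE i j).
  move=> m; suff -> : Theta G theta (u ^+ m) *m u ^+ m = 1%:M
    by rewrite subrr mxE.
  rewrite (ThetaE htheta); last exact: (groupX hG).
  elim: m => [|m IHm]; first by rewrite expr0 (theta1 hG htheta) mulmx1.
  rewrite {1}exprSr exprS -!mulmxE (thetaM htheta)//; last exact: (groupX hG).
  by rewrite -mulmxA [theta u *m _]mulmxA tu mul1mx.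
rewrite jacB//; [|by apply: regular_mxM => //; exact: regular_mxid
  |exact: regular_mxc].
rewrite jacM//; last exact: regular_mxid.
rewrite jacc subr0 jacid mulmx1 (ThetaE htheta) ?(theta1 hG htheta) ?mul1mx;
  last exact: group1.
by rewrite -dthetaE => /eqP; rewrite addr_eq0 => /eqP.
Qed.

End ReductiveGroup.

(** * Points with the maximal number of eigenvalues *)

Section TraceVariation.
Context {R : realType} {n : nat}.
Local Notation C := R[i].
Local Notation M := 'M[C]_n.+1.
Implicit Types (x y v : M) (p q f g : {poly C}).

Lemma regular_mx_horner p : regular_mx (fun x : M => horner_mx x p).
Proof.
elim/poly_ind: p => [|p c IHp].
  by under eq_fun do rewrite rmorph0; exact: regular_mxc.
have -> : (fun x : M => horner_mx x (p * 'X + c%:P)) =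
    fun x => horner_mx x p *m x + c%:M.
  by apply/funext => x; rewrite rmorphD rmorphM /= horner_mx_X horner_mx_C.
apply: regular_mxD; last exact: regular_mxc.
by apply: regular_mxM => //; exact: regular_mxid.
Qed.

Lemma horner_mxC y q : horner_mx y q * y = y * horner_mx y q.
Proof.
by have := rmorphM (horner_mx y) q 'X; rewrite mulrC rmorphM /= horner_mx_X.
Qed.

(** Under the trace, cyclicity against a [b] commuting with [y] reduces the derivative of a matrix
    polynomial to the ordinary one. The induction needs general [b], as it multiplies [b] by [y]. *)
Lemma trace_jac_horner p y v b : y \in unitmx -> y *m b = b *m y ->
  \tr (jac (fun x => horner_mx x p) y v *m b) =
  \tr (v *m (b *m horner_mx y p^`())).
Proof.
move=> uy; elim/poly_ind: p b => [|p c IHp] b yb.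
  have -> : (fun x : M => horner_mx x 0) = fun=> 0.
    by apply/funext => x; rewrite rmorph0.
  by rewrite deriv0 rmorph0 jacc mul0mx !mulmx0.
have -> : (fun x : M => horner_mx x (p * 'X + c%:P)) =
    fun x => horner_mx x p *m x + c%:M.
  by apply/funext => x; rewrite rmorphD rmorphM /= horner_mx_X horner_mx_C.
have rp := regular_mx_horner p; have rid := @regular_mxid R n.+1.
rewrite (jacD _ (regular_mxM rp rid) (regular_mxc _) uy) (jacM _ rp rid uy).
rewrite jacc jacid addr0 mulmxDl mxtraceD -mulmxA IHp;
  last by rewrite -[RHS]mulmxA -yb.
rewrite derivD derivM derivX derivC addr0 mulr1 rmorphD rmorphM /= horner_mx_X.
rewrite mulmxDr mulmxDr mxtraceD; congr (\tr _ + _).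
  by rewrite yb -mulmxA mulmxE -horner_mxC.
by rewrite -mulmxA mxtrace_mulC mulmxA.
Qed.

Lemma regularGL_trace_horner p : regularGL (fun x : M => \tr (horner_mx x p)).
Proof. by apply: regularGL_sum => i; exact: regular_mx_horner. Qed.

Lemma dirD_trace_horner p y v : y \in unitmx ->
  dirD (fun x => \tr (horner_mx x p)) y v = \tr (v *m horner_mx y p^`()).
Proof.
move=> uy; have tl : scalar_linear (fun x : M => \tr x).
  by move=> a x z; rewrite mxtraceD mxtraceZ.
rewrite (dirD_linear_comp _ tl (regular_mx_horner p) uy).
rewrite -[jac _ _ _]mulmx1 (@trace_jac_horner p y v 1%:M uy) ?mul1mx//.
by rewrite mulmx1.
Qed.

Definition spectrum_poly y : {poly C} :=
  \prod_(c <- undup (spectrum y)) ('X - c%:P).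

Definition spectrum_size y := size (undup (spectrum y)).

Lemma spectrum_poly0 y c : c \in spectrum y -> (spectrum_poly y).[c] = 0.
Proof.
by move=> cs; apply/rootP; rewrite /spectrum_poly root_prod_XsubC mem_undup.
Qed.

Lemma dvdp_spectrum_poly y q :
  (forall c, c \in spectrum y -> q.[c] = 0) -> spectrum_poly y %| q.
Proof.
move=> q0; have := @dvdp_prod_XsubC_exp _ (undup (spectrum y)) (fun=> 1%N) q.
rewrite undup_uniq => /(_ isT); apply => c; rewrite mem_undup expr1 dvdp_XsubCl.
by move=> /q0/rootP.
Qed.

Lemma coprimep_spectrum_poly_deriv y :
  coprimep (spectrum_poly y) (spectrum_poly y)^`().
Proof.
have := separable_prod_XsubC (undup (spectrum y)).
by rewrite undup_uniq separable_poly.unlock.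
Qed.

Lemma spectrum_poly_nilp y : horner_mx y (spectrum_poly y ^+ n.+1) = 0.
Proof.
apply: horner_mx_eq0 => c cs; apply: dvdp_exp2r.
by rewrite dvdp_XsubCl; apply/rootP; exact: spectrum_poly0.
Qed.

(* With more than [spectrum_size x] rows the matrix of traces factors through
   the distinct eigenvalues of [x]. *)
Lemma det_trace_horner x m (p q : 'I_m -> {poly C}) : (spectrum_size x < m)%N ->
  \det (\matrix_(a, b) \tr (horner_mx x (p a * q b))) = 0.
Proof.
move=> xm; set D := \matrix_(_, _) _.
pose s := undup (spectrum x); pose k := size s.
pose A := \matrix_(a < m, c < k) (p a).[s`_c].
pose B := \matrix_(c < k, b < m)
  ((count_mem s`_c (spectrum x))%:R * (q b).[s`_c]).
have DE : D = A *m B.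
  apply/matrixP => a b; rewrite !mxE trace_horner_mx.
  rewrite -big_undup_iterop_count /= -/s (big_nth 0) big_mkord.
  by apply: eq_bigr => c _; rewrite !mxE hornerM mulrCA mulr_natl.
apply/eqP; rewrite -[_ == 0]negbK -unitfE -unitmxE DE;
  apply/negP => /mxrank_unit rk.
have := leq_trans (mxrankM_maxl A B) (rank_leq_col A).
by rewrite rk leqNgt xm.
Qed.

(* [S] plays the role of an open condition; on it the number of distinct
   eigenvalues is at most that of [y], so the minors above vanish to first
   order at [y]. *)
Lemma trace_variation_square (A : set M) (S : M -> C) y v g :
  A `<=` [set x | x \in unitmx] -> regularGL S -> A y -> S y != 0 ->
  (forall x, A x -> S x != 0 -> (spectrum_size x <= spectrum_size y)%N) ->
  tangent A y v ->
  \tr (v *m horner_mx y (spectrum_poly y ^+ 2 * g)^`()) = 0.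
Proof.
move=> AGL gS Ay Sy0 ymax tv; have uy := AGL _ Ay.
set r := spectrum_size y in ymax; pose s := undup (spectrum y).
set f := spectrum_poly y.
have f0 : forall c, c \in spectrum y -> f.[c] = 0
  by move=> c; exact: spectrum_poly0.
have lex (i : nat) : exists l : {poly C}, forall c, c \in s ->
  l.[c] = (c == s`_i)%:R.
  exact: (interpolation (fun c => (c == s`_i)%:R) s).
pose l i := sval (cid (lex i)).
have lE i c : c \in s -> (l i).[c] = (c == s`_i)%:R
  by rewrite /l; case: cid => l' h /h.
(* The rows carry a Lagrange basis for the spectrum of [y] and [f], the columns the same basis and
   [f * g]. At [y] the matrix is the diagonal of multiplicities bordered by zeros, so to first order
   only the corner counts. *)
pose p (h : {poly C}) (a : 'I_r.+1) := if (a < r)%N then l a else h.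
pose D x := \matrix_(a < r.+1, b < r.+1) \tr
  (horner_mx x (p f a * p (f * g) b)).
have gD a b : regularGL (fun x => D x a b).
  by under eq_fun do rewrite mxE; exact: regularGL_trace_horner.
have gdD : regularGL (fun x => \det (D x)) by exact: regularGL_det.
have ddD : dirD (fun x => \det (D x)) y v = 0.
  have D0 x : A x -> S x != 0 -> \det (D x) = 0.
    by move=> Ax Sx; apply: det_trace_horner; rewrite ltnS; exact: ymax.
  (* [S] times the determinant vanishes on all of [A], including the zeros of [S]; at [y] the factor
     [S] can be cancelled from the derivative. *)
  have := tv => /tangentP/(_ _ (regularGL_mul gS gdD)).
  rewrite (dirD_mul _ gS gdD uy) (D0 _ Ay Sy0) mul0r addr0 => H.
  apply: (mulfI Sy0); rewrite mulr0; apply: H => x Ax.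
  by have [->|Sx] := eqVneq (S x) 0; rewrite ?mul0r// D0 ?mulr0.
have pmax h : p h ord_max = h by rewrite /p ltnn.
have Dcol a : D y a ord_max = 0.
  rewrite mxE pmax trace_horner_mx big1_seq// => c /andP[_ cs].
  by rewrite !hornerM f0// mul0r mulr0.
have Drow b : D y ord_max b = 0.
  rewrite mxE pmax trace_horner_mx big1_seq// => c /andP[_ cs].
  by rewrite hornerM f0// mul0r.
have gcof a : regularGL (fun x => cofactor (D x) a ord_max).
  apply: regularGL_mul; first exact: regularGL_const.
  by apply: regularGL_det => i j; under eq_fun do rewrite !mxE;
    exact: regularGL_trace_horner.
have E : (fun x => \det (D x)) =
  fun x => \sum_a D x a ord_max * cofactor (D x) a ord_max.
  by apply/funext => x; exact: expand_det_col.
move: ddD; rewrite E dirD_sum//; last by move=> a; apply: regularGL_mul.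
have Eterm a : dirD (fun x => D x a ord_max * cofactor (D x) a ord_max) y v =
    cofactor (D y) a ord_max * dirD (fun x => D x a ord_max) y v.
  by rewrite (dirD_mul _ (gD a ord_max) (gcof a) uy) Dcol mul0r add0r.
under eq_bigr do rewrite Eterm.
rewrite (bigD1 ord_max)//= [X in _ + X]big1 ?addr0; last first.
  move=> a am; suff -> : cofactor (D y) a ord_max = 0 by rewrite mul0r.
  rewrite /cofactor; have [i iE _] := unlift_some am.
  by rewrite (expand_det_row _ i) big1 ?mulr0// => j _;
    rewrite 2!mxE -iE Drow mul0r.
(* This cofactor is the product of the multiplicities of the eigenvalues. *)
have cof0 : cofactor (D y) ord_max ord_max != 0.
  rewrite /cofactor mulf_neq0 ?signr_eq0//.
  have -> : row' ord_max (col' ord_max (D y)) =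
      diag_mx (\row_(i < r) (count_mem s`_i (spectrum y))%:R).
    apply/matrixP => i j; rewrite !mxE /p !lift_max !ltn_ord.
    rewrite trace_horner_mx -big_undup_iterop_count /= -/s.
    rewrite (bigD1_seq s`_i) ?undup_uniq//=;
      last by apply: mem_nth; exact: ltn_ord.
    have si : s`_i \in s by apply: mem_nth; exact: ltn_ord.
    rewrite big_seq_cond big1 ?addr0; last first.
      move=> c /andP[cs ci]; rewrite hornerM (lE _ _ cs) (negPf ci) mul0r.
      by rewrite Monoid.iteropE; elim: (count_mem c _) => //= k ->;
        rewrite addr0.
    rewrite hornerM !lE// eqxx mul1r nth_uniq ?undup_uniq ?ltn_ord//.
    rewrite -[i == j]val_eqE /= -[LHS]/((i == j :> nat)%:R *+ _ : C).
    by case: eqP => _; rewrite ?mulr1n ?mul0rn.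
  rewrite det_diag; apply/prodf_neq0 => i _;
    rewrite mxE pnatr_eq0 -lt0n -has_count.
  apply/hasP; exists s`_i => /=; last exact: eqxx.
  by rewrite -mem_undup; apply: mem_nth; exact: ltn_ord.
move=> /eqP; rewrite mulf_eq0 (negPf cof0) /= => /eqP.
have -> : (fun x => D x ord_max ord_max) =
  fun x => \tr (horner_mx x (f ^+ 2 * g)).
  by apply/funext => x; rewrite mxE !pmax mulrA.
by rewrite dirD_trace_horner.
Qed.

(** The square case handles derivatives of multiples of f^2. As f is squarefree, every multiple of
    f^(j+1) is such a derivative modulo f^(j+2), and f^(n+1) vanishes at [y]: descending induction
    on j. *)
Lemma trace_variation (A : set M) (S : M -> C) y v q :
  A `<=` [set x | x \in unitmx] -> regularGL S -> A y -> S y != 0 ->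
  (forall x, A x -> S x != 0 -> (spectrum_size x <= spectrum_size y)%N) ->
  tangent A y v -> spectrum_poly y %| q -> \tr (v *m horner_mx y q) = 0.
Proof.
move=> AGL gS Ay Sy0 ymax tv; set f := spectrum_poly y.
have sq g := trace_variation_square g AGL gS Ay Sy0 ymax tv.
pose L p := \tr (v *m horner_mx y p).
have LD p1 p2 : L (p1 + p2) = L p1 + L p2
  by rewrite /L rmorphD mulmxDr mxtraceD.
suff H j t : L (f ^+ j.+1 * t) = 0.
  by move=> /dvdpP[t ->]; rewrite mulrC -[f]expr1; exact: H.
have [m] := ubnP (n - j); elim: m j t => // m IHm j t jm.
have [nj|jn] := leqP n j.
  by rewrite /L rmorphM -(subnK nj) -addnS exprD rmorphM /= spectrum_poly_nilp
    mulr0 mul0r mulmx0 mxtrace0.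
have IH t' : L (f ^+ j.+2 * t') = 0.
  by apply: IHm; rewrite subnSK// -ltnS.
have := coprimep_spectrum_poly_deriv y;
  rewrite -/f => /Bezout_eq1_coprimepP[[a b] /= ab].
(* By Bezout, the derivative of [f ^+ 2 * g] is [f ^+ j.+1 * t] up to a multiple of [f ^+ j.+2]. *)
pose g := f ^+ j * ((j.+2%:R)^-1 *: (b * t)).
have := sq g; rewrite -/f -/(L _).
have -> : (f ^+ 2 * g)^`() = f ^+ j.+1 * t +
    f ^+ j.+2 * (((j.+2%:R)^-1 *: (b * t))^`() - a * t).
  have bf : b * f^`() = 1 - a * f by rewrite -ab addrC addKr.
  have E : (f ^+ j.+2)^`() * (j.+2%:R^-1 *: (b * t)) =
      f ^+ j.+1 * t - f ^+ j.+2 * (a * t).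
    rewrite deriv_exp -scaler_nat -scalerAl -scalerAr scalerA divff
      ?pnatr_eq0//.
    rewrite scale1r /= [LHS](_ : _ = f ^+ j.+1 * (b * f^`()) * t); last by ring.
    by rewrite bf [f ^+ j.+2]exprS; ring.
  by rewrite /g mulrA -exprD add2n derivM E mulrBr addrAC addrA.
by rewrite LD IH addr0.
Qed.

End TraceVariation.

(** * Points of P with maximal spectrum are diagonalizable *)

Section GenericSemisimplicity.
Context {R : realType} {n : nat}.
Local Notation C := R[i].
Local Notation M := 'M[C]_n.+1.
Implicit Types (x y : M) (p q : {poly C}).

Lemma spectrum_poly_semisimple y : mxfun id y = y ->
  horner_mx y (spectrum_poly y) = 0.
Proof.
move=> ys; rewrite -[X in horner_mx X _]ys /mxfun horner_mx_comp.
apply: horner_mx_eq0 => c cs.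
have /dvdpP[q ->] : 'X - c%:P %| spectrum_poly y.
  by rewrite dvdp_XsubCl; apply/rootP; exact: spectrum_poly0.
rewrite comp_polyM; apply: dvdp_mull.
rewrite comp_polyB comp_polyX comp_polyC; exact: mxfun_polyP.
Qed.

(* For diagonalizable [y] the kernel and the image of [ad y] meet trivially. *)
Lemma semisimple_ad y a k : mxfun id y = y -> y * a - a * y = k ->
  y * k = k * y -> k = 0.
Proof.
move=> ys ak yk; have f0 := spectrum_poly_semisimple ys.
have pk p : horner_mx y p * k = k * horner_mx y p.
  elim/poly_ind: p => [|p c IHp]; first by rewrite rmorph0 mul0r mulr0.
  rewrite rmorphD rmorphM /= horner_mx_X horner_mx_C mulrDl mulrDr -mulrA yk.
  by rewrite mulrA IHp mulrA -!mulmxE scalar_mxC.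
(* As [k] commutes with [y], bracketing with [a] acts on polynomials in [y] like a derivation. For
   the squarefree polynomial f killing [y] this gives f'(y) k = 0, and f'(y) is invertible. *)
have ad p : horner_mx y p * a - a * horner_mx y p = horner_mx y p^`() * k.
  elim/poly_ind: p => [|p c IHp].
    by rewrite deriv0 !rmorph0 !mul0r mulr0 subrr.
  rewrite derivD derivM derivX derivC addr0 mulr1 !rmorphD !rmorphM /=
    horner_mx_X.
  rewrite horner_mx_C !mulrDl mulrDr -!mulmxE scalar_mxC opprD addrACA subrr
    addr0.
  rewrite !mulmxE; have -> : horner_mx y p * y * a - a * (horner_mx y p * y) =
      horner_mx y p * (y * a - a * y) +
        (horner_mx y p * a - a * horner_mx y p) * y.
    by rewrite mulrBr mulrBl !mulrA addrA subrK.
  by rewrite ak IHp -mulrA -yk addrC mulrA.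
have := coprimep_spectrum_poly_deriv y.
move=> /Bezout_eq1_coprimepP[[u v] /= uv].
have := congr1 (horner_mx y) uv;
  rewrite rmorphD !rmorphM rmorph1 /= f0 mulr0 add0r.
move=> /(congr1 ( *%R^~ k)) /=;
  rewrite mul1r -mulrA -ad f0 mul0r mulr0 subrr mulr0.
by [].
Qed.

Lemma invmx_horner y : y \in unitmx -> exists e, horner_mx y e = invmx y.
Proof.
move=> uy; have : coprimep (char_poly y) 'X.
  rewrite -['X]subr0 coprimep_XsubC char_poly_spectrum root_prod_XsubC.
  by apply/negP => /(spectrum_unit uy); rewrite eqxx.
move=> /Bezout_eq1_coprimepP[[a b] /= ab]; exists b.
have := congr1 (horner_mx y) ab;
  rewrite rmorphD !rmorphM rmorph1 /= Cayley_Hamilton.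
rewrite mulr0 add0r horner_mx_X => /(congr1 (mulmx^~ (invmx y))).
by rewrite -mulmxE mulmxK// mul1mx.
Qed.

Variables (G : set M) (theta : M -> M).
Hypotheses (Gred : reductive G) (htheta : involutive_automorphism G theta).
Let hG : algebraic_group G := Gred.1.
Local Notation P := (sym_space G theta).
Local Notation dth := (dtheta G theta).

Lemma sym_space_group y : P y -> G y /\ theta y = invmx y.
Proof.
move=> [g Gg <-]; have Gt := theta_group htheta Gg.
have ug := group_GL hG Gg; have ut := group_GL hG Gt.
split; first by apply: (groupM hG) => //; exact: (groupV hG).
rewrite (thetaM htheta Gg (groupV hG Gt)) (thetaV hG htheta Gt)
  (thetaK htheta Gg).
have uw : g *m invmx (theta g) \in unitmx by rewrite unitmx_mul ug unitmx_inv.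
rewrite -[LHS](mulmxK uw) -[RHS]mul1mx; congr (_ *m _).
by rewrite !mulmxA mulmxKV// mulmxV.
Qed.

Lemma generic_semisimple (S : M -> C) y : regularGL S -> P y -> S y != 0 ->
  (forall x, P x -> S x != 0 -> (spectrum_size x <= spectrum_size y)%N) ->
  mxfun id y = y.
Proof.
move=> gS Py Sy ymax; have [Gy ty] := sym_space_group Py.
have uy := group_GL hG Gy; have PGL : P `<=` [set x | x \in unitmx].
  by move=> x; exact: (sym_space_unitmx hG htheta).
have [Gs ts] := group_semisimple_part hG htheta Gy ty.
set s := mxfun id y in Gs ts *; set si := mxfun (fun c => c^-1) y in ts.
have us := group_GL hG Gs.
have ss : s * si = 1.
  rewrite mxfunM -(rmorph1 (horner_mx y));
    apply/esym/mxfunE => c /(spectrum_unit uy) c0.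
  by rewrite divff// subrr dvdp0.
have siE : si = invmx s.
  by rewrite -[LHS]mul1mx -(mulVmx us) -mulmxA mulmxE ss mulr1.
pose u := si * y.
have comm p q : horner_mx y p * horner_mx y q = horner_mx y q * horner_mx y p.
  by rewrite -!rmorphM mulrC.
have u1 : u - 1 = horner_mx y
  (mxfun_poly (fun c => c^-1) y * ('X - mxfun_poly id y)).
  by rewrite rmorphM rmorphB /= horner_mx_X mulrBr comm -/si -/s ss.
have Gu : G u by apply: (groupM hG) => //; rewrite siE; exact: (groupV hG).
have unil : (u - 1) ^+ n.+1 = 0.
  rewrite u1 -rmorphXn; apply: horner_mx_eq0 => c cs; rewrite exprMn;
    apply: dvdp_mull.
  apply: dvdp_exp2r; rewrite dvdp_XsubCl; apply/rootP.
  by rewrite hornerD hornerN hornerX mxfun_poly_horner// subrr.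
have tu : theta u *m u = 1%:M.
  have tsi : theta si = s by rewrite siE (thetaV hG htheta Gs) ts siE invmxK.
  have Gsi : G si by rewrite siE; exact: (groupV hG).
  have ysi : y * si = si * y.
    by have := comm 'X (mxfun_poly (fun c => c^-1) y); rewrite horner_mx_X.
  have vy : invmx y * y = 1 by rewrite -mulmxE mulVmx.
  have -> : theta u = s *m invmx y by rewrite -tsi -ty -(thetaM htheta Gsi Gy).
  by rewrite mulmxE /u -ysi -mulrA [invmx y * _]mulrA vy mul1r.
have [tnu dnu] := group_log Gred htheta Gu unil tu.
have [w1 [w2 [nu1 nu2]]] := unip_logE unil.
set nu := unip_log u in tnu dnu nu1 nu2.
(* Tangent vectors of P carry a factor y, which the inverse of y removes; as a polynomial in y it
   leaves nu y^-1 in the form that [trace_variation] accepts. *)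
have [e eE] := invmx_horner uy.
pose W := w1 \Po (mxfun_poly (fun c => c^-1) y * 'X).
pose q := mxfun_poly (fun c => c^-1) y * ('X - mxfun_poly id y) * W.
have nuE : nu = horner_mx y q.
  have uE : horner_mx y (mxfun_poly (fun c => c^-1) y * 'X) = u.
    by rewrite rmorphM /= horner_mx_X.
  by rewrite nu1 u1 -[in horner_mx u]uE horner_mx_comp -rmorphM.
have fq : spectrum_poly y %| q * e.
  apply/dvdp_mulr/dvdp_mulr/dvdp_mull/dvdp_spectrum_poly => c cs.
  by rewrite hornerD hornerN hornerX mxfun_poly_horner// subrr.
have nurad : trform_rad G theta nu.
  split=> // x tx; have tv := sym_space_tangent hG htheta Py tx.
  have := trace_variation PGL gS Py Sy ymax tv fq.
  have ce : nu *m invmx y = invmx y *m nu by rewrite -eE nuE; exact: comm.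
  have -> : horner_mx y (q * e) = nu *m invmx y by rewrite rmorphM /= -nuE eE.
  rewrite mulmxBl raddfB /= {1}ce /trform dnu mulNmx raddfN /= => tr0.
  rewrite -[RHS]tr0; congr (_ - _).
    by rewrite -[x *m y *m _]mulmxA [y *m _]mulmxA mulmxV// mul1mx mxtrace_mulC.
  by rewrite mxtrace_mulC -[y *m _ *m _]mulmxA [RHS]mxtrace_mulC -!mulmxA
    mulVmx// mulmx1.
(* The difference of the two traces is the trace of nu w2(u) g; the powers of u in w2(u) are
   absorbed into g, and [trform_rad_trace] applies. *)
have uker : trace_kernel G u.
  split=> // g Gg; apply/eqP;
    rewrite -subr_eq0 -raddfB /= -{2}[g]mul1mx -mulmxBl.
  rewrite -[1%:M]/(1 : M) nu2; apply/eqP.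
  elim/poly_ind: w2 g Gg {nu2} => [|w c IHw] g Gg.
    by rewrite rmorph0 mulr0 mul0mx mxtrace0.
  rewrite rmorphD rmorphM /= horner_mx_X horner_mx_C mulrDr mulmxDl mxtraceD.
  have -> : nu * (horner_mx u w * u) *m g = nu * horner_mx u w *m (u *m g).
    by rewrite -!mulmxE !mulmxA.
  rewrite IHw ?add0r; last exact: (groupM hG).
  rewrite -mulmxE scalar_mxC -mulmxA mul_scalar_mx mxtraceZ.
  by rewrite (trform_rad_trace Gred htheta nurad Gg) mulr0.
have u_1 := trace_kernel_trivial Gred uker.
rewrite -[RHS]mul1r -ss -mulrA -/u u_1; exact: esym (mulr1 _).
Qed.

Lemma sym_space_vanish (xi : M -> M) : regular_mx xi ->
  (forall y, P y -> y * xi y = xi y * y) ->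
  (forall y, P y -> exists a, y * a - a * y = y * xi y) ->
  forall y, P y -> xi y = 0.
Proof.
move=> rxi xiC xiad; have uP := sym_space_unitmx hG htheta.
(* Maximality is reached by induction on the room left below n + 1 eigenvalues; a single entry of
   [xi] provides the regular function that defines the open set. *)
suff H i j d y : P y -> xi y i j != 0 -> (n.+1 - spectrum_size y < d)%N ->
  False.
  move=> y Py; apply/matrixP => i j; rewrite mxE; apply/eqP/negPn/negP => xi0.
  exact: (H i j _ y Py xi0 (ltnSn _)).
elim: d y => // d IHd y Py xi0 yd.
have [ymax|] := pselect (forall x, P x -> xi x i j != 0 ->
    (spectrum_size x <= spectrum_size y)%N).
  have ys := generic_semisimple (rxi i j) Py xi0 ymax.
  have [a ya] := xiad _ Py.
  have : y * xi y = 0.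
    by apply: (semisimple_ad ys ya); rewrite [in LHS]xiC// mulrA.
  move=> /(congr1 (mulmx (invmx y)));
    rewrite -mulmxE mulmxA mulVmx ?mul1mx ?mulmx0; last exact: uP.
  by move=> x0; rewrite x0 mxE eqxx in xi0.
move=> /existsNP[x /not_implyP[Px /not_implyP[xix /negP]]];
  rewrite -ltnNge => yx.
rewrite ltnS in yd; apply: (IHd x Px xix); apply: leq_trans yd.
apply: (ltn_sub2l _ yx); apply: (leq_trans yx).
by rewrite -(size_spectrum x) size_undup.
Qed.

End GenericSemisimplicity.

Lemma sym_space_xi (R : realType) (N : nat) (G : set 'M[R[i]]_N)
    (theta : 'M[R[i]]_N -> 'M[R[i]]_N) (xi : 'M[R[i]]_N -> 'M[R[i]]_N) :
  reductive G -> involutive_automorphism G theta -> regular_mx xi ->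
  (forall y, sym_space G theta y -> y *m xi y = xi y *m y) ->
  (forall y, sym_space G theta y ->
     exists a, y *m a - a *m y = y *m xi y) ->
  forall y, sym_space G theta y -> xi y = 0.
Proof.
(* Polynomials in a matrix require positive size; in size 0 all matrices are equal. *)
case: N G theta xi => [|n] G theta xi Gred htheta rxi xiC xiad y Py.
  by apply/matrixP => -[].
exact: (sym_space_vanish Gred htheta rxi xiC xiad Py).
Qed.

(** * Flat vector fields *)

Section FlatFields.
Context {R : realType} {N : nat}.
Local Notation C := R[i].
Local Notation M := 'M[C]_N.
Variables (G : set M) (theta : M -> M).
Hypotheses (Gred : reductive G) (htheta : involutive_automorphism G theta).
Let hG : algebraic_group G := Gred.1.
Local Notation P := (sym_space G theta).
Local Notation K := (fixed_group G theta).
Local Notation dth := (dtheta G theta).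
Local Notation CP := (coord_ring P).
Local Notation flat := (@flat_map R N G theta).
Implicit Types (Phi Psi : P -> M) (f g : CP) (y z : P).

Lemma sym_space_GL : P `<=` [set x | x \in unitmx].
Proof. by move=> x; exact: (sym_space_unitmx hG htheta). Qed.

Lemma sym_space_unit y : val y \in unitmx.
Proof. exact: sym_space_GL (coord_set_val y). Qed.

Definition ext Phi (x : M) : M := \matrix_(i, j) extend (fun z => Phi z i j) x.

Lemma regular_mx_ext Phi : regular_mx (ext Phi).
Proof. by move=> i j; under eq_fun do rewrite mxE; exact: regularGL_extend. Qed.

Lemma extE Phi y : regular_map Phi -> ext Phi (val y) = Phi y.
Proof.
by move=> rP; apply/matrixP => i j; rewrite mxE;
  have [_ ->] := extendP (rP i j).
Qed.

Lemma diffmxE Phi (x v : M) : Defs.diffmx Phi x v = jac (ext Phi) x v.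
Proof.
apply/matrixP => i j; rewrite jacE mxE dirDE; congr (lineD _ _ _).
by apply/funext => w; rewrite mxE.
Qed.

Definition flow Phi (x : M) : M := x *m ext Phi x.

Lemma regular_mx_flow Phi : regular_mx (flow Phi).
Proof. by apply: regular_mxM; [exact: regular_mxid|exact: regular_mx_ext]. Qed.

Lemma half_double (x : M) : 2^-1 *: (x + x) = x.
Proof.
rewrite -{1 2}[x]scale1r -scalerDl scalerA mulVf ?scale1r//.
by rewrite pnatr_eq0.
Qed.

Lemma flat_comm Phi y : flat Phi -> val y *m Phi y = Phi y *m val y.
Proof. by move=> [_ _ _ h]; rewrite -[in RHS]h mulmxKV// sym_space_unit. Qed.

Lemma flat_proj Phi y : flat Phi -> proj_at G theta (val y) (Phi y) = Phi y.
Proof.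
move=> hP; have [_ /(_ y)[_ dP] _ _] := hP; rewrite /proj_at /theta_at dP.
rewrite mulmxN mulNmx opprK -mulmxA -(flat_comm y hP) mulKmx ?sym_space_unit//.
exact: half_double.
Qed.

Lemma flat_tangent Phi y : flat Phi -> tangent P (val y) (val y *m Phi y).
Proof.
move=> hP; have [_ /(_ y)[tP dP] _ _] := hP.
(* The orbit direction of x = Phi / 2 is (Phi y + y Phi) / 2, which equals y Phi because Phi
   commutes with y. *)
have := sym_space_tangent hG htheta (coord_set_val y) (LieZ hG 2^-1 tP).
rewrite dthetaZ dP scalerN mulmxN opprK -scalemxAl -scalemxAr -(flat_comm y hP).
by rewrite -scalerDr half_double.
Qed.

Lemma flow_tangent Phi (x : M) : flat Phi -> P x -> tangent P x (flow Phi x).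
Proof.
move=> hP Px; have [rP _ _ _] := hP.
have := flat_tangent (mkA Px) hP.
by rewrite -(extE _ rP).
Qed.

Lemma flowE Phi y : flat Phi -> flow Phi (val y) = val y *m Phi y.
Proof. by move=> [rP _ _ _]; rewrite /flow extE. Qed.

Lemma tilde_vfield Phi : flat Phi -> tilde Phi = vfield (flow Phi).
Proof.
move=> hP; apply/funext => f; rewrite vfield.unlock.
apply: (congr1 (fun h : P -> C => to_coord h)); apply/funext => y.
by rewrite (flat_proj y hP) (flowE y hP).
Qed.

Lemma flat_tildeE Phi f y : flat Phi ->
  tilde Phi f y = dirD (extend f) (val y) (val y *m Phi y).
Proof.
move=> hP; rewrite tilde_vfield//.
rewrite (vfieldE sym_space_GL (@regular_mx_flow Phi)
  (fun x => @flow_tangent Phi x hP)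
  y (regularGL_extend f) (extend_coordE f)).
by rewrite flowE.
Qed.

Lemma flow_commute Phi Psi : flat Phi -> flat Psi -> forall y,
  let v := val y *m Psi y in
  val y *m Defs.diffmx Phi (val y) v - Defs.diffmx Phi (val y) v *m val y =
  val y *m (Phi y *m Psi y - Psi y *m Phi y).
Proof.
move=> hP hQ y v; have [rP _ _ _] := hP; have uy := sym_space_unit y.
rewrite diffmxE; have re := @regular_mx_ext Phi; have rid := @regular_mxid R N.
have : jac (fun x => x *m ext Phi x) (val y) v =
  jac (fun x => ext Phi x *m x) (val y) v.
  apply: (jac_tangent sym_space_GL) => //; first exact: coord_set_val.
  - exact: flat_tangent.
  - exact: regular_mxM.
  - exact: regular_mxM.
  - by move=> x Px; rewrite -[x]/(val (mkA Px)) extE// flat_comm.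
rewrite !jacM// jacid extE// => E; set D := jac (ext Phi) _ _ in E *.
have EP : Phi y *m v = v *m Phi y + val y *m D - D *m val y.
  by rewrite E addrC addKr.
have -> : val y *m (Phi y *m Psi y - Psi y *m Phi y) = Phi y *m v - v *m Phi y.
  by rewrite mulmxBr !mulmxA flat_comm.
by rewrite EP -[v *m _ + _ - _]addrA [RHS]addrAC subrr add0r.
Qed.

Lemma flat_maps_commute Phi Psi : flat Phi -> flat Psi ->
  forall y, Phi y *m Psi y = Psi y *m Phi y.
Proof.
move=> hP hQ y; have [rP _ _ _] := hP; have [rQ _ _ _] := hQ.
apply/eqP; rewrite -subr_eq0; apply/eqP.
pose xi (x : M) := ext Phi x *m ext Psi x - ext Psi x *m ext Phi x.
have xiE z : xi (val z) = Phi z *m Psi z - Psi z *m Phi z by rewrite /xi !extE.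
rewrite -xiE; apply: (sym_space_xi Gred htheta) => [|x Px|x Px|].
- by apply: regular_mxB; apply: regular_mxM; exact: regular_mx_ext.
- rewrite -[x]/(val (mkA Px)) xiE mulmxBr mulmxBl !mulmxA !flat_comm//.
  by rewrite -!mulmxA !flat_comm.
- exists (Defs.diffmx Phi x (x *m Psi (mkA Px))).
  by rewrite -[x]/(val (mkA Px)) flow_commute// xiE.
- exact: coord_set_val.
Qed.

Lemma flat_diff_comm Phi Psi y : flat Phi -> flat Psi ->
  val y *m Defs.diffmx Phi (val y) (val y *m Psi y) =
  Defs.diffmx Phi (val y) (val y *m Psi y) *m val y.
Proof.
move=> hP hQ; have := flow_commute hP hQ y.
by rewrite (flat_maps_commute hP hQ y) subrr mulmx0 => /eqP;
  rewrite subr_eq0 => /eqP.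
Qed.

(** Linear equations satisfied by all values of [Phi] pass to its derivatives along P; they are
    those of the Lie algebra and of the -1 eigenspace. *)
Lemma tangent_scalar_linear (L : M -> C) Phi y (v : M) : scalar_linear L ->
  regular_map Phi -> (forall z, L (Phi z) = 0) -> tangent P (val y) v ->
  L (Defs.diffmx Phi (val y) v) = 0.
Proof.
move=> Llin rP L0 /tangentP tv; have re := @regular_mx_ext Phi.
rewrite diffmxE -(dirD_linear_comp _ Llin re (sym_space_unit y)).
apply: tv => [|x Px]; first exact: regularGL_linear.
by rewrite -[x]/(val (mkA Px)) extE.
Qed.

Lemma p_space_diff Phi y (v : M) : flat Phi -> tangent P (val y) v ->
  p_space G theta (Defs.diffmx Phi (val y) v).
Proof.
move=> hP tv; have [rP pP _ _] := hP; split.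
  apply/tangentP => F gF F0.
  apply: (@tangent_scalar_linear (dirD F 1%:M)) => // [a u w|z].
    by apply: dirD_linear => //; exact: unitmx1.
  by have [/tangentP tz _] := pP z; exact: tz.
apply/eqP; rewrite -addr_eq0; apply/eqP/matrixP => i j; rewrite [RHS]mxE.
apply: (@tangent_scalar_linear (fun x => (dth x + x) i j)) => // [a u w|z].
  by rewrite dtheta_linear addrACA -scalerDr mxE [X in X + _]mxE.
by have [_ ->] := pP z; rewrite addNr mxE.
Qed.

Lemma p_space_linear (a : C) (x w : M) : p_space G theta x ->
  p_space G theta w ->
  p_space G theta (a *: x + w).
Proof.
move=> [tx dx] [tw dw]; split; first exact: Lie_linear.
by rewrite dtheta_linear dx dw opprD scalerN.
Qed.

Lemma diff_equivariant Phi y (k v : M) : flat Phi -> K k ->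
  tangent P (val y) v ->
  Defs.diffmx Phi (val (kact k y)) (k *m v *m invmx k) =
  k *m Defs.diffmx Phi (val y) v *m invmx k.
Proof.
move=> hP Kk tv; have [rP _ eP _] := hP; have uy := sym_space_unit y.
have rc := @regular_mxc R N; have re := @regular_mx_ext Phi.
rewrite !diffmxE (kactE hG htheta _ Kk) -jac_mulmx2.
rewrite (jac_tangent sym_space_GL (W :=
  fun x => k *m ext Phi x *m invmx k) (coord_set_val y) tv).
- rewrite jacM//; last by apply: regular_mxM.
  by rewrite jacM// !jacc mul0mx add0r mulmx0 addr0.
- exact: regular_mx_mulmx2.
- by apply: regular_mxM => //; exact: regular_mxM.
- move=> x Px; rewrite -[x]/(val (mkA Px)) -(kactE hG htheta _ Kk) !extE//.
  exact: eP.
Qed.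

Lemma circledast_flat Phi Psi : flat Phi -> flat Psi ->
  flat (circledast Phi Psi).
Proof.
move=> hP hQ; have [rP pP eP cP] := hP; have [rQ pQ eQ cQ] := hQ.
split.
- move=> i j.
  have [H1 g1 E1] := regularGL_dirD (@regular_mx_ext Psi i j)
    (@regular_mx_flow Phi).
  have [H2 g2 E2] := regularGL_dirD (@regular_mx_ext Phi i j)
    (@regular_mx_flow Psi).
  exists (fun x => H1 x - H2 x); first exact: regularGLB.
  move=> y; rewrite E1 ?E2 ?sym_space_unit// !flowE// -!jacE -!diffmxE.
  by rewrite /circledast mxE [X in _ + X]mxE.
- move=> y; rewrite /circledast addrC -scaleN1r.
  by apply: p_space_linear; apply: p_space_diff => //; exact: flat_tangent.
- move=> k y Kk; have uk := group_GL hG Kk.1.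
  have E Ph : flat Ph -> val (kact k y) *m Ph (kact k y) =
    k *m (val y *m Ph y) *m invmx k.
    move=> [_ _ e _]; rewrite (kactE hG htheta _ Kk) (e _ _ Kk) !mulmxA
      mulmxKV//.
  rewrite /circledast !E// !diff_equivariant//; try exact: flat_tangent.
  by rewrite mulmxBr mulmxBl.
- move=> y; have uy := sym_space_unit y.
  have -> : val y *m circledast Phi Psi y = circledast Phi Psi y *m val y.
    rewrite /circledast mulmxBr mulmxBl; congr (_ - _).
      exact: (flat_diff_comm y hQ hP).
    exact: (flat_diff_comm y hP hQ).
  exact: mulmxK.
Qed.

Lemma tilde_bracket Phi Psi : flat Phi -> flat Psi ->
  lie_bracket (tilde Phi) (tilde Psi) = tilde (circledast Phi Psi).
Proof.
move=> hP hQ; have hZ := circledast_flat hP hQ.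
apply/funext => f; rewrite /lie_bracket !tilde_vfield//.
apply: vfield_bracket => //; try exact: regular_mx_flow.
- exact: sym_space_GL.
- by move=> x Px; exact: flow_tangent.
- by move=> x Px; exact: flow_tangent.
- by move=> x Px; exact: flow_tangent.
move=> x Px; rewrite -[x]/(val (mkA Px)) !flowE//; set y := mkA Px.
have rid := @regular_mxid R N; have uy := sym_space_unit y.
have J Ph w : flat Ph -> jac (flow Ph) (val y) w =
    w *m Ph y + val y *m Defs.diffmx Ph (val y) w.
  move=> [rp _ _ _]; rewrite jacM//; last exact: regular_mx_ext.
  by rewrite jacid extE// diffmxE.
(* The terms of the product rule that do not differentiate the maps cancel because the values
   commute. *)
have E0 : val y *m Phi y *m Psi y - val y *m Psi y *m Phi y = 0.
  by rewrite -!mulmxA (flat_maps_commute hP hQ y) subrr.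
rewrite (J _ _ hP) (J _ _ hQ) opprD addrACA E0 add0r /circledast.
exact: mulmxBr.
Qed.

End FlatFields.

(** * Invariance and module structure of the flat fields *)

Section FlatSubmodule.
Context {R : realType} {N : nat}.
Local Notation C := R[i].
Local Notation M := 'M[C]_N.
Variables (G : set M) (theta : M -> M).
Hypotheses (Gred : reductive G) (htheta : involutive_automorphism G theta).
Let hG : algebraic_group G := Gred.1.
Local Notation P := (sym_space G theta).
Local Notation K := (fixed_group G theta).
Local Notation CP := (coord_ring P).
Local Notation flat := (@flat_map R N G theta).
Implicit Types (Phi Psi : P -> M) (f g : CP) (y z : P).

Lemma pullback_coordE (k : M) f y : K k -> pullback k f y = f (kact k y).
Proof. exact: (pullbackE hG htheta). Qed.

Lemma tilde_invariant Phi : flat Phi ->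
  @invariant_vector_fields R N G theta (tilde Phi).
Proof.
move=> hP; have PGL := sym_space_GL Gred htheta.
have rW := @regular_mx_flow _ _ _ _ Phi.
have tW x : P x -> tangent P x (flow Phi x)
  by exact: (flow_tangent Gred htheta hP).
have tE := tilde_vfield Gred htheta hP.
split; first by split=> [a f g|f g]; rewrite tE;
  [exact: vfield_linear|exact: vfield_mul].
move=> k f Kk; apply: coord_inj => y; rewrite (pullback_coordE _ _ Kk).
rewrite [RHS](flat_tildeE Gred htheta f (kact k y) hP) tE.
have gF : regularGL (fun x : M => extend f (k *m x *m invmx k)).
  by apply: regularGL_mulmx2; exact: regularGL_extend.
rewrite (vfieldE PGL rW tW y gF) => [|z]; last first.
  by rewrite (pullback_coordE _ _ Kk) extend_coordE (kactE hG htheta _ Kk).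
rewrite dirD_mulmx2 (flowE y hP) (kactE hG htheta _ Kk).
have [_ _ e _] := hP; rewrite (e _ y Kk); congr (dirD _ _ _).
by rewrite !mulmxA mulmxKV//; exact: (group_GL hG Kk.1).
Qed.

Lemma flat_map_linear (a : C) Phi Psi : flat Phi -> flat Psi ->
  flat (fun y => a *: Phi y + Psi y).
Proof.
move=> [rP pP eP cP] [rQ pQ eQ cQ]; split.
- move=> i j; have [F gF FE] := rP i j; have [H gH HE] := rQ i j.
  exists (fun x => a * F x + H x); last by move=> y; rewrite !mxE FE HE.
  by apply: regularGL_add => //; exact: regularGLZ.
- by move=> y; exact: (p_space_linear Gred).
- move=> k y Kk; rewrite eP// eQ// mulmxDr mulmxDl.
  by rewrite -scalemxAr -scalemxAl.
- move=> y; rewrite mulmxDr mulmxDl cQ -scalemxAr -scalemxAl.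
  by rewrite cP.
Qed.

Lemma flat_map0 : flat (fun=> 0).
Proof.
split.
- move=> i j; exists (fun=> 0); first exact: regularGL_const.
  by move=> y; rewrite mxE.
- by move=> y; split; [exact: Lie0|rewrite dtheta0 oppr0].
- by move=> k y _; rewrite mulmx0 mul0mx.
- by move=> y; rewrite mulmx0 mul0mx.
Qed.

Lemma flat_map_scale g Phi : @invariants R N G theta g -> flat Phi ->
  flat (fun y => g y *: Phi y).
Proof.
move=> ig [rP pP eP cP]; split.
- move=> i j; have [F gF FE] := rP i j.
  exists (fun x => extend g x * F x);
    last by move=> y; rewrite mxE FE extend_coordE.
  by apply: regularGL_mul => //; exact: regularGL_extend.
- move=> y; rewrite -[_ *: _]addr0; apply: (p_space_linear Gred) => //.
  by split; [exact: Lie0|rewrite dtheta0 oppr0].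
- move=> k y Kk; rewrite eP// -(pullback_coordE _ _ Kk) ig//.
  by rewrite -scalemxAr -scalemxAl.
- by move=> y; rewrite -scalemxAr -scalemxAl cP.
Qed.

Lemma tilde_linear (a : C) Phi Psi f : flat Phi -> flat Psi ->
  tilde (fun y => a *: Phi y + Psi y) f = a *: tilde Phi f + tilde Psi f.
Proof.
move=> hP hQ; have hL := flat_map_linear a hP hQ.
apply: coord_inj => y; rewrite coordD coordZ.
rewrite [LHS](flat_tildeE Gred htheta f y hL).
rewrite [X in _ = _ * X + _](flat_tildeE Gred htheta f y hP).
rewrite [X in _ = _ + X](flat_tildeE Gred htheta f y hQ) mulmxDr -scalemxAr.
exact: (dirD_linear _ _ _ (regularGL_extend f) (sym_space_unit Gred htheta y)).
Qed.

Lemma tilde0 f : tilde (fun=> 0 : M) f = 0 :> CP.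
Proof.
apply: coord_inj => y; rewrite (flat_tildeE Gred htheta f y flat_map0) mulmx0.
exact: (dirD0 (regularGL_extend f) (sym_space_unit Gred htheta y)).
Qed.

Lemma tilde_scale g Phi f : @invariants R N G theta g -> flat Phi ->
  tilde (fun y => g y *: Phi y) f = g * tilde Phi f.
Proof.
move=> ig hP; have hL := flat_map_scale ig hP.
apply: coord_inj => y; rewrite coordM.
rewrite [LHS](flat_tildeE Gred htheta f y hL).
rewrite [X in _ = _ * X](flat_tildeE Gred htheta f y hP) -scalemxAr.
exact: (dirDZ _ _ (regularGL_extend f) (sym_space_unit Gred htheta y)).
Qed.

End FlatSubmodule.

Theorem proposition3p3 (R : realType) (N : nat)
    (G : set 'M[R[i]]_N) (theta : 'M[R[i]]_N -> 'M[R[i]]_N)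
    (Gred : reductive G) (Gconn : zariski_connected G)
    (htheta : involutive_automorphism G theta) :
  submodule (@invariants R N G theta)
    (@flat_vector_fields R N G theta) (@invariant_vector_fields R N G theta) /\
  (forall Phi Psi : sym_space G theta -> 'M[R[i]]_N,
     flat_map Phi -> flat_map Psi ->
     flat_map (circledast Phi Psi) /\
     lie_bracket (tilde Phi) (tilde Psi) = tilde (circledast Phi Psi)) /\
  lie_subalgebra
    (@flat_vector_fields R N G theta) (@invariant_vector_fields R N G theta).
Proof.
have sub X : @flat_vector_fields R N G theta X ->
    @invariant_vector_fields R N G theta X.
  by move=> [Phi hP ->]; exact: (tilde_invariant Gred htheta hP).
have zero : @flat_vector_fields R N G theta (fun=> 0).
  exists (fun=> 0); first exact: flat_map0.
  by apply/funext => f; rewrite (tilde0 Gred htheta).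
have lin (a : R[i]) X Y : @flat_vector_fields R N G theta X ->
    @flat_vector_fields R N G theta Y ->
    @flat_vector_fields R N G theta (fun f => a *: X f + Y f).
  move=> [Phi hP ->] [Psi hQ ->]; exists (fun y => a *: Phi y + Psi y).
    exact: (flat_map_linear Gred).
  by apply/funext => f; rewrite (tilde_linear Gred htheta).
have bracket (Phi Psi : sym_space G theta -> 'M[R[i]]_N) :
    flat_map Phi -> flat_map Psi ->
    flat_map (circledast Phi Psi) /\
    lie_bracket (tilde Phi) (tilde Psi) = tilde (circledast Phi Psi).
  move=> hP hQ; split; first exact: (circledast_flat Gred htheta hP hQ).
  exact: (tilde_bracket Gred htheta hP hQ).
split; last split; first last.
- split=> // X Y [Phi hP ->] [Psi hQ ->].
  by have [hZ ->] := bracket _ _ hP hQ; exists (circledast Phi Psi).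
- exact: bracket.
split=> // [X Y hX hY|g X ig [Phi hP ->]].
  have := lin 1 X Y hX hY; congr flat_vector_fields.
  by apply/funext => f; rewrite scale1r.
exists (fun y => g y *: Phi y); first exact: (flat_map_scale Gred htheta ig hP).
by apply/funext => f; rewrite (tilde_scale Gred htheta).
Qed.
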